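(* We have $$\mathcal{R}=\mathcal{R}^++\mathcal{R}^-\quad\text{and}\quad\mathcal{R}^+\cap\mathcal{R}^-=\{0\}.$$ Moreover, for each $T>0$, $\mathcal{R}|_Q:=\{f|_Q: f\in\mathcal{R}\}=\mathcal{H}^+_T(Q)+\mathcal{H}^-_T(Q)$, which is a reproducing kernel Hilbert space on $Q$ with reproducing kernel $$2\mathcal{K}_\ell(z,w;T)+2\mathcal{K}_\ell(z+1,w+1;T),\qquad z,w\in Q,$$ when endowed with the norm given by $$\|f\|^2=\min\{\|f_1\|^2_{\mathcal{H}^+_T(Q)}+\|f_2\|^2_{\mathcal{H}^-_T(Q)}:\ f=f_1+f_2,\ f_1\in\mathcal{H}^+_T(Q),\ f_2\in\mathcal{H}^-_T(Q)\}.$$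
   Context: Identify $\mathbb{R}^2$ with $\mathbb{C}$. Let $Q=\{x+iy: |y|<x,\ |y|<1-x\}$, $Q_\infty=\bigcup_{n\in\mathbb{Z}}(n+Q)$ and $D=\{x+iy: |y|<x,\ |y|<2-x\}$ (so $Q\subset D$ and $1+Q\subset D$). $L^2_{\mathbb{C}}(0,T)$ is the space of complex-valued square integrable functions on $(0,T)$. Kernels: $$\mathcal{K}_0(z,w;T)=\frac{z\overline{w}}{\pi}e^{-\frac{z^2+\overline{w}^2}{4T}}\left(\frac{1}{(z^2+\overline{w}^2)^2}+\frac{1}{4T(z^2+\overline{w}^2)}\right)$$ whenever $z^2+\overline{w}^2\neq 0$, and $\mathcal{K}_\ell(z,w;T)=\sum_{m,n\in\mathbb{Z}}\mathcal{K}_0(z+2n,w+2m;T)$ for $z,w\in D$. $\mathcal{H}^{+}_T(Q)$ and $\mathcal{H}^-_T(Q)$ are the reproducing kernel Hilbert spaces of analytic functions on $Q$ with reproducing kernels, respectively, $$\mathcal{K}_\pm(z,w;T)=\mathcal{K}_\ell(z,w;T)+\mathcal{K}_\ell(z+1,w+1;T)\pm\mathcal{K}_\ell(z+1,w;T)\pm\mathcal{K}_\ell(z,w+1;T),\quad z,w\in Q.$$ Heat kernel: $K(x,t)=\frac{1}{\sqrt{4\pi t}}e^{-x^2/(4t)}$ for $t>0$; $\theta(x,t)=\sum_{n\in\mathbb{Z}}K(x+2n,t)$; for $z\in\mathbb{C}$, $(\partial_xK)(z,t)=-\frac{z}{4\sqrt{\pi}\,t^{3/2}}e^{-z^2/(4t)}$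 and $(\partial_x\theta)(z,t)=\sum_{n\in\mathbb{Z}}(\partial_xK)(z+2n,t)$. Control system: $\partial_tw-\partial_{xx}w=0$ for $0<x<1$, $0<t<T$; $w(0,t)=u_\ell(t)$, $w(1,t)=u_r(t)$ for $0<t<T$; $w(x,0)=0$ for $0<x<1$. For $u_\ell,u_r\in L^2_{\mathbb{C}}(0,T)$ its solution is the unique $w\in C([0,T],W^{-1,2}(0,1))$ given by $$w(x,t)=-2\int_0^t(\partial_x\theta)(x,t-\tau)u_\ell(\tau)\,d\tau+2\int_0^t(\partial_x\theta)(x-1,t-\tau)u_r(\tau)\,d\tau.$$ $\mathcal{R}_T$ is the set of all $w(\cdot,T)$ where $w$ is the solution with controls $u_\ell,u_r\in L^2_{\mathbb{C}}(0,T)$; $\mathcal{R}^+_T$ (respectively $\mathcal{R}^-_T$) is the subset obtained with $u_r=-u_\ell$ (respectively $u_r=u_\ell$). These spaces do not depend on $T>0$ and are denoted $\mathcal{R},\mathcal{R}^+,\mathcal{R}^-$. Their elements are identified with their analytic extensions from $(0,1)$ to $Q_\infty$ given by the same integral formula with $x$ replaced by $z\in Q_\infty$. *)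

(* Defs.v *)
From HB Require Import structures.
From mathcomp Require Import all_boot all_order all_algebra.
From mathcomp Require Import all_classical all_reals all_analysis.
From mathcomp Require Export complex.

Set Implicit Arguments.
Unset Strict Implicit.
Unset Printing Implicit Defensive.

Import Order.TTheory GRing.Theory Num.Theory.
Import numFieldNormedType.Exports.

Local Open Scope classical_set_scope.
Local Open Scope complex_scope.
Local Open Scope ring_scope.

(* The complex numbers are R[i], for an arbitrary R : realType; R[i]^o is R[i]
   with its structure of normed module over itself. *)

Section complex_analysis.
Context {R : realType}.
Local Notation C := (R[i]).

Definition cexp (z : C) : C :=
  (expR (complex.Re z))%:C * (cos (complex.Im z) +i* sin (complex.Im z)).

(* Sum of an absolutely convergent family (the value is junk otherwise). *)
Definition rsum (I : choiceType) (f : I -> R) : R :=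
  fine (\esum_(i in [set: I]) ((EFin \o f)^\+ i)
        - \esum_(i in [set: I]) ((EFin \o f)^\- i))%E.

Definition csum (I : choiceType) (f : I -> C) : C :=
  rsum (fun i => complex.Re (f i)) +i* rsum (fun i => complex.Im (f i)).

Definition cintegral (D : set R) (f : R -> C) : C :=
  (\int[lebesgue_measure]_(t in D) complex.Re (f t)) +i*
  (\int[lebesgue_measure]_(t in D) complex.Im (f t)).

(* Representatives of the classes in L^2_C(0, T). *)
Definition L2C (T : R) : set (R -> C) :=
  [set u : R -> C | [/\ measurable_fun `]0, T[ (fun t => complex.Re (u t)),
                        measurable_fun `]0, T[ (fun t => complex.Im (u t))
                      & lebesgue_measure.-integrable `]0, T[
                          (fun t => (complex.Re (u t) ^+ 2 +
                                     complex.Im (u t) ^+ 2)%:E)]].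

(* Complex differentiability at every point of A, for an open set A; the
   extension of f by 0 outside A is then irrelevant. *)
Definition analytic (A : set C) (f : A -> C) : Prop :=
  forall z : C, A z -> derivable ('valL_ 0 f : C^o -> C^o) z 1.

End complex_analysis.

Section hilbert_spaces_of_functions.
Context {R : realType}.
Local Notation C := (R[i]).

(* The inner product is linear in its first argument; its values outside the
   carrier are irrelevant.  In the partial order of R[i], 0 <= x states that x
   is real and nonnegative. *)
Record hilbert_fun (X : Type) := HilbertFun {
  hcarrier : set (X -> C^o) ;
  hip : (X -> C^o) -> (X -> C^o) -> C ;
  hcarrier0 : hcarrier 0 ;
  hcarrier_lin : forall a f g,
    hcarrier f -> hcarrier g -> hcarrier (a *: f + g) ;
  hip_lin : forall a f g h, hcarrier f -> hcarrier g -> hcarrier h ->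
    hip (a *: f + g) h = a * hip f h + hip g h ;
  hip_conj : forall f g, hcarrier f -> hcarrier g -> hip g f = (hip f g)^* ;
  hip_ge0 : forall f, hcarrier f -> 0 <= hip f f ;
  hip_eq0 : forall f, hcarrier f -> hip f f = 0 -> f = 0 ;
  hcomplete : forall u : nat -> X -> C^o, (forall n, hcarrier (u n)) ->
    (forall e : R, 0 < e -> exists N, forall m n, (N <= m)%N -> (N <= n)%N ->
       Num.sqrt (complex.Re (hip (u m - u n) (u m - u n))) < e) ->
    exists2 f, hcarrier f &
      Num.sqrt (complex.Re (hip (u n - f) (u n - f))) @[n --> \oo] --> (0 : R)
}.

Definition hnorm (X : Type) (H : hilbert_fun X) (f : X -> C^o) : R :=
  Num.sqrt (complex.Re (hip H f f)).

Definition reproducing_kernel (X : Type) (H : hilbert_fun X)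
    (k : X -> X -> C) : Prop :=
  forall w, hcarrier H (k^~ w) /\
    forall f, hcarrier H f -> f w = hip H f (k^~ w).

(* "H is the reproducing kernel Hilbert space of analytic functions on A with
   kernel k": the carrier and the inner product of H are determined by k. *)
Definition analytic_rkhs (A : set C) (k : A -> A -> C)
    (H : hilbert_fun A) : Prop :=
  (forall f, hcarrier H f -> analytic f) /\ reproducing_kernel H k.

Definition decomposition_norms (X : Type) (H1 H2 : hilbert_fun X)
    (f : X -> C^o) : set R :=
  [set r | exists f1 f2, [/\ hcarrier H1 f1, hcarrier H2 f2, f = f1 + f2 &
                             r = hnorm H1 f1 ^+ 2 + hnorm H2 f2 ^+ 2]].

Definition is_min (A : set R) (m : R) : Prop := A m /\ lbound A m.

End hilbert_spaces_of_functions.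

Section heat.
Context {R : realType}.
Local Notation C := (R[i]).

Definition Q : set C :=
  [set z | `|complex.Im z| < complex.Re z /\
           `|complex.Im z| < 1 - complex.Re z].

Definition Qinf : set C := [set z | exists n : int, Q (z - n%:~R)].

Lemma Q_sub_Qinf : Q `<=` Qinf.
Proof. by move=> z Qz; exists 0; rewrite subr0. Qed.

Definition Q_to_Qinf (z : Q) : Qinf :=
  SigSub (mem_set (Q_sub_Qinf (set_valP z))).

Definition restrictQ (f : Qinf -> C) : Q -> C := f \o Q_to_Qinf.

Definition K0 (T : R) (z w : C) : C :=
  z * w^* / (pi : R)%:C * cexp (- ((z ^+ 2 + w^* ^+ 2) / (4 * T%:C)))
  * (((z ^+ 2 + w^* ^+ 2) ^+ 2)^-1 + (4 * T%:C * (z ^+ 2 + w^* ^+ 2))^-1).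

Definition Kl (T : R) (z w : C) : C :=
  csum (fun mn : int * int => K0 T (z + 2 * mn.2%:~R) (w + 2 * mn.1%:~R)).

Definition Kplus (T : R) (z w : C) : C :=
  Kl T z w + Kl T (z + 1) (w + 1) + Kl T (z + 1) w + Kl T z (w + 1).

Definition Kminus (T : R) (z w : C) : C :=
  Kl T z w + Kl T (z + 1) (w + 1) - Kl T (z + 1) w - Kl T z (w + 1).

(* Derivative in x of the heat kernel (4 pi t)^(-1/2) exp (- x^2 / (4 t)),
   extended to complex x. *)
Definition dxK (z : C) (t : R) : C :=
  - (z / (4 * Num.sqrt pi * t `^ (3 / 2))%:C)
  * cexp (- (z ^+ 2 / (4 * t)%:C)).

Definition dxtheta (z : C) (t : R) : C :=
  csum (fun n : int => dxK (z + 2 * n%:~R) t).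

(* Value at (z, t) of the (analytically extended) solution of the heat equation
   on (0, 1) with zero initial state and boundary controls ul, ur. *)
Definition heat_solution (ul ur : R -> C) (z : C) (t : R) : C :=
  - 2 * cintegral `]0, t[ (fun s => dxtheta z (t - s) * ul s)
  + 2 * cintegral `]0, t[ (fun s => dxtheta (z - 1) (t - s) * ur s).

Definition final_state (T : R) (ul ur : R -> C) : Qinf -> C :=
  fun z => heat_solution ul ur (set_val z) T.

Definition reach (T : R) : set (Qinf -> C) :=
  [set f | exists ul ur, [/\ L2C T ul, L2C T ur & f = final_state T ul ur]].

Definition reach_plus (T : R) : set (Qinf -> C) :=
  [set f | exists ul ur, [/\ L2C T ul, L2C T ur, ur = - ul
                           & f = final_state T ul ur]].

Definition reach_minus (T : R) : set (Qinf -> C) :=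
  [set f | exists ul ur, [/\ L2C T ul, L2C T ur, ur = ul
                           & f = final_state T ul ur]].

Definition on_Q (k : C -> C -> C) : Q -> Q -> C :=
  fun z w => k (set_val z) (set_val w).

End heat.

(* Main.v *)
Require Import Defs.
From mathcomp Require Import all_boot all_order all_algebra.
From mathcomp Require Import all_classical all_reals all_analysis.
From mathcomp Require Import measurable_realfun ring lra.
Import Order.TTheory GRing.Theory Num.Theory.
Import numFieldNormedType.Exports.
Local Open Scope classical_set_scope.
Local Open Scope complex_scope.
Local Open Scope ring_scope.
Set Implicit Arguments.
Unset Strict Implicit.
Unset Printing Implicit Defensive.

(** The theorem follows from one observation: the state at z is the inner product
    of the control with a function of time depending on z, and the Gram kernel
    of these functions is the given one.

    Spaces.  For functions e_z in a Hilbert space, the maps z |-> <u, e_z> form,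
    with the quotient norm, the reproducing kernel Hilbert space of the kernel
    <e_w, e_z> (feature_space).  A kernel determines its space
    (reproducing_kernel_carrier), and applying the same construction to a direct
    sum shows that the sum of two such spaces, with the norm of the minimal
    decomposition, has the sum of the kernels for kernel
    (reproducing_kernel_sum).  The Hilbert space used is that of the square
    integrable functions on (0, T), whose completeness is L2_complete.

    Kernels.  Integrating dxK z (T - s) times the conjugate of dxK w (T - s) over
    (0, T) gives K0 z w (dxK_integral), by an explicit primitive.  Summing over
    the translates by even integers gives Kl_integral: Kl is the Gram kernel of
    the functions dxtheta z (T - s).  For controls u and - sg u at the two ends,
    sg = 1 or - 1, the state at z is - 2 times the integral of u against
    sg dxtheta (z + 1) + dxtheta z; expanding the Gram kernel of these functions
    gives Kplus and Kminus.  Hence the restrictions of the two symmetric reachable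
    spaces are the carriers of the two Hilbert spaces (sign_spaceP), and
    Kplus + Kminus is the kernel of the sum.

    Analyticity.  The second order Taylor remainder of dxK in space is bounded
    uniformly in time and summably over the translates (dxK_taylor,
    dxtheta_taylor), so it can be integrated against a control.

    Decomposition.  A pair of controls is the sum of an antisymmetric and of a
    symmetric pair.  Unit translations of Qinf preserve the states of the first
    kind and change the sign of those of the second, so that only 0 is of both
    kinds (reach_plus_minus0). *)

(** * Hilbert spaces with a semidefinite form, and reproducing kernels *)

Section semi_hilbert_theory.
Context {R : realType}.
Local Notation C := (R[i]).

Definition vanishing (a : nat -> R) :=
  forall e : R, 0 < e -> exists N, forall n, (N <= n)%N -> a n < e.

Definition sqmod (z : C) : R := complex.Re z ^+ 2 + complex.Im z ^+ 2.

(** The form may vanish on nonzero vectors, and vectors need not be functions: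
    the representatives of square integrable classes, the elements of a
    hilbert_fun and the pairs of such elements are treated at once, without
    taking quotients. *)
Record semi_hilbert (V : lmodType C) := SemiHilbert {
  dom : set V ;
  ip : V -> V -> C ;
  dom0 : dom 0 ;
  dom_lin : forall a f g, dom f -> dom g -> dom (a *: f + g) ;
  ip_lin : forall a f g h, dom f -> dom g -> dom h ->
    ip (a *: f + g) h = a * ip f h + ip g h ;
  ip_conj : forall f g, dom f -> dom g -> ip g f = (ip f g)^* ;
  ip_ge0 : forall f, dom f -> 0 <= ip f f ;
  ip_complete : forall u : nat -> V, (forall n, dom (u n)) ->
    (forall e : R, 0 < e -> exists N, forall m n, (N <= m)%N -> (N <= n)%N ->
       complex.Re (ip (u m - u n) (u m - u n)) < e) ->
    exists2 f, dom f & vanishing (fun n => complex.Re (ip (u n - f) (u n - f)))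
}.

Definition sqn (V : lmodType C) (H : semi_hilbert V) (u : V) : R :=
  complex.Re (ip H u u).

Section basics.
Variables (V : lmodType C) (H : semi_hilbert V).
Local Notation dom := (dom H).
Local Notation ip := (ip H).
Local Notation sqn := (sqn H).

Lemma domD u v : dom u -> dom v -> dom (u + v).
Proof. by move=> du dv; rewrite -[u]scale1r; exact: dom_lin. Qed.

Lemma domZ a u : dom u -> dom (a *: u).
Proof. by move=> du; rewrite -[_ *: _]addr0; apply: dom_lin => //; exact: dom0. Qed.

Lemma domN u : dom u -> dom (- u).
Proof. by rewrite -scaleN1r; exact: domZ. Qed.

Lemma domB u v : dom u -> dom v -> dom (u - v).
Proof. by move=> du dv; apply: domD => //; exact: domN. Qed.

Lemma ip0l v : dom v -> ip 0 v = 0.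
Proof.
move=> dv; have := ip_lin 1 (dom0 H) (dom0 H) dv.
by rewrite scaler0 addr0 mul1r => /(congr1 (fun x => x - ip 0 v)); rewrite subrr addrK.
Qed.

Lemma ipDl u v w : dom u -> dom v -> dom w -> ip (u + v) w = ip u w + ip v w.
Proof. by move=> du dv dw; have := ip_lin 1 du dv dw; rewrite scale1r mul1r. Qed.

Lemma ipZl a u w : dom u -> dom w -> ip (a *: u) w = a * ip u w.
Proof.
by move=> du dw; have := ip_lin a du (dom0 H) dw; rewrite addr0 ip0l// addr0.
Qed.

Lemma ipNl u w : dom u -> dom w -> ip (- u) w = - ip u w.
Proof. by move=> du dw; rewrite -scaleN1r ipZl// mulN1r. Qed.

Lemma ipBl u v w : dom u -> dom v -> dom w -> ip (u - v) w = ip u w - ip v w.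
Proof. by move=> du dv dw; rewrite ipDl ?ipNl//; exact: domN. Qed.

Lemma ipDr u v w : dom u -> dom v -> dom w -> ip w (u + v) = ip w u + ip w v.
Proof.
move=> du dv dw; rewrite (ip_conj (domD du dv) dw) ipDl// rmorphD/=.
by rewrite -!ip_conj.
Qed.

Lemma ipZr a u w : dom u -> dom w -> ip w (a *: u) = a^* * ip w u.
Proof.
by move=> du dw; rewrite (ip_conj (domZ a du) dw) ipZl// rmorphM/= -ip_conj.
Qed.

Lemma ipNr u w : dom u -> dom w -> ip w (- u) = - ip w u.
Proof.
by move=> du dw; rewrite (ip_conj (domN du) dw) ipNl// rmorphN/= -ip_conj.
Qed.

Lemma ipBr u v w : dom u -> dom v -> dom w -> ip w (u - v) = ip w u - ip w v.
Proof. by move=> du dv dw; rewrite ipDr ?ipNr//; exact: domN. Qed.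

Lemma ip_sqn u : dom u -> ip u u = (sqn u)%:C.
Proof. by move=> /ip_ge0; rewrite /sqn; case: (ip u u) => a b /ger0_Im /= ->. Qed.

Lemma sqn_ge0 u : dom u -> 0 <= sqn u.
Proof. by move=> du; have := ip_ge0 du; rewrite ip_sqn// ler0c. Qed.

Lemma sqnBZ x m c : dom x -> dom m ->
  sqn (x - c *: m) =
  sqn x - 2 * complex.Re (c^* * ip x m) + sqmod c * sqn m.
Proof.
move=> dx dm; have dcm := domZ c dm.
rewrite /sqn ipBl ?ipBr//; last exact: domB.
rewrite !ipZl ?ipZr// (ip_conj dx dm) !ip_sqn// /sqn !ip_sqn//=.
case: (ip x m) => a b; case: c {dcm} => p q; rewrite /sqmod /=.
by simpc; rewrite /=; ring.
Qed.

Lemma sqnZ c m : dom m -> sqn (c *: m) = sqmod c * sqn m.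
Proof.
move=> dm; have := sqnBZ (- c) (dom0 H) dm.
rewrite sub0r scaleNr opprK => ->; rewrite ip0l// mulr0/= mulr0 subr0.
by rewrite /sqn ip0l ?add0r; [case: c => a b; rewrite /sqmod/= !sqrrN|exact: dom0].
Qed.

Lemma sqnN u : dom u -> sqn (- u) = sqn u.
Proof. by move=> du; rewrite -scaleN1r sqnZ// /sqmod/=; ring. Qed.

Lemma sqnB x m : dom x -> dom m ->
  sqn (x - m) = sqn x - 2 * complex.Re (ip x m) + sqn m.
Proof.
move=> dx dm; have := sqnBZ 1 dx dm; rewrite scale1r => ->.
by case: (ip x m) => a b; rewrite /sqmod/=; ring.
Qed.

Lemma sqnD x m : dom x -> dom m ->
  sqn (x + m) = sqn x + 2 * complex.Re (ip x m) + sqn m.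
Proof.
move=> dx dm; have := sqnB dx (domN dm); rewrite opprK => ->.
by rewrite ipNr// sqnN//; case: (ip x m) => a b /=; ring.
Qed.

Lemma sqmod_ge0 z : 0 <= sqmod z.
Proof. by rewrite addr_ge0// sqr_ge0. Qed.

Lemma sqmod_eq0 z : sqmod z <= 0 -> z = 0.
Proof.
case: z => a b; rewrite /sqmod/= => h.
have /eqP : a ^+ 2 + b ^+ 2 = 0 by apply/eqP; rewrite eq_le h addr_ge0// sqr_ge0.
by rewrite paddr_eq0 ?sqr_ge0// !sqrf_eq0 => /andP[/eqP-> /eqP->].
Qed.

(** Comparing x with x - c *: m, for c the multiple of <x, m> that decreases the
    norm most, bounds <x, m>.  With e = |x|^2 the hypothesis is void and this is
    the Cauchy-Schwarz inequality; for x almost of minimal norm in x + N it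
    gives the near orthogonality used in the projection theorem. *)
Lemma almost_orthogonal x m e : dom x -> dom m ->
  (forall c : C, sqn x - e <= sqn (x - c *: m)) ->
  sqmod (ip x m) <= e * sqn m.
Proof.
move=> dx dm h.
have {}h t : 2 * t * sqmod (ip x m) - t ^+ 2 * sqmod (ip x m) * sqn m <= e.
  have := h (t%:C * ip x m); rewrite sqnBZ//; case: (ip x m) => a b.
  rewrite /sqmod/=; simpc => /= h'.
  rewrite -subr_ge0; apply: (le_trans _ (_ : 0 <= _)); first exact: lexx.
  by move: h'; rewrite -subr_ge0; congr (0 <= _); ring.
have n0 := sqn_ge0 dm; have B0 := sqmod_ge0 (ip x m).
move: n0; rewrite le_eqVlt => /orP[/eqP n0|n0].
  rewrite -n0 mulr0 leNgt; apply/negP => B1.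
  have := h ((e + 1) / (2 * sqmod (ip x m))); rewrite -n0 mulr0 subr0.
  have -> : 2 * ((e + 1) / (2 * sqmod (ip x m))) * sqmod (ip x m) = e + 1.
    by field; rewrite gt_eqF.
  by rewrite leNgt ltrDl ltr01.
have := h (sqn m)^-1.
have -> : 2 * (sqn m)^-1 * sqmod (ip x m) -
   (sqn m)^-1 ^+ 2 * sqmod (ip x m) * sqn m = sqmod (ip x m) / sqn m.
  by field; rewrite gt_eqF.
by rewrite ler_pdivrMr.
Qed.

Lemma cauchy_schwarz x m : dom x -> dom m ->
  sqmod (ip x m) <= sqn x * sqn m.
Proof.
move=> dx dm; apply: almost_orthogonal => // c; rewrite subrr.
by apply: sqn_ge0; apply: domB => //; exact: domZ.
Qed.

Lemma ip_null x m : dom x -> dom m -> sqn x = 0 -> ip x m = 0.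
Proof.
by move=> dx dm x0; apply: sqmod_eq0; rewrite -(mul0r (sqn m)) -x0 cauchy_schwarz.
Qed.

Lemma sqnD_le x m : dom x -> dom m -> sqn (x + m) <= 2 * sqn x + 2 * sqn m.
Proof.
move=> dx dm; rewrite sqnD//; have := sqn_ge0 (domB dx dm); rewrite sqnB//.
by lra.
Qed.

Lemma vanishing_cst a (s : nat -> R) c : 0 <= c ->
  vanishing s -> (forall n, a <= c * s n) -> a <= 0.
Proof.
move=> c0 s0 h; rewrite leNgt; apply/negP => a0.
have [|N hN] := s0 (a / (c + 1)); first by rewrite divr_gt0// ltr_wpDl.
have := hN N (leqnn N); rewrite ltr_pdivlMr ?ltr_wpDl// => h1.
have := h N; case: (leP 0 (s N)) => sN; first by lra.
by have := mulr_ge0_le0 c0 (ltW sN); lra.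
Qed.

Lemma ip_limit (s : nat -> V) p m : (forall n, dom (s n)) -> dom p -> dom m ->
  vanishing (fun n => sqn (s n - p)) ->
  (forall n, ip (s n) m = 0) -> ip p m = 0.
Proof.
move=> ds dp dm sp h; apply: sqmod_eq0.
apply: (vanishing_cst (c := sqn m) _ sp); first exact: sqn_ge0.
move=> n; rewrite mulrC.
have -> : ip p m = - ip (s n - p) m by rewrite ipBl// h sub0r opprK.
have := cauchy_schwarz (domB (ds n) dp) dm.
by case: (ip _ m) => a b; rewrite /sqmod/= !sqrrN.
Qed.

Lemma inv_small (e : R) : 0 < e ->
  exists N, forall n, (N <= n)%N -> n.+1%:R^-1 < e.
Proof.
move=> e0; exists (Num.truncn e^-1) => n hn.
rewrite invf_plt ?posrE//; apply: (lt_le_trans (truncnS_gt _)).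
by rewrite ler_nat.
Qed.

(** By the parallelogram law a minimising sequence of N is Cauchy; its limit p
    is the projection of u.  N need not be closed, so p only lies in its
    closure. *)
Lemma projection (N : set V) u : N 0 ->
  (forall a f g, N f -> N g -> N (a *: f + g)) -> N `<=` dom -> dom u ->
  exists p, [/\ dom p, exists2 s : nat -> V, (forall n, N (s n)) &
      vanishing (fun n => sqn (s n - p))
    & forall m, N m -> ip (u - p) m = 0].
Proof.
move=> N0 Nlin Ndom du.
pose D := [set sqn (u - m) | m in N].
have Dinf : has_inf D.
  split; first by exists (sqn (u - 0)), 0.
  by exists 0 => _ [m /Ndom dm <-]; apply: sqn_ge0; exact: domB.
pose d := inf D.
have dle m : N m -> d <= sqn (u - m).
  by move=> Nm; apply: ge_inf; [exact: Dinf.2|exists m].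
have /choice[s hs] : forall n : nat, exists m, N m /\ sqn (u - m) < d + n.+1%:R^-1.
  move=> n; have e0 : (0 : R) < n.+1%:R^-1 by rewrite invr_gt0.
  by have [_ [m Nm <-] h] := inf_adherent e0 Dinf; exists m.
have Ns n : N (s n) by case: (hs n).
have ds n : dom (s n) by exact: Ndom.
have dus n : dom (u - s n) by exact: domB.
have cau (e : R) : 0 < e -> exists N, forall m n, (N <= m)%N -> (N <= n)%N ->
    sqn (s m - s n) < e.
  move=> e0; have [k hk] := inv_small (divr_gt0 e0 (ltr0n _ 4)).
  exists k => m n km kn.
  have mid : d <= sqn (u - 2^-1 *: (s m + s n)).
    apply: dle; rewrite -[_ *: _]addr0; apply: (Nlin) => //.
    by rewrite -[s m]scale1r; exact: Nlin.
  have E1 : u - 2^-1 *: (s m + s n) = 2^-1 *: ((u - s m) + (u - s n)).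
    rewrite addrACA -opprD scalerBr; congr (_ - _).
    by rewrite scalerDr -scalerDl [_ + _](_ : _ = 1 :> C) ?scale1r//; field.
  have E2 : s m - s n = (u - s n) - (u - s m).
    by rewrite opprB [RHS]addrC addrA subrK.
  have [dm dn] := (dus m, dus n).
  have [_ hm] := hs m; have [_ hn] := hs n.
  rewrite E2; move: mid hm hn; rewrite E1 sqnZ; last exact: domD.
  move: dm dn; set x := u - s m; set y := u - s n => dm dn.
  rewrite (sqnD dm dn) (sqnB dn dm).
  have -> : sqmod (2^-1 : C) = 4^-1.
    by rewrite /sqmod/= !addr0; field.
  rewrite (ip_conj dm dn); case: (ip _ _) => a b /= mid hm hn.
  move: (hk _ km) (hk _ kn) hm hn mid.
  by move: (_%:R^-1) (_%:R^-1) (sqn x) (sqn y) => p q r t *; lra.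
have [p dp sp] := ip_complete ds cau.
exists p; split => //; first by exists s.
move=> m Nm; have dm := Ndom _ Nm.
have near n : sqmod (ip (u - s n) m) <= n.+1%:R^-1 * sqn m.
  apply: almost_orthogonal => // c.
  have : d <= sqn (u - (c *: m + s n)) by apply: dle; exact: Nlin.
  have -> : u - (c *: m + s n) = u - s n - c *: m by rewrite opprD addrA addrAC.
  move: (hs n).2; move: (_%:R^-1) (sqn _) (sqn _) => p1 q r *; lra.
apply: sqmod_eq0; apply: (vanishing_cst (c := 2 * sqn m)
    (s := fun n => n.+1%:R^-1 + sqn (s n - p))).
- by rewrite mulr_ge0// sqn_ge0.
- move=> e e0; have [N1 h1] := sp _ (divr_gt0 e0 (ltr0n _ 2)).
  have [k hk] := inv_small (divr_gt0 e0 (ltr0n _ 2)).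
  exists (maxn k N1) => n; rewrite geq_max => /andP[kn Nn].
  move: (h1 _ Nn) (hk _ kn); rewrite -/(sqn _); move: (_%:R^-1) (sqn _) => q r *; lra.
- move=> n.
  have -> : ip (u - p) m = ip (u - s n) m + ip (s n - p) m.
    by rewrite -ipDl//; [rewrite addrA subrK|exact: domB].
  have := near n; have := cauchy_schwarz (domB (ds n) dp) dm.
  case: (ip _ m) => a b; case: (ip _ m) => a' b'; rewrite /sqmod/= => h1 h2.
  rewrite -mulrA [_ * (_ + _)]mulrDr -[sqn m * _]mulrC -[sqn m * _]mulrC.
  move: h1 h2; move: (_ * _) (_ * _) => q r h1 h2.
  have := sqr_ge0 (a - a'); have := sqr_ge0 (b - b'); nra.
Qed.

End basics.

Lemma vanishing_sqrt (a : nat -> R) : (forall n, 0 <= a n) ->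
  vanishing a <-> (Num.sqrt (a n) @[n --> \oo] --> (0 : R)).
Proof.
move=> a0; split.
  move=> va; apply/cvgr0Pnorm_lt => e e0.
  have [N hN] := va (e ^+ 2) (exprn_gt0 _ e0).
  exists N => // n /= /hN h; rewrite ger0_norm ?sqrtr_ge0//.
  by rewrite -(ger0_norm (ltW e0)) -sqrtr_sqr ltr_sqrt// exprn_gt0.
move=> /cvgr0Pnorm_lt h e e0.
have [|N _ hN] := h (Num.sqrt e); first by rewrite sqrtr_gt0.
exists N => n /hN /=; rewrite ger0_norm ?sqrtr_ge0//.
by rewrite ltr_sqrt.
Qed.

Section feature_space.
Variables (V : lmodType C) (H : semi_hilbert V) (X : Type) (e : X -> V).
Hypothesis e_dom : forall x, dom H (e x).
Local Notation dom := (dom H).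
Local Notation ip := (ip H).
Local Notation sqn := (sqn H).

Definition feature_map (u : V) : X -> C^o := fun x => ip u (e x).

Lemma feature_map_lin a u v : dom u -> dom v ->
  feature_map (a *: u + v) = a *: feature_map u + feature_map v.
Proof. by move=> du dv; apply/funext => x; exact: ip_lin. Qed.

Lemma feature_mapB u v : dom u -> dom v ->
  feature_map (u - v) = feature_map u - feature_map v.
Proof. by move=> du dv; apply/funext => x; exact: ipBl. Qed.

(** Among the preimages of f, those orthogonal to the kernel of feature_map are
    the ones of least norm.  They differ by null vectors only, which the inner
    product does not see, so that any choice transports the inner product. *)
Definition is_lift (f : X -> C^o) (u : V) := [/\ dom u, feature_map u = f &
  forall v, dom v -> feature_map v = 0 -> ip u v = 0].

Definition lift (f : X -> C^o) : V := xget 0 [set u | is_lift f u].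

(** The kernel of feature_map is closed, because each feature is a continuous
    functional; hence subtracting the projection on it stays in the fibre. *)
Lemma lift_exists u : dom u -> exists v, is_lift (feature_map u) v.
Proof.
move=> du; pose N := [set v | dom v /\ feature_map v = 0].
have [||||p [dp [s Ns sp] orth]] := @projection _ H N u.
- by split; [exact: dom0|apply/funext => x; exact: ip0l].
- move=> a f g [df f0] [dg g0]; split; first exact: dom_lin.
  by rewrite feature_map_lin// f0 g0 scaler0 addr0.
- by move=> v [].
- by [].
have p0 : feature_map p = 0.
  apply/funext => x; apply: (ip_limit (s := s)) => //.
    by move=> n; exact: (Ns n).1.
  by move=> n; rewrite -[LHS]/(feature_map (s n) x) (Ns n).2.
exists (u - p); split; first exact: domB.
  by rewrite feature_mapB// p0 subr0.
by move=> v dv v0; exact: orth.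
Qed.

Definition feature_carrier : set (X -> C^o) := [set feature_map u | u in dom].

Lemma liftP f : feature_carrier f -> is_lift f (lift f).
Proof. by move=> [u /lift_exists h <-]; exact: xgetPex. Qed.

Lemma lift_ip f u v : is_lift f u -> dom v -> ip (lift f) v = ip u v.
Proof.
move=> fu dv; have [du fu1 fu2] := fu.
have [dl fl1 fl2] : is_lift f (lift f) by apply: liftP; exists u.
apply/eqP; rewrite -subr_eq0 -ipBl//; apply/eqP.
have d : dom (lift f - u) by exact: domB.
apply: ip_null => //; rewrite /sqn ipBl//.
have k : feature_map (lift f - u) = 0 by rewrite feature_mapB// fu1 fl1 subrr.
by rewrite fu2// fl2// subrr.
Qed.

Definition feature_ip f g := ip (lift f) (lift g).

Lemma feature_ipE f g u v : is_lift f u -> is_lift g v ->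
  feature_ip f g = ip u v.
Proof.
move=> fu gv; have [du _ _] := fu; have [dv _ _] := gv.
have [dl _ _] : is_lift g (lift g) by apply: liftP; exists v => //; case: gv.
rewrite /feature_ip (lift_ip fu)// (ip_conj dl)// (lift_ip gv)//.
by rewrite -ip_conj.
Qed.

Lemma is_lift_lin a f g u v : is_lift f u -> is_lift g v ->
  is_lift (a *: f + g) (a *: u + v).
Proof.
move=> [du fu ou] [dv gv ov]; split; first exact: dom_lin.
  by rewrite feature_map_lin// fu gv.
by move=> w dw w0; rewrite ip_lin// ou// ov// mulr0 addr0.
Qed.

Lemma is_liftB f g u v : is_lift f u -> is_lift g v ->
  is_lift (f - g) (u - v).
Proof.
move=> hf hg; rewrite (addrC f) (addrC u) -[- g]scaleN1r -[- v]scaleN1r.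
exact: is_lift_lin.
Qed.

Lemma feature_carrier0 : feature_carrier 0.
Proof. by exists 0; [exact: dom0|apply/funext => x; exact: ip0l]. Qed.

Lemma feature_carrier_lin a f g : feature_carrier f -> feature_carrier g ->
  feature_carrier (a *: f + g).
Proof.
move=> [u du <-] [v dv <-]; exists (a *: u + v); first exact: dom_lin.
exact: feature_map_lin.
Qed.

Lemma feature_ip_lin a f g h : feature_carrier f -> feature_carrier g ->
  feature_carrier h ->
  feature_ip (a *: f + g) h = a * feature_ip f h + feature_ip g h.
Proof.
move=> /liftP lf /liftP lg /liftP lh.
rewrite (feature_ipE (is_lift_lin a lf lg) lh).
by case: lf => ? _ _; case: lg => ? _ _; case: lh => ? _ _; exact: ip_lin.
Qed.

Lemma feature_ip_conj f g : feature_carrier f -> feature_carrier g ->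
  feature_ip g f = (feature_ip f g)^*.
Proof. by move=> /liftP[df _ _] /liftP[dg _ _]; exact: ip_conj. Qed.

Lemma feature_ip_ge0 f : feature_carrier f -> 0 <= feature_ip f f.
Proof. by move=> /liftP[df _ _]; exact: ip_ge0. Qed.

Lemma feature_ip_eq0 f : feature_carrier f -> feature_ip f f = 0 -> f = 0.
Proof.
move=> /liftP[df ff _]; rewrite /feature_ip => f0.
by rewrite -ff; apply/funext => x; apply: ip_null => //; rewrite /sqn f0.
Qed.

Lemma feature_complete (u : nat -> X -> C^o) :
  (forall n, feature_carrier (u n)) ->
  (forall d : R, 0 < d -> exists N, forall m n, (N <= m)%N -> (N <= n)%N ->
     Num.sqrt (complex.Re (feature_ip (u m - u n) (u m - u n))) < d) ->
  exists2 f, feature_carrier f &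
    Num.sqrt (complex.Re (feature_ip (u n - f) (u n - f))) @[n --> \oo]
      --> (0 : R).
Proof.
move=> cu cau; pose v n := lift (u n).
have lv n : is_lift (u n) (v n) by exact: liftP.
have dv n : dom (v n) by case: (lv n).
have [d d0|p dp vp] := ip_complete dv.
  have [|N hN] := cau (Num.sqrt d); first by rewrite sqrtr_gt0.
  exists N => m n Nm Nn; have := hN _ _ Nm Nn.
  rewrite ltr_sqrt//.
  by have l := is_liftB (lv m) (lv n); rewrite (feature_ipE l l).
have lp : is_lift (feature_map p) p.
  split => // w dw w0; apply: (ip_limit (s := v)) => // n.
  by case: (lv n) => _ _; apply.
exists (feature_map p); first by exists p.
have l n := is_liftB (lv n) lp.
under eq_fun do rewrite (feature_ipE (l _) (l _)).
by apply/vanishing_sqrt => // n; exact/sqn_ge0/domB.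
Qed.

(** The range of feature_map with the quotient norm: the reproducing kernel
    Hilbert space of the Gram kernel of the features. *)
Definition feature_space : hilbert_fun X :=
  HilbertFun feature_carrier0 feature_carrier_lin feature_ip_lin
    feature_ip_conj feature_ip_ge0 feature_ip_eq0 feature_complete.

Lemma feature_space_kernel :
  reproducing_kernel feature_space (fun x y => ip (e y) (e x)).
Proof.
move=> y; have ly : is_lift (feature_map (e y)) (e y).
  split => // v dv v0; rewrite (ip_conj dv)//.
  by rewrite -[ip v _]/(feature_map v y) v0 [LHS]conjc0.
split; first by exists (e y).
move=> f /= /liftP lf; rewrite (feature_ipE lf ly).
by case: lf => _ /(congr1 (fun g => g y)) <-.
Qed.

Lemma feature_space_norm f : feature_carrier f ->
  is_min [set sqn u | u in [set u | dom u /\ feature_map u = f]]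
    (hnorm feature_space f ^+ 2).
Proof.
move=> cf; have [dl fl ol] := liftP cf.
rewrite /hnorm sqr_sqrtr; last exact: sqn_ge0.
split; first by exists (lift f).
move=> _ [u [du fu] <-]; have d := domB du dl.
rewrite -[u](subrK (lift f)) sqnD//.
have -> : ip (u - lift f) (lift f) = 0.
  rewrite ip_conj// ol// ?[LHS]conjc0//.
  by rewrite feature_mapB// fu fl subrr.
by rewrite /= mulr0 addr0 -[X in X <= _]add0r lerD2r sqn_ge0.
Qed.

End feature_space.

Section uniqueness.
Variable X : Type.
Implicit Types (H : @hilbert_fun R X) (k : X -> X -> C).

Lemma hilbert_fun_vanishing H (u : nat -> X -> C^o) f :
  (forall n, hcarrier H (u n - f)) ->
  vanishing (fun n => complex.Re (hip H (u n - f) (u n - f))) <->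
  (Num.sqrt (complex.Re (hip H (u n - f) (u n - f))) @[n --> \oo] --> (0 : R)).
Proof.
move=> cu; apply: vanishing_sqrt => n.
by have := hip_ge0 (cu n); case: (hip _ _ _) => a b; rewrite lecE/= => /andP[].
Qed.

Lemma hcarrierB H f g : hcarrier H f -> hcarrier H g -> hcarrier H (f - g).
Proof. by move=> cf cg; rewrite addrC -scaleN1r; exact: hcarrier_lin. Qed.

Lemma hilbert_fun_complete H (u : nat -> X -> C^o) :
  (forall n, hcarrier H (u n)) ->
  (forall d : R, 0 < d -> exists N, forall m n, (N <= m)%N -> (N <= n)%N ->
     complex.Re (hip H (u m - u n) (u m - u n)) < d) ->
  exists2 f, hcarrier H f &
    vanishing (fun n => complex.Re (hip H (u n - f) (u n - f))).
Proof.
move=> cu cau; have [d d0|f cf] := hcomplete cu.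
  have [|N hN] := cau (d ^+ 2); first by rewrite exprn_gt0.
  exists N => m n Nm Nn; have := hN _ _ Nm Nn => h.
  by rewrite -(ger0_norm (ltW d0)) -sqrtr_sqr ltr_sqrt// exprn_gt0.
move=> h; exists f => //; apply/hilbert_fun_vanishing => // n.
exact: hcarrierB.
Qed.

Definition semi_hilbert_of H : semi_hilbert (X -> C^o) :=
  SemiHilbert (hcarrier0 H) (@hcarrier_lin _ _ H) (@hip_lin _ _ H)
    (@hip_conj _ _ H) (@hip_ge0 _ _ H) (@hilbert_fun_complete H).

Definition kernel_span k : set (X -> C^o) :=
  [set f | exists s : seq (C * X), f = \sum_(p <- s) p.1 *: (k^~ p.2 : X -> C^o)].

Lemma kernel_span_lin k a f g : kernel_span k f -> kernel_span k g ->
  kernel_span k (a *: f + g).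
Proof.
move=> [s ->] [t ->].
exists ([seq (a * p.1, p.2) | p <- s] ++ t).
rewrite big_cat/= big_map/= scaler_sumr; congr (_ + _).
by apply: eq_bigr => p _; rewrite scalerA.
Qed.

Lemma kernel_spanB k f g : kernel_span k f -> kernel_span k g ->
  kernel_span k (f - g).
Proof. by move=> cf cg; rewrite addrC -scaleN1r; exact: kernel_span_lin. Qed.

Lemma kernel_span_sub H k : reproducing_kernel H k ->
  kernel_span k `<=` hcarrier H.
Proof.
move=> rk _ [s ->]; elim: s => [|p s ih].
  by rewrite big_nil; exact: hcarrier0.
by rewrite big_cons; apply: hcarrier_lin => //; exact: (rk _).1.
Qed.

(** The reproducing property forces the inner product on the span of the
    kernel functions. *)
Lemma kernel_span_ip H H' k : reproducing_kernel H k ->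
  reproducing_kernel H' k -> forall f g, kernel_span k f -> kernel_span k g ->
  hip H f g = hip H' f g.
Proof.
move=> rk rk' f g kf [s ->].
have cf := kernel_span_sub rk kf; have cf' := kernel_span_sub rk' kf.
elim: s => [|p s ih].
  have c0 := hcarrier0 H; have c0' := hcarrier0 H'.
  have z : hip H 0 f = 0 := ip0l (H := semi_hilbert_of H) cf.
  have z' : hip H' 0 f = 0 := ip0l (H := semi_hilbert_of H') cf'.
  by rewrite big_nil (hip_conj c0 cf) (hip_conj c0' cf') z z'.
rewrite big_cons.
have c : kernel_span k (\sum_(j <- s) j.1 *: (k^~ j.2 : X -> C^o)) by exists s.
have cs := kernel_span_sub rk c; have cs' := kernel_span_sub rk' c.
have [c1 r1] := rk p.2; have [c1' r1'] := rk' p.2.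
have expand (K : @hilbert_fun R X) : hcarrier K f -> hcarrier K (k^~ p.2) ->
    hcarrier K (\sum_(j <- s) j.1 *: (k^~ j.2 : X -> C^o)) ->
    hip K f (p.1 *: (k^~ p.2 : X -> C^o) + \sum_(j <- s) j.1 *: (k^~ j.2 : X -> C^o)) =
    p.1^* * hip K f (k^~ p.2) + hip K f (\sum_(j <- s) j.1 *: (k^~ j.2 : X -> C^o)).
  move=> d1 d2 d3; have d4 := domZ (H := semi_hilbert_of K) p.1 d2.
  have := ipDr (H := semi_hilbert_of K) d4 d3 d1 => /= ->.
  by have := ipZr (H := semi_hilbert_of K) p.1 d2 d1 => /= ->.
rewrite !expand// -r1// -r1'// ih//.
Qed.

(** A reproducing kernel determines its space.  The projection of f on the span
    of the kernel functions has the same values as f, so f is a limit of elements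
    of the span.  The two norms agree on the span, so the approximating sequence
    also converges in the other space, and its limit there has the values of
    f. *)
Lemma reproducing_kernel_sub H H' k : reproducing_kernel H k ->
  reproducing_kernel H' k -> hcarrier H `<=` hcarrier H'.
Proof.
move=> rk rk' f cf.
have [||||p [dp [s Ns sp] orth]] :=
  @projection _ (semi_hilbert_of H) (kernel_span k) f.
- by exists [::]; rewrite big_nil.
- by move=> *; exact: kernel_span_lin.
- exact: kernel_span_sub.
- by [].
have pf : p = f.
  apply/funext => x; apply/eqP; rewrite eq_sym -subr_eq0; apply/eqP.
  have [cx rx] := rk x; rewrite -[LHS]/((f - p) x) rx; last exact: hcarrierB.
  by apply: orth; exists [:: (1, x)]; rewrite big_seq1 scale1r.
subst p.
have cs n := kernel_span_sub rk (Ns n); have cs' n := kernel_span_sub rk' (Ns n).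
have [d d0|g cg sg] := hilbert_fun_complete cs'.
  have [N hN] := sp _ (divr_gt0 d0 (ltr0n _ 4)).
  exists N => m n Nm Nn; have c := kernel_spanB (Ns m) (Ns n).
  rewrite -(kernel_span_ip rk rk' c c).
  have -> : s m - s n = (s m - f) - (s n - f) by rewrite opprB addrA subrK.
  have dm : hcarrier H (s m - f) by exact: hcarrierB.
  have dn : hcarrier H (s n - f) by exact: hcarrierB.
  apply: le_lt_trans
    (sqnD_le (H := semi_hilbert_of H) dm (domN (H := semi_hilbert_of H) dn)) _.
  rewrite sqnN//; have := hN _ Nm; have := hN _ Nn; rewrite /sqn/=; lra.
suff -> : f = g by [].
apply/funext => x.
have [cx rx] := rk x; have [cx' rx'] := rk' x.
have kx : kernel_span k (k^~ x) by exists [:: (1, x)]; rewrite big_seq1 scale1r.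
apply/eqP; rewrite -subr_eq0; apply/eqP; apply: sqmod_eq0.
pose K := complex.Re (hip H (k^~ x) (k^~ x)) +
   complex.Re (hip H' (k^~ x) (k^~ x)).
have K1 : 0 <= complex.Re (hip H (k^~ x) (k^~ x)) by exact: (sqn_ge0 (H := semi_hilbert_of H)).
have K2 : 0 <= complex.Re (hip H' (k^~ x) (k^~ x)) by exact: (sqn_ge0 (H := semi_hilbert_of H')).
apply: (vanishing_cst (c := 2 * K)
  (s := fun n => complex.Re (hip H (s n - f) (s n - f)) +
                 complex.Re (hip H' (s n - g) (s n - g)))).
- by rewrite mulr_ge0// addr_ge0.
- move=> d d0.
  have [N hN] := sp _ (divr_gt0 d0 (ltr0n _ 2)).
  have [N' hN'] := sg _ (divr_gt0 d0 (ltr0n _ 2)).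
  exists (maxn N N') => n; rewrite geq_max => /andP[/hN h1 /hN' h2].
  move: h1 h2 => /=; lra.
- move=> n.
  have dm : hcarrier H (s n - f) by exact: hcarrierB.
  have dn : hcarrier H' (s n - g) by exact: hcarrierB.
  have := cauchy_schwarz (H := semi_hilbert_of H) dm cx.
  have := cauchy_schwarz (H := semi_hilbert_of H') dn cx'.
  rewrite /sqn/= -rx// -rx'//= -!/(sqmod _).
  have -> : (f x - g x : C) = (s n - g) x - (s n - f) x.
    by rewrite /= !fctE opprB [RHS]addrC addrA subrK.
  have a0 := sqn_ge0 (H := semi_hilbert_of H) dm.
  have b0 := sqn_ge0 (H := semi_hilbert_of H') dn.
  move: a0 b0 K1 K2; rewrite /sqn /K/=.
  move: (complex.Re _) (complex.Re _) (complex.Re _) (complex.Re _) => A B D E'.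
  case: ((s n - g) x) => a b; case: ((s n - f) x) => a' b'.
  rewrite /sqmod/= => A0 B0 D0 E0 h1 h2.
  have h3 := mulr_ge0 A0 E0; have h4 := mulr_ge0 B0 D0.
  have := sqr_ge0 (a + a'); have := sqr_ge0 (b + b'); nra.
Qed.

Lemma reproducing_kernel_carrier H H' k : reproducing_kernel H k ->
  reproducing_kernel H' k -> hcarrier H = hcarrier H'.
Proof.
by move=> rk rk'; apply/seteqP; split;
  [exact: reproducing_kernel_sub rk rk'|exact: reproducing_kernel_sub rk' rk].
Qed.

End uniqueness.

Section direct_sum.
Variables (V1 V2 : lmodType C) (H1 : semi_hilbert V1) (H2 : semi_hilbert V2).

Definition sum_dom : set (V1 * V2) := [set u | dom H1 u.1 /\ dom H2 u.2].
Definition sum_ip (u v : V1 * V2) : C := ip H1 u.1 v.1 + ip H2 u.2 v.2.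

Lemma sum_dom0 : sum_dom 0.
Proof. by split; exact: dom0. Qed.

Lemma sum_dom_lin a u v : sum_dom u -> sum_dom v -> sum_dom (a *: u + v).
Proof. by move=> [? ?] [? ?]; split; exact: dom_lin. Qed.

Lemma sum_ip_lin a u v w : sum_dom u -> sum_dom v -> sum_dom w ->
  sum_ip (a *: u + v) w = a * sum_ip u w + sum_ip v w.
Proof.
by move=> [? ?] [? ?] [? ?]; rewrite /sum_ip/= !ip_lin// mulrDr addrACA.
Qed.

Lemma sum_ip_conj u v : sum_dom u -> sum_dom v -> sum_ip v u = (sum_ip u v)^*.
Proof.
move=> [? ?] [? ?]; rewrite /sum_ip/= rmorphD/=.
by congr (_ + _); exact: ip_conj.
Qed.

Lemma sum_ip_ge0 u : sum_dom u -> 0 <= sum_ip u u.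
Proof. by move=> [? ?]; rewrite addr_ge0// ip_ge0. Qed.

Lemma sum_complete (u : nat -> V1 * V2) : (forall n, sum_dom (u n)) ->
    (forall e : R, 0 < e -> exists N, forall m n, (N <= m)%N -> (N <= n)%N ->
       complex.Re (sum_ip (u m - u n) (u m - u n)) < e) ->
    exists2 f, sum_dom f &
      vanishing (fun n => complex.Re (sum_ip (u n - f) (u n - f))).
Proof.
move=> du cau.
have d1 n : dom H1 (u n).1 by case: (du n).
have d2 n : dom H2 (u n).2 by case: (du n).
have Re_sum a : complex.Re (sum_ip a a) = sqn H1 a.1 + sqn H2 a.2.
  by rewrite /sqn /sum_ip; case: (ip _ _ _) => ? ?; case: (ip _ _ _).
have [e e0|p1 dp1 h1] := ip_complete d1.
  have [N hN] := cau e e0; exists N => m n Nm Nn.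
  have := hN _ _ Nm Nn; rewrite Re_sum/=.
  have := sqn_ge0 (domB (d2 m) (d2 n)); rewrite -/(sqn _ _); lra.
have [e e0|p2 dp2 h2] := ip_complete d2.
  have [N hN] := cau e e0; exists N => m n Nm Nn.
  have := hN _ _ Nm Nn; rewrite Re_sum/=.
  have := sqn_ge0 (domB (d1 m) (d1 n)); rewrite -/(sqn _ _); lra.
exists (p1, p2); first by split.
move=> e e0.
have [N hN] := h1 _ (divr_gt0 e0 (ltr0n _ 2)).
have [N' hN'] := h2 _ (divr_gt0 e0 (ltr0n _ 2)).
exists (maxn N N') => n; rewrite geq_max => /andP[/hN h3 /hN' h4].
rewrite Re_sum/=; move: h3 h4; rewrite -!/(sqn _ _); lra.
Qed.

Definition semi_hilbert_sum : semi_hilbert (V1 * V2)%type :=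
  SemiHilbert sum_dom0 sum_dom_lin sum_ip_lin sum_ip_conj sum_ip_ge0
    sum_complete.

End direct_sum.

(** The sum of two spaces is the feature space of their direct sum, for the
    features made of the two kernel functions: feature_map is then the addition,
    and its quotient norm is the minimum over all decompositions. *)
Lemma reproducing_kernel_sum (X : Type) (H1 H2 : @hilbert_fun R X) k1 k2 :
  reproducing_kernel H1 k1 -> reproducing_kernel H2 k2 ->
  exists H : @hilbert_fun R X,
    [/\ hcarrier H = [set f + g | f in hcarrier H1 & g in hcarrier H2],
        forall f, hcarrier H f ->
          is_min (decomposition_norms H1 H2 f) (hnorm H f ^+ 2)
      & reproducing_kernel H (fun x y => k1 x y + k2 x y)].
Proof.
move=> rk1 rk2.
pose S := semi_hilbert_sum (semi_hilbert_of H1) (semi_hilbert_of H2).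
pose e x : (X -> C^o) * (X -> C^o) := (k1^~ x, k2^~ x).
have de x : dom S (e x) by split; [exact: (rk1 x).1|exact: (rk2 x).1].
have fmE u : dom S u -> feature_map S e u = u.1 + u.2.
  move=> [c1 c2]; apply/funext => x; rewrite /feature_map/= /sum_ip/=.
  by rewrite -(rk1 x).2// -(rk2 x).2.
have sqE u : dom S u -> sqn S u = hnorm H1 u.1 ^+ 2 + hnorm H2 u.2 ^+ 2.
  move=> [c1 c2]; rewrite /hnorm !sqr_sqrtr;
    [|exact: (sqn_ge0 (H := semi_hilbert_of H2))
     |exact: (sqn_ge0 (H := semi_hilbert_of H1))].
  by rewrite /sqn/= /sum_ip/=; case: (hip _ _ _) => ? ?; case: (hip _ _ _).
exists (feature_space de); split.
- apply/seteqP; split.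
    by move=> _ [u du <-]; rewrite fmE//; case: du => c1 c2; exists u.1 => //; exists u.2.
  move=> _ [f cf [g cg <-]]; exists (f, g); first by split.
  by rewrite fmE//; split.
- move=> f cf; have [[u [du fu] su] lb] := feature_space_norm de cf.
  split.
    rewrite -su; exists u.1, u.2; have [? ?] := du; split => //.
      by rewrite -fu fmE.
    exact: sqE.
  move=> _ [f1 [f2 [c1 c2 ff ->]]]; apply: lb; exists (f1, f2); last by rewrite sqE.
  by split; [split|rewrite fmE//; split].
- have := feature_space_kernel de; congr reproducing_kernel.
  apply/funext => x; apply/funext => y; rewrite /= /sum_ip/=.
  by rewrite -((rk1 x).2 _ (rk1 y).1) -((rk2 x).2 _ (rk2 y).1).
Qed.

End semi_hilbert_theory.

(** * Sums of absolutely summable families *)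

Section real_sums.
Context {R : realType}.
Implicit Types (I J : choiceType).

Definition rsummable I (f : I -> R) : Prop :=
  (\esum_(i in [set: I]) (`|f i|)%:E < +oo)%E.

Definition rpos (x : R) : R := Num.max x 0.
Definition rneg (x : R) : R := Num.max (- x) 0.

Lemma rpos_ge0 x : 0 <= rpos x. Proof. by rewrite /rpos le_max lexx orbT. Qed.
Lemma rneg_ge0 x : 0 <= rneg x. Proof. by rewrite /rneg le_max lexx orbT. Qed.

Lemma rposBneg x : x = rpos x - rneg x.
Proof.
by rewrite /rpos /rneg; case: (leP x 0) => h; case: (leP (- x) 0) => h'; lra.
Qed.

Lemma rpos_le x : rpos x <= `|x|.
Proof. by rewrite /rpos ge_max ler_norm normr_ge0. Qed.

Lemma rneg_le x : rneg x <= `|x|.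
Proof. by rewrite /rneg ge_max ler_normr lexx orbT normr_ge0. Qed.

Lemma rsummable_le I (f c : I -> R) : (forall i, `|f i| <= c i) ->
  rsummable c -> rsummable f.
Proof.
move=> fc; apply: le_lt_trans; apply: le_esum => i _; rewrite lee_fin.
by apply: (le_trans (fc i)); exact: ler_norm.
Qed.

Lemma rsummable_rpos I (f : I -> R) : rsummable f -> rsummable (rpos \o f).
Proof.
move=> sf; apply: (@rsummable_le _ _ (fun i => `|f i|)) => [i|].
  by rewrite /= ger0_norm ?rpos_ge0// rpos_le.
by rewrite /rsummable; under eq_esum do rewrite normr_id.
Qed.

Lemma rsummable_rneg I (f : I -> R) : rsummable f -> rsummable (rneg \o f).
Proof.
move=> sf; apply: (@rsummable_le _ _ (fun i => `|f i|)) => [i|].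
  by rewrite /= ger0_norm ?rneg_ge0// rneg_le.
by rewrite /rsummable; under eq_esum do rewrite normr_id.
Qed.

Lemma rsummableD I (f g : I -> R) : rsummable f -> rsummable g ->
  rsummable (fun i => f i + g i).
Proof.
move=> sf sg; apply: (@le_lt_trans _ _ (\esum_(i in [set: I]) ((`|f i|)%:E + (`|g i|)%:E))%E).
  by apply: le_esum => i _; rewrite -EFinD lee_fin ler_normD.
by rewrite esumD//; [exact: lte_add_pinfty|move=> *; rewrite lee_fin..].
Qed.

Lemma rsumE_ge0 I (f : I -> R) : (forall i, 0 <= f i) ->
  rsum f = fine (\esum_(i in [set: I]) (f i)%:E).
Proof.
move=> f0; rewrite /rsum; congr fine.
rewrite [X in (_ - X)%E]esum1 ?sube0; last first.
  move=> i _; rewrite funenegE /=.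
  by rewrite -EFin_max max_r// oppr_le0.
apply: eq_esum => i _; rewrite funeposE /= -EFin_max max_l//.
Qed.

Lemma rsumEFin I (f : I -> R) : (forall i, 0 <= f i) -> rsummable f ->
  (rsum f)%:E = \esum_(i in [set: I]) (f i)%:E.
Proof.
move=> f0 sf; rewrite rsumE_ge0// fineK// ge0_fin_numE; last first.
  by apply: esum_ge0 => i _; rewrite lee_fin.
by apply: le_lt_trans sf; apply: le_esum => i _; rewrite lee_fin ler_norm.
Qed.

Lemma rsum_ge0 I (f : I -> R) : (forall i, 0 <= f i) -> 0 <= rsum f.
Proof.
move=> f0; rewrite rsumE_ge0// fine_ge0//; apply: esum_ge0 => i _.
by rewrite lee_fin.
Qed.

(** Every property of signed sums below is reduced to sums of nonnegative
    families through this lemma, applied to positive and negative parts. *)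
Lemma rsumB_ge0 I (f g : I -> R) : (forall i, 0 <= f i) ->
  (forall i, 0 <= g i) -> rsummable f -> rsummable g ->
  rsum (fun i => f i - g i) = rsum f - rsum g.
Proof.
move=> f0 g0 sf sg; have := @esumB R I [set: I] (EFin \o f) (EFin \o g) sf sg.
move=> /(_ (fun i _ => f0 i) (fun i _ => g0 i)) E.
by rewrite {1}/rsum [LHS](congr1 fine E) -!rsumEFin.
Qed.

Lemma rsumE I (f : I -> R) : rsummable f ->
  rsum f = rsum (rpos \o f) - rsum (rneg \o f).
Proof.
move=> sf; rewrite -rsumB_ge0//.
- by congr rsum; apply/funext => i; exact: rposBneg.
- by move=> i; exact: rpos_ge0.
- by move=> i; exact: rneg_ge0.
- exact: rsummable_rpos.
- exact: rsummable_rneg.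
Qed.

Lemma le_rsum_ge0 I (f g : I -> R) : (forall i, 0 <= f i) ->
  (forall i, f i <= g i) -> rsummable g -> rsum f <= rsum g.
Proof.
move=> f0 fg sg; rewrite -lee_fin !rsumEFin//.
- by apply: le_esum => i _; rewrite lee_fin.
- by move=> i; exact: le_trans (fg i).
- by apply: rsummable_le sg => i; rewrite ger0_norm.
Qed.

Lemma rsumD_ge0 I (f g : I -> R) : (forall i, 0 <= f i) ->
  (forall i, 0 <= g i) -> rsummable f -> rsummable g ->
  rsum (fun i => f i + g i) = rsum f + rsum g.
Proof.
move=> f0 g0 sf sg; apply: EFin_inj; rewrite EFinD !rsumEFin//.
- by rewrite -esumD//; move=> i _; rewrite lee_fin.
- by move=> i; rewrite addr_ge0.
- exact: rsummableD.
Qed.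

Lemma rsumD I (f g : I -> R) : rsummable f -> rsummable g ->
  rsum (fun i => f i + g i) = rsum f + rsum g.
Proof.
move=> sf sg; rewrite (rsumE sf) (rsumE sg).
have [p0 n0] := (rpos_ge0, rneg_ge0).
have [sfp sfn] := (rsummable_rpos sf, rsummable_rneg sf).
have [sgp sgn] := (rsummable_rpos sg, rsummable_rneg sg).
transitivity (rsum (fun i => (rpos (f i) + rpos (g i)) - (rneg (f i) + rneg (g i)))).
  congr rsum; apply/funext => i; rewrite {1}(rposBneg (f i)) {1}(rposBneg (g i)); ring.
rewrite rsumB_ge0//; try by move=> i; rewrite addr_ge0.
- by rewrite !rsumD_ge0//; ring.
- exact: rsummableD.
- exact: rsummableD.
Qed.

Lemma rsummableN I (f : I -> R) : rsummable f -> rsummable (fun i => - f i).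
Proof. by rewrite /rsummable; under [in X in _ -> X]eq_esum do rewrite normrN. Qed.

Lemma rsumN I (f : I -> R) : rsummable f -> rsum (fun i => - f i) = - rsum f.
Proof.
move=> sf; have := rsumD sf (rsummableN sf).
have -> : (fun i => f i + - f i) = fun=> 0 by apply/funext => i; rewrite subrr.
rewrite rsumE_ge0// esum1//= => /eqP; rewrite eq_sym addrC addr_eq0 => /eqP->//.
Qed.

Lemma le_norm_rsum I (f c : I -> R) : (forall i, `|f i| <= c i) ->
  rsummable c -> `|rsum f| <= rsum c.
Proof.
move=> fc sc; have sf := rsummable_le fc sc.
have c0 i : 0 <= c i by apply: le_trans (fc i).
have h1 : rsum (rpos \o f) <= rsum c.
  apply: le_rsum_ge0 => // i; first exact: rpos_ge0.
  by apply: le_trans (fc i); exact: rpos_le.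
have h2 : rsum (rneg \o f) <= rsum c.
  apply: le_rsum_ge0 => // i; first exact: rneg_ge0.
  by apply: le_trans (fc i); exact: rneg_le.
have h3 : 0 <= rsum (rpos \o f) by apply: rsum_ge0 => i; exact: rpos_ge0.
have h4 : 0 <= rsum (rneg \o f) by apply: rsum_ge0 => i; exact: rneg_ge0.
rewrite (rsumE sf) ler_norml; apply/andP; split; lra.
Qed.

Lemma rsum_reindex I J (e : I -> J) (f : J -> R) : bijective e ->
  rsum f = rsum (f \o e).
Proof.
move=> be; have b : set_bij [set: I] [set: J] e by rewrite setTT_bijective.
rewrite /rsum (reindex_esum _ _ _ (EFin \o f)^\+%E b).
rewrite (reindex_esum _ _ _ (EFin \o f)^\-%E b).
by congr (fine (_ - _)%E); apply: eq_esum => i _; rewrite ?funeposE ?funenegE.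
Qed.

Lemma rsum_pair_ge0 I J (f : I * J -> R) : (forall ij, 0 <= f ij) ->
  rsummable f ->
  [/\ forall i, rsummable (fun j => f (i, j)),
      rsummable (fun i => rsum (fun j => f (i, j)))
    & rsum f = rsum (fun i => rsum (fun j => f (i, j)))].
Proof.
move=> f0 sf.
have E : (\esum_(i in [set: I]) \esum_(j in [set: J]) (f (i, j))%:E =
    \esum_(ij in [set: I * J]) (f ij)%:E)%E.
  rewrite (@esum_esum R I J [set: I] (fun=> [set: J]) (fun i j => (f (i, j))%:E)).
    by congr esum; [apply/seteqP; split|apply/funext => -[]].
  by move=> *; rewrite lee_fin.
have Elty : (\esum_(ij in [set: I * J]) (f ij)%:E < +oo)%E.
  by rewrite -(rsumEFin f0 sf) ltry.
have s1 i : rsummable (fun j => f (i, j)).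
  apply: (@le_lt_trans _ _ (\esum_(i in [set: I]) \esum_(j in [set: J]) (f (i, j))%:E)%E).
    rewrite (@esumID _ _ [set i]); last first.
      by move=> k _; apply: esum_ge0 => j _; rewrite lee_fin.
    rewrite setTI esum_set1; last by apply: esum_ge0 => j _; rewrite lee_fin.
    rewrite (@eq_esum _ _ _ _ (fun j => (f (i, j))%:E)); last first.
      by move=> j _; rewrite ger0_norm.
    rewrite leeDl//; apply: esum_ge0 => k _; apply: esum_ge0 => j _.
    by rewrite lee_fin.
  by rewrite E.
have s0 i : 0 <= rsum (fun j => f (i, j)) by exact: rsum_ge0.
have E2 : (\esum_(i in [set: I]) (rsum (fun j => f (i, j)))%:E =
    \esum_(ij in [set: I * J]) (f ij)%:E)%E.
  by rewrite -E; apply: eq_esum => i _; rewrite rsumEFin.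
have s2 : rsummable (fun i => rsum (fun j => f (i, j))).
  rewrite /rsummable; under eq_esum do rewrite ger0_norm//.
  by rewrite E2.
by split => //; apply: EFin_inj; rewrite !rsumEFin.
Qed.

Lemma rsum_pair I J (f : I * J -> R) : rsummable f ->
  rsum f = rsum (fun i => rsum (fun j => f (i, j))).
Proof.
move=> sf; rewrite (rsumE sf).
have [p1 p2 ->] := rsum_pair_ge0 (fun ij => rpos_ge0 (f ij)) (rsummable_rpos sf).
have [n1 n2 ->] := rsum_pair_ge0 (fun ij => rneg_ge0 (f ij)) (rsummable_rneg sf).
rewrite -rsumB_ge0//; try by move=> i; apply: rsum_ge0 => j; rewrite ?rpos_ge0 ?rneg_ge0.
congr rsum; apply/funext => i; rewrite -rsumB_ge0//.
- by congr rsum; apply/funext => j; rewrite -rposBneg.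
- by move=> j; exact: rpos_ge0.
- by move=> j; exact: rneg_ge0.
Qed.

(** Enumerating the integers gives access to the theorems on series, notably
    monotone convergence. *)
Lemma esum_int (f : int -> \bar R) : (forall n, 0 <= f n)%E ->
  (\esum_(n in [set: int]) f n = \sum_(k <oo) (f k%:Z + f (Negz k)))%E.
Proof.
move=> f0; rewrite nneseriesD//.
rewrite (esumID (range Posz)); last by move=> *; exact: f0.
rewrite setTI; congr (_ + _)%E.
  rewrite esum_set_image//.
    by apply: eq_eseriesl => k; exact: mem_set.
  by move=> i j _ _ [].
have -> : [set: int] `&` ~` range Posz = range Negz.
  apply/seteqP; split => [[n [_ []]|n _]|_ [n _ <-]] //=; first by exists n.
    by exists n.
  by split => // -[m _].
rewrite esum_set_image//.
  by apply: eq_eseriesl => k; exact: mem_set.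
by move=> i j _ _ [].
Qed.

Lemma esumZ_int (b : R) (g : int -> R) : 0 <= b -> (forall n, 0 <= g n) ->
  (\esum_(n in [set: int]) (b * g n)%:E = b%:E * \esum_(n in [set: int]) (g n)%:E)%E.
Proof.
move=> b0 g0; rewrite !esum_int; try by move=> n; rewrite lee_fin// mulr_ge0.
rewrite -nneseriesZl; last by move=> k _; rewrite -EFinD lee_fin addr_ge0.
by apply: eq_eseriesr => k _; rewrite -!EFinD -EFinM mulrDr.
Qed.

Lemma rsumZ (a : R) (f : int -> R) : rsummable f ->
  rsummable (fun n => a * f n) /\ rsum (fun n => a * f n) = a * rsum f.
Proof.
move=> sf.
have s (b : R) (g : int -> R) : rsummable g -> rsummable (fun n => b * g n).
  move=> sg; rewrite /rsummable; under eq_esum do rewrite normrM.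
  rewrite esumZ_int// lte_mul_pinfty// lee_fin//.
split; first exact: s.
have nn (b : R) (g : int -> R) : 0 <= b -> (forall n, 0 <= g n) -> rsummable g ->
    rsum (fun n => b * g n) = b * rsum g.
  move=> b0 g0 sg; apply: EFin_inj; rewrite EFinM !rsumEFin ?esumZ_int//.
    by move=> i; rewrite mulr_ge0.
  exact: s.
have nn2 (b : R) : 0 <= b -> rsum (fun n => b * f n) = b * rsum f.
  move=> b0; rewrite (rsumE sf) mulrBr -!nn//; first last.
  - exact: rsummable_rpos.
  - by move=> i; exact: rpos_ge0.
  - exact: rsummable_rneg.
  - by move=> i; exact: rneg_ge0.
  rewrite -rsumB_ge0//.
  - by congr rsum; apply/funext => i /=; rewrite -mulrBr -rposBneg.
  - by move=> i; rewrite mulr_ge0// rpos_ge0.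
  - by move=> i; rewrite mulr_ge0// rneg_ge0.
  - exact/s/rsummable_rpos.
  - exact/s/rsummable_rneg.
have [/nn2//|a0] := leP 0 a.
have := nn2 (- a); rewrite oppr_ge0 ltW// mulNr => /(_ isT) h.
apply: oppr_inj; rewrite -h -rsumN; last exact: s.
by congr rsum; apply/funext => i; rewrite mulNr.
Qed.

Lemma rsummable_pair (f g : int -> R) : rsummable f -> rsummable g ->
  rsummable (fun ij : int * int => f ij.1 * g ij.2).
Proof.
move=> sf sg; rewrite /rsummable.
have sg' : rsummable (fun j => `|g j|).
  by rewrite /rsummable; under eq_esum do rewrite normr_id.
have -> : (\esum_(ij in [set: int * int]) (`|f ij.1 * g ij.2|)%:E =
    \esum_(i in [set: int]) \esum_(j in [set: int]) (`|f i| * `|g j|)%:E)%E.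
  rewrite (@esum_esum R _ _ [set: int] (fun=> [set: int])
    (fun i j => (`|f i| * `|g j|)%:E)); last first.
    by move=> *; rewrite lee_fin mulr_ge0.
  congr esum; last by apply/funext => -[i j]; rewrite normrM.
  by apply/seteqP; split.
under eq_esum do rewrite esumZ_int// -rsumEFin// -EFinM mulrC.
rewrite esumZ_int//; last exact: rsum_ge0.
by rewrite lte_mul_pinfty// lee_fin rsum_ge0.
Qed.

Section exchange.
Context d (X : measurableType d) (mu : {measure set X -> \bar R}).
Variables (D : set X) (mD : measurable D) (Dfin : (mu D < +oo)%E).

Lemma rsum_measurable_ge0 (f : int -> X -> R) (c : int -> R) :
  (forall n x, 0 <= f n x) ->
  (forall n x, D x -> f n x <= c n) -> rsummable c ->
  (forall n, measurable_fun D (f n)) ->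
  measurable_fun D (fun x => rsum (fun n => f n x)).
Proof.
move=> f0 fc sc mf; apply/measurable_EFinP.
apply: (eq_measurable_fun
    (fun x => \sum_(k <oo | k \in predT) ((f k%:Z x)%:E + (f (Negz k) x)%:E))%E).
  move=> x; rewrite inE => Dx /=; rewrite rsumEFin//.
    by rewrite esum_int// => n; rewrite lee_fin.
  by apply: rsummable_le sc => i; rewrite ger0_norm//; exact: fc.
apply: ge0_emeasurable_sum.
  by move=> k x _ _; rewrite -EFinD lee_fin addr_ge0.
by move=> k _; apply: emeasurable_funD; exact/measurable_EFinP.
Qed.

Lemma rsum_measurable (f : int -> X -> R) (c : int -> R) :
  (forall n x, D x -> `|f n x| <= c n) -> rsummable c ->
  (forall n, measurable_fun D (f n)) ->
  measurable_fun D (fun x => rsum (fun n => f n x)).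
Proof.
move=> fc sc mf.
apply: (eq_measurable_fun (fun x => rsum (fun n => rpos (f n x)) - rsum (fun n => rneg (f n x)))).
  move=> x; rewrite inE => Dx; rewrite [RHS]rsumE//.
  by apply: rsummable_le sc => i; exact: fc.
apply: measurable_funB; apply: (rsum_measurable_ge0 (c := c)) => //.
- by move=> *; exact: rpos_ge0.
- by move=> n x Dx; apply: le_trans (rpos_le _) (fc _ _ Dx).
- by move=> n; apply: measurable_maxr.
- by move=> *; exact: rneg_ge0.
- by move=> n x Dx; apply: le_trans (rneg_le _) (fc _ _ Dx).
- by move=> n; apply: measurable_maxr => //; exact: measurable_funN.
Qed.

Lemma bounded_integrable (f : X -> R) (c : R) : measurable_fun D f ->
  (forall x, D x -> `|f x| <= c) -> mu.-integrable D (EFin \o f).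
Proof.
move=> mf fc; apply: measurable_bounded_integrable => //.
exists c; split; first exact: num_real.
by move=> M cM x Dx; apply: le_trans (fc x Dx) (ltW cM).
Qed.

Lemma rsum_integral_ge0 (f : int -> X -> R) (c : int -> R) :
  (forall n x, 0 <= f n x) ->
  (forall n x, D x -> f n x <= c n) -> rsummable c ->
  (forall n, measurable_fun D (f n)) ->
  rsummable (fun n => \int[mu]_(x in D) f n x) /\
  \int[mu]_(x in D) rsum (fun n => f n x) = rsum (fun n => \int[mu]_(x in D) f n x).
Proof.
move=> f0 fc sc mf.
have If n : mu.-integrable D (EFin \o f n).
  apply: (@bounded_integrable _ (c n)) => // x Dx.
  by rewrite ger0_norm//; exact: fc.
have fin n : (\int[mu]_(x in D) f n x)%:E = (\int[mu]_(x in D) (f n x)%:E)%E.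
  by rewrite /Rintegral fineK//; exact: (integrable_fin_num mD (If n)).
have i0 n : 0 <= \int[mu]_(x in D) f n x by apply: Rintegral_ge0.
have ss x : D x -> rsummable (fun n => f n x).
  by move=> Dx; apply: rsummable_le sc => i; rewrite ger0_norm// fc.
have E : (\int[mu]_(x in D) (rsum (fun n => f n x))%:E)%E =
    (\esum_(n in [set: int]) (\int[mu]_(x in D) f n x)%:E)%E.
  rewrite esum_int; last by move=> n; rewrite lee_fin.
  under eq_integral => x xD.
    rewrite rsumEFin//; last by apply: ss; rewrite inE in xD.
    rewrite esum_int; last by move=> n; rewrite lee_fin.
    over.
  rewrite integral_nneseries//.
  - apply: eq_eseriesr => k _; rewrite ge0_integralD ?fin//;
      try (by move=> x _; rewrite lee_fin); exact/measurable_EFinP.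
  - by move=> n; apply: emeasurable_funD; exact/measurable_EFinP.
  - by move=> n x _; rewrite -EFinD lee_fin addr_ge0.
have lty : (\esum_(n in [set: int]) (\int[mu]_(x in D) f n x)%:E < +oo)%E.
  rewrite -E; apply: integrable_lty => //.
  apply: (@bounded_integrable _ (rsum c)); first exact: (rsum_measurable_ge0 (c := c)).
  move=> x Dx; apply: le_norm_rsum => // n.
  by rewrite ger0_norm//; exact: fc.
split; first by rewrite /rsummable; under eq_esum do rewrite ger0_norm//.
rewrite [RHS]rsumE_ge0// -E//.
Qed.

Lemma rsum_integral (f : int -> X -> R) (c : int -> R) :
  (forall n x, D x -> `|f n x| <= c n) -> rsummable c ->
  (forall n, measurable_fun D (f n)) ->
  \int[mu]_(x in D) rsum (fun n => f n x) = rsum (fun n => \int[mu]_(x in D) f n x).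
Proof.
move=> fc sc mf.
have mp n : measurable_fun D (rpos \o f n).
  by apply: measurable_maxr.
have mn n : measurable_fun D (rneg \o f n).
  by apply: measurable_maxr => //; exact: measurable_funN.
have fp n x : D x -> rpos (f n x) <= c n.
  by move=> Dx; apply: le_trans (rpos_le _) (fc _ _ Dx).
have fn n x : D x -> rneg (f n x) <= c n.
  by move=> Dx; apply: le_trans (rneg_le _) (fc _ _ Dx).
have [sp ip] := rsum_integral_ge0 (fun n x => rpos_ge0 (f n x)) fp sc mp.
have [sn ineg] := rsum_integral_ge0 (fun n x => rneg_ge0 (f n x)) fn sc mn.
transitivity (\int[mu]_(x in D) (rsum (fun n => rpos (f n x)) - rsum (fun n => rneg (f n x)))).
  apply: eq_Rintegral => x; rewrite inE => Dx; rewrite [LHS]rsumE//.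
  by apply: rsummable_le sc => i; exact: fc.
rewrite RintegralB//; first last.
- apply: (@bounded_integrable _ (rsum c)).
    exact: (rsum_measurable_ge0 (fun n x => rneg_ge0 (f n x)) fn sc mn).
  move=> x Dx; apply: le_norm_rsum => // n.
  by rewrite ger0_norm ?rneg_ge0//; exact: fn.
- apply: (@bounded_integrable _ (rsum c)).
    exact: (rsum_measurable_ge0 (fun n x => rpos_ge0 (f n x)) fp sc mp).
  move=> x Dx; apply: le_norm_rsum => // n.
  by rewrite ger0_norm ?rpos_ge0//; exact: fp.
rewrite ip ineg -rsumB_ge0//; try by move=> n; apply: Rintegral_ge0 => x _;
  rewrite ?rpos_ge0 ?rneg_ge0.
congr rsum; apply/funext => n; rewrite -RintegralB//.
- by apply: eq_Rintegral => x _; rewrite -rposBneg.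
- apply: (@bounded_integrable _ (c n)); first exact: mp.
  by move=> x Dx; rewrite ger0_norm ?rpos_ge0//; exact: fp.
- apply: (@bounded_integrable _ (c n)); first exact: mn.
  by move=> x Dx; rewrite ger0_norm ?rneg_ge0//; exact: fn.
Qed.

End exchange.
End real_sums.

(** * Complex sums and integrals *)

Section complex_sums.
Context {R : realType}.
Local Notation C := (R[i]).
Local Notation Re := complex.Re.
Local Notation Im := complex.Im.

Lemma Re_add (z w : C) : Re (z + w) = Re z + Re w.
Proof. by case: z w => [? ?] []. Qed.

Lemma Im_add (z w : C) : Im (z + w) = Im z + Im w.
Proof. by case: z w => [? ?] []. Qed.

Lemma Re_mul (z w : C) : Re (z * w) = Re z * Re w - Im z * Im w.
Proof. by case: z w => [? ?] []. Qed.

Lemma Im_mul (z w : C) : Im (z * w) = Re z * Im w + Im z * Re w.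
Proof. by case: z w => [? ?] []. Qed.

(** The taxicab modulus.  It is equivalent to the modulus, submultiplicative, and
    built from real and imaginary parts without a square root. *)
Definition l1 (z : C) : R := `|Re z| + `|Im z|.

Lemma l1_ge0 z : 0 <= l1 z. Proof. by rewrite addr_ge0. Qed.

Lemma l1_Re z : `|Re z| <= l1 z. Proof. by rewrite lerDl. Qed.

Lemma l1_Im z : `|Im z| <= l1 z. Proof. by rewrite lerDr. Qed.

Lemma l1D z w : l1 (z + w) <= l1 z + l1 w.
Proof.
case: z w => [a b] [c d]; rewrite /l1/= [leRHS]addrACA.
by rewrite lerD// ler_normD.
Qed.

Lemma l1N z : l1 (- z) = l1 z.
Proof. by case: z => a b; rewrite /l1/= !normrN. Qed.

Lemma l1B z w : l1 (z - w) <= l1 z + l1 w.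
Proof. by rewrite -(l1N w) l1D. Qed.

Lemma l1_conj z : l1 z^* = l1 z.
Proof. by case: z => a b; rewrite /l1/= normrN. Qed.

Lemma l1_real (x : R) : l1 x%:C = `|x|.
Proof. by rewrite /l1/= normr0 addr0. Qed.

Lemma l1M z w : l1 (z * w) <= l1 z * l1 w.
Proof.
case: z w => [a b] [c d]; rewrite /l1/= mulrDl !mulrDr -!normrM.
have h1 := ler_normB (a * c) (b * d); have h2 := ler_normD (a * d) (b * c).
by have := lerD h1 h2; rewrite addrACA [X in _ <= X -> _]addrC; lra.
Qed.

Lemma l1M_le z w a b : l1 z <= a -> l1 w <= b -> l1 (z * w) <= a * b.
Proof. by move=> h k; apply: le_trans (l1M _ _) _; rewrite ler_pM// l1_ge0. Qed.

Lemma l1X_le z a n : l1 z <= a -> l1 (z ^+ n) <= a ^+ n.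
Proof.
move=> h; elim: n => [|n ih]; first by rewrite !expr0 l1_real normr1.
by rewrite !exprS; exact: l1M_le.
Qed.

Lemma l1Zr (a : R) z : l1 (a%:C * z) = `|a| * l1 z.
Proof.
by case: z => c d; rewrite /l1/= !mul0r subr0 addr0 mulrDr !normrM.
Qed.

Lemma sqmod_l1 z : sqmod z <= l1 z ^+ 2.
Proof.
case: z => a b; rewrite /sqmod /l1/=.
rewrite -(real_normK (num_real a)) -(real_normK (num_real b)).
have := mulr_ge0 (normr_ge0 a) (normr_ge0 b); nra.
Qed.

Lemma l1_sqmod z : l1 z ^+ 2 <= 2 * sqmod z.
Proof.
case: z => a b; rewrite /sqmod /l1/=.
rewrite -(real_normK (num_real a)) -(real_normK (num_real b)).
have := sqr_ge0 (`|a| - `|b|); nra.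
Qed.

Definition csummable (I : choiceType) (f : I -> C) :=
  rsummable (fun i => l1 (f i)).

Section generic.
Variable I : choiceType.
Implicit Types (f g : I -> C) (c : I -> R).

Lemma csummable_le f c : (forall i, l1 (f i) <= c i) -> rsummable c ->
  csummable f.
Proof.
by move=> fc; apply: rsummable_le => i; rewrite ger0_norm ?l1_ge0.
Qed.

Lemma csummable_Re f : csummable f -> rsummable (fun i => Re (f i)).
Proof. by apply: rsummable_le => i; exact: l1_Re. Qed.

Lemma csummable_Im f : csummable f -> rsummable (fun i => Im (f i)).
Proof. by apply: rsummable_le => i; exact: l1_Im. Qed.

Lemma csumD f g : csummable f -> csummable g ->
  csum (fun i => f i + g i) = csum f + csum g.
Proof.
move=> sf sg; transitivity (rsum (fun i => Re (f i) + Re (g i)) +i*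
  rsum (fun i => Im (f i) + Im (g i))).
  by rewrite /csum; congr Complex; congr rsum; apply/funext => i; rewrite ?Re_add ?Im_add.
have [h1 h2] := (csummable_Re sf, csummable_Im sf).
have [h3 h4] := (csummable_Re sg, csummable_Im sg).
by rewrite !rsumD.
Qed.

Lemma csumN f : csummable f -> csum (fun i => - f i) = - csum f.
Proof.
move=> sf; transitivity (rsum (fun i => - Re (f i)) +i* rsum (fun i => - Im (f i))).
  by rewrite /csum; congr Complex; congr rsum; apply/funext => i; case: (f i).
have [h1 h2] := (csummable_Re sf, csummable_Im sf).
by rewrite !rsumN.
Qed.

Lemma csummableN f : csummable f -> csummable (fun i => - f i).
Proof. by move=> sf; apply: csummable_le sf => i; rewrite l1N. Qed.

Lemma csummableD f g : csummable f -> csummable g ->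
  csummable (fun i => f i + g i).
Proof.
by move=> sf sg; apply: csummable_le (rsummableD sf sg) => i; exact: l1D.
Qed.

Lemma csumB f g : csummable f -> csummable g ->
  csum (fun i => f i - g i) = csum f - csum g.
Proof. by move=> sf sg; rewrite csumD ?csumN//; exact: csummableN. Qed.

Lemma csum_conj f : csummable f -> csum (fun i => (f i)^*) = (csum f)^*.
Proof.
move=> sf; transitivity (rsum (fun i => Re (f i)) +i* rsum (fun i => - Im (f i))).
  by rewrite /csum; congr Complex; congr rsum; apply/funext => i; case: (f i).
by rewrite !rsumN//; exact: csummable_Im.
Qed.

Lemma l1_csum f c : (forall i, l1 (f i) <= c i) -> rsummable c ->
  l1 (csum f) <= 2 * rsum c.
Proof.
move=> fc sc; rewrite mulr_natl mulr2n lerD//; apply: le_norm_rsum => // i.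
  by apply: le_trans (fc i); exact: l1_Re.
by apply: le_trans (fc i); exact: l1_Im.
Qed.

Lemma csum_reindex (J : choiceType) (e : J -> I) f : bijective e ->
  csum f = csum (f \o e).
Proof. by move=> be; rewrite /csum !(rsum_reindex _ be). Qed.

End generic.

Lemma csum_pair (I J : choiceType) (f : I * J -> C) : csummable f ->
  csum f = csum (fun i => csum (fun j => f (i, j))).
Proof.
move=> sf; rewrite /csum/=.
by rewrite (rsum_pair (csummable_Re sf)) (rsum_pair (csummable_Im sf)).
Qed.

Lemma csumZ (a : C) (f : int -> C) : csummable f ->
  csum (fun i => a * f i) = a * csum f.
Proof.
move=> sf; have [sr si] := (csummable_Re sf, csummable_Im sf).
transitivity (rsum (fun i => Re a * Re (f i) + - (Im a * Im (f i))) +i*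
              rsum (fun i => Re a * Im (f i) + Im a * Re (f i))).
  by rewrite /csum; congr Complex; congr rsum; apply/funext => i; rewrite ?Re_mul ?Im_mul.
have [s1 h1] := rsumZ (Re a) sr; have [s2 h2] := rsumZ (Im a) si.
have [s3 h3] := rsumZ (Re a) si; have [s4 h4] := rsumZ (Im a) sr.
rewrite !rsumD ?rsumN ?h1 ?h2 ?h3 ?h4//; last exact: rsummableN.
by case: (a).
Qed.

Lemma csummableZ (a : C) (f : int -> C) : csummable f ->
  csummable (fun i => a * f i).
Proof.
move=> sf; have [s _] := rsumZ (l1 a) sf.
by apply: csummable_le s => i; exact: l1M.
Qed.

End complex_sums.

Section complex_integral.
Context {R : realType}.
Local Notation C := (R[i]).
Local Notation Re := complex.Re.
Local Notation Im := complex.Im.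
Context d (X : measurableType d) (mu : {measure set X -> \bar R}).
Variable D : set X.
Hypothesis mD : measurable D.

Definition cint (f : X -> C) : C :=
  (\int[mu]_(t in D) Re (f t)) +i* (\int[mu]_(t in D) Im (f t)).

Definition cmeas (f : X -> C) :=
  measurable_fun D (fun t => Re (f t)) /\ measurable_fun D (fun t => Im (f t)).

Definition cintegrable (f : X -> C) :=
  mu.-integrable D (EFin \o (fun t => Re (f t))) /\
  mu.-integrable D (EFin \o (fun t => Im (f t))).

Lemma integrable_addr (f g : X -> R) : mu.-integrable D (EFin \o f) ->
  mu.-integrable D (EFin \o g) ->
  mu.-integrable D (EFin \o (fun t => f t + g t)).
Proof. by move=> If Ig; exact: (integrableD mD If Ig). Qed.

Lemma integrable_mulr (c : R) (f : X -> R) : mu.-integrable D (EFin \o f) ->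
  mu.-integrable D (EFin \o (fun t => c * f t)).
Proof. by move=> If; exact: (integrableZl mD c If). Qed.

Lemma cmeasD f g : cmeas f -> cmeas g -> cmeas (fun t => f t + g t).
Proof.
move=> [f1 f2] [g1 g2]; split.
  rewrite (_ : (fun t => _) = (fun t => Re (f t) + Re (g t))).
    exact: measurable_funD.
  by apply/funext => t; case: (f t) => ? ?; case: (g t).
rewrite (_ : (fun t => _) = (fun t => Im (f t) + Im (g t))).
  exact: measurable_funD.
by apply/funext => t; case: (f t) => ? ?; case: (g t).
Qed.

Lemma cmeasM f g : cmeas f -> cmeas g -> cmeas (fun t => f t * g t).
Proof.
move=> [f1 f2] [g1 g2]; split.
  rewrite (_ : (fun t => _) = (fun t => Re (f t) * Re (g t) - Im (f t) * Im (g t))).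
    by apply: measurable_funB; exact: measurable_funM.
  by apply/funext => t; case: (f t) => ? ?; case: (g t).
rewrite (_ : (fun t => _) = (fun t => Re (f t) * Im (g t) + Im (f t) * Re (g t))).
  by apply: measurable_funD; exact: measurable_funM.
by apply/funext => t; case: (f t) => ? ?; case: (g t).
Qed.

Lemma cmeas_cst c : cmeas (fun=> c).
Proof. by split; exact: measurable_cst. Qed.

Lemma cmeas_conj f : cmeas f -> cmeas (fun t => (f t)^*).
Proof.
move=> [f1 f2]; split.
  by rewrite (_ : (fun t => _) = (fun t => Re (f t)))//; apply/funext => t; case: (f t).
rewrite (_ : (fun t => _) = (fun t => - Im (f t))); first exact: measurable_funN.
by apply/funext => t; case: (f t).
Qed.

Lemma cmeasN f : cmeas f -> cmeas (fun t => - f t).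
Proof.
move=> mf; rewrite (_ : (fun t => _) = (fun t => (-1) * f t)).
  by apply: cmeasM => //; exact: cmeas_cst.
by apply/funext => t; rewrite mulN1r.
Qed.

Lemma measurable_l1 f : cmeas f -> measurable_fun D (fun t => l1 (f t)).
Proof.
by move=> [f1 f2]; apply: measurable_funD; exact: measurableT_comp.
Qed.

Lemma measurable_sqmod f : cmeas f -> measurable_fun D (fun t => sqmod (f t)).
Proof.
by move=> [f1 f2]; apply: measurable_funD; exact: measurable_funX.
Qed.

Lemma cintegrable_le f (g : X -> R) : cmeas f ->
  mu.-integrable D (EFin \o g) -> (forall t, D t -> l1 (f t) <= g t) ->
  cintegrable f.
Proof.
move=> [f1 f2] ig fg; split; apply: (le_integrable mD _ _ ig) => //.
- exact/measurable_EFinP.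
- move=> t Dt; rewrite /= lee_fin; apply: (le_trans _ (ler_norm _)).
  by apply: (le_trans _ (fg t Dt)); exact: l1_Re.
- exact/measurable_EFinP.
- move=> t Dt; rewrite /= lee_fin; apply: (le_trans _ (ler_norm _)).
  by apply: (le_trans _ (fg t Dt)); exact: l1_Im.
Qed.

Lemma cintegrable_cmeas f : cintegrable f -> cmeas f.
Proof.
by move=> [i1 i2]; split; apply/measurable_EFinP; apply: measurable_int; eassumption.
Qed.

Lemma cintegrable_l1 f : cintegrable f ->
  mu.-integrable D (EFin \o (fun t => l1 (f t))).
Proof.
by move=> [i1 i2]; apply: integrable_addr; exact: integrable_norm.
Qed.

Lemma cintegralD f g : cintegrable f -> cintegrable g ->
  cint (fun t => f t + g t) = cint f + cint g.
Proof.
move=> [f1 f2] [g1 g2].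
transitivity (\int[mu]_(t in D) (Re (f t) + Re (g t)) +i*
              \int[mu]_(t in D) (Im (f t) + Im (g t))).
  by rewrite /cint; congr Complex; apply: eq_Rintegral => t _; rewrite ?Re_add ?Im_add.
by rewrite !RintegralD.
Qed.

Lemma cintegrableD f g : cintegrable f -> cintegrable g ->
  cintegrable (fun t => f t + g t).
Proof.
move=> If Ig.
apply: (@cintegrable_le _ (fun t => l1 (f t) + l1 (g t))).
- by apply: cmeasD; exact: cintegrable_cmeas.
- by apply: integrable_addr; exact: cintegrable_l1.
- by move=> t _; exact: l1D.
Qed.

Lemma cintegrableZ a f : cintegrable f -> cintegrable (fun t => a * f t).
Proof.
move=> If; apply: (@cintegrable_le _ (fun t => l1 a * l1 (f t))).
- by apply: cmeasM; [exact: cmeas_cst|exact: cintegrable_cmeas].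
- by apply: integrable_mulr; exact: cintegrable_l1.
- by move=> t _; exact: l1M.
Qed.

Lemma cintegralZ a f : cintegrable f ->
  cint (fun t => a * f t) = a * cint f.
Proof.
move=> [f1 f2].
transitivity (\int[mu]_(t in D) (Re a * Re (f t) - Im a * Im (f t)) +i*
              \int[mu]_(t in D) (Re a * Im (f t) + Im a * Re (f t))).
  by rewrite /cint; congr Complex; apply: eq_Rintegral => t _; rewrite ?Re_mul ?Im_mul.
rewrite RintegralB ?RintegralD ?RintegralZl//; try exact: integrable_mulr.
by case: (a).
Qed.

Lemma cintegrableN f : cintegrable f -> cintegrable (fun t => - f t).
Proof.
move=> If; rewrite (_ : (fun t => _) = (fun t => (-1) * f t)).
  exact: cintegrableZ.
by apply/funext => t; rewrite mulN1r.
Qed.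

Lemma cintegralN f : cintegrable f ->
  cint (fun t => - f t) = - cint f.
Proof.
move=> If; rewrite -mulN1r -cintegralZ//.
by congr cint; apply/funext => t; rewrite mulN1r.
Qed.

Lemma cintegralB f g : cintegrable f -> cintegrable g ->
  cint (fun t => f t - g t) = cint f - cint g.
Proof. by move=> If Ig; rewrite cintegralD ?cintegralN//; exact: cintegrableN. Qed.

Lemma cintegral_conj f : cintegrable f ->
  cint (fun t => (f t)^*) = (cint f)^*.
Proof.
move=> [f1 f2].
transitivity (\int[mu]_(t in D) Re (f t) +i* \int[mu]_(t in D) ((-1) * Im (f t))).
  by rewrite /cint; congr Complex; apply: eq_Rintegral => t _; case: (f t) => //= ? ?; rewrite mulN1r.
by rewrite RintegralZl// mulN1r.
Qed.

Lemma eq_cintegral f g : {in D, f =1 g} -> cint f = cint g.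
Proof.
by move=> fg; rewrite /cint; congr Complex; apply: eq_Rintegral => t tD;
  rewrite fg.
Qed.

Lemma l1_cintegral f (g : X -> R) : cmeas f ->
  mu.-integrable D (EFin \o g) -> (forall t, D t -> l1 (f t) <= g t) ->
  l1 (cint f) <= 2 * \int[mu]_(t in D) g t.
Proof.
move=> mf ig fg; have [i1 i2] := cintegrable_le mf ig fg.
rewrite mulr_natl mulr2n /l1/= lerD//;
  apply: (le_trans (le_normr_Rintegral _ _)) => //; apply: le_Rintegral => //;
  try (by apply: integrable_norm); move=> t Dt; apply: le_trans (fg t Dt);
  [exact: l1_Re|exact: l1_Im].
Qed.

Hypothesis Dfin : (mu D < +oo)%E.

Lemma csum_cmeas (f : int -> X -> C) (c : int -> R) :
  (forall n t, D t -> l1 (f n t) <= c n) -> rsummable c ->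
  (forall n, cmeas (f n)) -> cmeas (fun t => csum (fun n => f n t)).
Proof.
move=> fc sc mf; split; apply: (rsum_measurable (c := c)) => //.
- by move=> n t Dt; apply: le_trans (l1_Re _) (fc _ _ Dt).
- by move=> n; case: (mf n).
- by move=> n t Dt; apply: le_trans (l1_Im _) (fc _ _ Dt).
- by move=> n; case: (mf n).
Qed.

Lemma csum_cintegral (f : int -> X -> C) (c : int -> R) :
  (forall n t, D t -> l1 (f n t) <= c n) -> rsummable c ->
  (forall n, cmeas (f n)) ->
  cint (fun t => csum (fun n => f n t)) = csum (fun n => cint (f n)).
Proof.
move=> fc sc mf; rewrite /cint /csum/=.
rewrite (rsum_integral mD Dfin (c := c))//; first last.
- by move=> n; case: (mf n).
- by move=> n t Dt; apply: le_trans (l1_Re _) (fc _ _ Dt).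
rewrite (rsum_integral mD Dfin (c := c))//.
- by move=> n t Dt; apply: le_trans (l1_Im _) (fc _ _ Dt).
- by move=> n; case: (mf n).
Qed.

Lemma bounded_integrable_cst (c : R) : mu.-integrable D (EFin \o (fun=> c)).
Proof.
by apply: (bounded_integrable mD Dfin (c := `|c|)) => //; exact: measurable_cst.
Qed.

Lemma bounded_cintegrable f (c : R) : cmeas f ->
  (forall t, D t -> l1 (f t) <= c) -> cintegrable f.
Proof. by move=> mf fc; apply: (cintegrable_le mf (bounded_integrable_cst c)). Qed.

Lemma l1_cintegral_bounded f (c : R) : cmeas f ->
  (forall t, D t -> l1 (f t) <= c) ->
  l1 (cint f) <= 2 * (c * fine (mu D)).
Proof.
move=> mf fc; rewrite -Rintegral_cst//.
exact: (l1_cintegral mf (bounded_integrable_cst c)).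
Qed.

End complex_integral.

(** * Completeness of the space of square integrable functions *)

Section riesz_fischer.
Context {R : realType}.
Local Notation C := (R[i]).
Local Notation Re := complex.Re.
Local Notation Im := complex.Im.

Lemma cvg_summable_steps (x : nat -> R) :
  (\sum_(k <oo) (`|x k.+1 - x k|)%:E < +oo)%E -> cvgn x.
Proof.
move=> xoo.
have s0 : (0 <= \sum_(k <oo) (`|x k.+1 - x k|)%:E)%E.
  by apply: nneseries_ge0 => k _ _; rewrite lee_fin.
have cs : cvgn (series (fun k => x k.+1 - x k)).
  apply: normed_cvg; apply: nondecreasing_is_cvgn.
    apply/nondecreasing_seqP => n.
    by rewrite /= /series/= big_nat_recr//= lerDl.
  exists (fine (\sum_(k <oo) (`|x k.+1 - x k|)%:E)) => _ [n _ <-] /=.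
  rewrite -lee_fin fineK ?ge0_fin_numE// /series/= -sumEFin.
  by apply: nneseries_lim_ge => i _ _; rewrite lee_fin.
rewrite (_ : x = (fun n => x 0%N + series (fun k => x k.+1 - x k) n)).
  by apply: is_cvgD => //; exact: is_cvg_cst.
by apply/funext => n; rewrite /series/= telescope_sumr// addrC subrK.
Qed.

Lemma limn_einf_le (u : (\bar R)^nat) (e : \bar R) (K : nat) :
  (forall k, (K <= k)%N -> (u k <= e)%E) -> (limn_einf u <= e)%E.
Proof.
move=> ue; rewrite limn_einf_lim; apply: lime_le; first exact: is_cvg_einfs.
apply: nearW => n; apply: le_trans (ue (maxn n K) (leq_maxr _ _)).
by apply: ereal_inf_lbound; exists (maxn n K) => //=; exact: leq_maxl.
Qed.

(** The arithmetic-geometric inequality in this form turns square integrable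
    increments of size q ^+ 2 into integrable increments of size q, on a space of
    finite measure. *)
Lemma l1_weighted (q : R) (z : C) : 0 < q -> l1 z <= q^-1 * sqmod z + q.
Proof.
move=> q0; rewrite -(ler_pM2l q0) [leRHS]mulrDr mulrA mulfV ?gt_eqF// mul1r.
have := l1_sqmod z; have := sqr_ge0 (l1 z - q).
move: (l1 z) (sqmod z) => a b; nra.
Qed.

Context d (X : measurableType d) (mu : {measure set X -> \bar R}).
Variable D : set X.
Hypothesis mD : measurable D.
Hypothesis Dfin : (mu D < +oo)%E.

Definition L2dom : set (X -> C^o) :=
  [set f | cmeas D f /\ mu.-integrable D (EFin \o (fun t => sqmod (f t)))].

Definition L2ip (f g : X -> C^o) : C := cint mu D (fun t => (f t : C) * (g t : C)^*).

Definition L2sqn (f : X -> C^o) : R := \int[mu]_(t in D) sqmod (f t).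

(** The product is dominated by the sum of the squared moduli. *)
Lemma L2_mul f g : L2dom f -> L2dom g ->
  cintegrable mu D (fun t => (f t : C) * (g t : C)^*).
Proof.
move=> [mf If] [mg Ig].
apply: (cintegrable_le mD (g := fun t => sqmod (f t) + sqmod (g t))).
- by apply: cmeasM => //; exact: cmeas_conj.
- exact: integrable_addr.
- move=> t _; apply: (le_trans (l1M _ _)); rewrite l1_conj.
  have := l1_sqmod (f t); have := l1_sqmod (g t).
  have := sqr_ge0 (l1 (f t) - l1 (g t)).
  move: (l1 _) (l1 _) (sqmod _) (sqmod _) => a b p q; nra.
Qed.

Lemma L2_bounded f c : cmeas D f -> (forall t, D t -> l1 (f t) <= c) -> L2dom f.
Proof.
move=> mf fc; split => //.
apply: (bounded_integrable mD Dfin (c := c ^+ 2)); first exact: measurable_sqmod.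
move=> t Dt; rewrite ger0_norm ?sqmod_ge0//; apply: (le_trans (sqmod_l1 _)).
by rewrite lerXn2r ?nnegrE ?l1_ge0 ?fc//; apply: le_trans (fc t Dt); exact: l1_ge0.
Qed.

Lemma L2_mul_bounded f g c : L2dom g -> cmeas D f ->
  (forall t, D t -> l1 (f t) <= c) -> cintegrable mu D (fun t => f t * g t).
Proof.
move=> dg mf fc.
have df : L2dom (fun t => (f t)^*).
  by apply: (@L2_bounded _ c) => [|t Dt]; [exact: cmeas_conj|rewrite l1_conj fc].
rewrite (_ : (fun t => _) = (fun t => (g t : C) * (((f t)^* : C))^*)).
  exact: L2_mul.
by apply/funext => t; rewrite conjCK mulrC.
Qed.

Lemma sqmodM z w : sqmod (z * w : C) = sqmod z * sqmod w.
Proof. by case: z w => [a b] [c e]; rewrite /sqmod/=; ring. Qed.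

Lemma sqmodD_le z w : sqmod (z + w : C) <= 2 * sqmod z + 2 * sqmod w.
Proof.
case: z w => [a b] [c e]; rewrite /sqmod/=.
have := sqr_ge0 (a - c); have := sqr_ge0 (b - e); nra.
Qed.

Lemma sqmodN z : sqmod (- z : C) = sqmod z.
Proof. by case: z => [a b]; rewrite /sqmod/= !sqrrN. Qed.

Lemma L2dom0 : L2dom 0.
Proof.
apply: (@L2_bounded _ 0); first exact: cmeas_cst.
by move=> t _; rewrite /l1/= normr0 addr0.
Qed.

Lemma L2dom_lin a f g : L2dom f -> L2dom g -> L2dom (a *: f + g).
Proof.
move=> [mf If] [mg Ig].
have m : cmeas D (a *: f + g).
  apply: (cmeasD (f := fun t => a * f t)) => //.
  by apply: cmeasM => //; exact: cmeas_cst.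
split => //.
apply: (le_integrable mD _ _ (integrable_addr mD
  (integrable_mulr mD (2 * sqmod a) If) (integrable_mulr mD 2 Ig))) => /=.
  by apply/measurable_EFinP; exact: measurable_sqmod.
move=> t _; rewrite lee_fin ger0_norm ?sqmod_ge0//.
apply: (le_trans _ (ler_norm _)).
by apply: (le_trans (sqmodD_le _ _)); rewrite sqmodM mulrA.
Qed.

Lemma L2ip_lin a f g h : L2dom f -> L2dom g -> L2dom h ->
  L2ip (a *: f + g) h = a * L2ip f h + L2ip g h.
Proof.
move=> df dg dh; rewrite /L2ip -cintegralZ//; last exact: L2_mul.
rewrite -cintegralD//; [|by apply: cintegrableZ => //; exact: L2_mul|exact: L2_mul].
by congr cint; apply/funext => t /=; rewrite mulrDl mulrA.
Qed.

Lemma L2ip_conj f g : L2dom f -> L2dom g -> L2ip g f = (L2ip f g)^*.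
Proof.
move=> df dg; rewrite /L2ip -cintegral_conj//; last exact: L2_mul.
by congr cint; apply/funext => t; rewrite [RHS]rmorphM [X in _ = _ * X]conjCK mulrC.
Qed.

Lemma L2ip_self f : L2ip f f = (L2sqn f)%:C.
Proof.
rewrite /L2ip /L2sqn /cint; congr Complex.
  by apply: eq_Rintegral => t _; case: (f t) => a b; rewrite /sqmod/=; ring.
transitivity (\int[mu]_(t in D) 0); last by rewrite Rintegral_cst// mul0r.
by apply: eq_Rintegral => t _; case: (f t) => a b /=; ring.
Qed.

Lemma L2ip_ge0 f : L2dom f -> 0 <= L2ip f f.
Proof.
move=> df; rewrite L2ip_self ler0c; apply: Rintegral_ge0 => t _.
exact: sqmod_ge0.
Qed.

Lemma L2domB f g : L2dom f -> L2dom g -> L2dom (f - g).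
Proof. by move=> df dg; rewrite addrC -scaleN1r; exact: L2dom_lin. Qed.

Lemma fast_subsequence (u : nat -> X -> C^o) (q : nat -> R) :
  (forall k, 0 < q k) ->
  (forall e : R, 0 < e -> exists N, forall m n, (N <= m)%N -> (N <= n)%N ->
     L2sqn (u m - u n) < e) ->
  exists phi : nat -> nat, [/\ forall k m n, (phi k <= m)%N -> (phi k <= n)%N ->
    L2sqn (u m - u n) < q k, forall k, (phi k <= phi k.+1)%N &
    forall k, (k <= phi k)%N].
Proof.
move=> q0 cau.
have /choice[N hN] : forall k, exists N, forall m n, (N <= m)%N -> (N <= n)%N ->
     L2sqn (u m - u n) < q k by move=> k; exact: cau.
exists (fun k => \sum_(j < k.+1) (N j).+1)%N; split.
- move=> k m n km kn.
  have Nk : (N k <= \sum_(j < k.+1) (N j).+1)%N.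
    by rewrite big_ord_recr/=; apply: leq_trans (leq_addl _ _).
  by apply: hN; exact: leq_trans Nk _.
- by move=> k; rewrite [leqRHS]big_ord_recr/= leq_addr.
- elim=> // k ih; rewrite big_ord_recr/= addnS ltnS.
  by apply: leq_trans ih _; exact: leq_addr.
Qed.

Lemma cvg_sqmod (x y : nat -> R) (l l' : R) (c : C) :
  x n @[n --> \oo] --> l -> y n @[n --> \oo] --> l' ->
  (sqmod ((x n +i* y n) - c))%:E @[n --> \oo] --> (sqmod ((l +i* l') - c))%:E.
Proof.
move=> xl yl; apply: cvg_EFin; first by apply: nearW.
case: c => a b; rewrite /sqmod/=.
have xa : (x n - a) @[n --> \oo] --> l - a by apply: cvgB => //; exact: cvg_cst.
have yb : (y n - b) @[n --> \oo] --> l' - b by apply: cvgB => //; exact: cvg_cst.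
by apply: cvgD; under eq_fun do rewrite expr2; rewrite expr2; exact: cvgM.
Qed.

(** Riesz-Fischer.  A subsequence v with square integrable increments below
    q k ^+ 2, q summable, has integrable increments of summable norm; the sum of
    these increments is finite almost everywhere, and there v converges.  Fatou's
    lemma bounds the distance from the limit w to the terms of u.  Upper limits
    define w everywhere and keep it measurable. *)
Lemma L2_complete (u : nat -> X -> C^o) : (forall n, L2dom (u n)) ->
  (forall e : R, 0 < e -> exists N, forall m n, (N <= m)%N -> (N <= n)%N ->
     Re (L2ip (u m - u n) (u m - u n)) < e) ->
  exists2 f, L2dom f & vanishing (fun n => Re (L2ip (u n - f) (u n - f))).
Proof.
move=> du cau0.
have cau (e : R) : 0 < e -> exists N, forall m n, (N <= m)%N -> (N <= n)%N ->
     L2sqn (u m - u n) < e.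
  move=> /cau0[N hN]; exists N => m n Nm Nn; have := hN _ _ Nm Nn.
  by rewrite L2ip_self.
(* a summable rate, the one of epsilon_trick0 *)
pose q k : R := 1 / (2 ^ k.+1)%:R.
have q0 k : 0 < q k by rewrite divr_gt0// ltr0n expn_gt0.
have [phi [hphi phi_mono phi_ge]] := fast_subsequence (fun k => exprn_gt0 2 (q0 k)) cau.
pose v k := u (phi k).
have dv k : L2dom (v k) by exact: du.
have vstep k : L2sqn (v k.+1 - v k) < q k ^+ 2.
  exact: hphi.
have dstep k : L2dom (v k.+1 - v k) by exact: L2domB.
have mstep k : measurable_fun D (fun s => l1 (v k.+1 s - v k s)).
  by apply: (measurable_l1 (f := fun s => v k.+1 s - v k s)); case: (dstep k).
pose M := 1 + fine (mu D).
have M0 : 0 <= M by rewrite addr_ge0// fine_ge0.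
have istep k : (\int[mu]_(s in D) (l1 (v k.+1 s - v k s))%:E <= (M / (2 ^ k.+1)%:R)%:E)%E.
  have Ih : mu.-integrable D (EFin \o
      (fun s => (q k)^-1 * sqmod (v k.+1 s - v k s) + q k)).
    apply: integrable_addr => //; last exact: bounded_integrable_cst.
    by apply: integrable_mulr => //; case: (dstep k).
  apply: (@le_trans _ _ (\int[mu]_(s in D)
      ((q k)^-1 * sqmod (v k.+1 s - v k s) + q k)%:E)%E).
    apply: ge0_le_integral => //.
    - by move=> s _; rewrite lee_fin l1_ge0.
    - exact/measurable_EFinP.
    - by case/integrableP : Ih.
    - by move=> s _; rewrite lee_fin l1_weighted.
  rewrite -(fineK (integrable_fin_num mD Ih)) lee_fin.
  rewrite -/(Rintegral mu D (fun s => (q k)^-1 * sqmod (v k.+1 s - v k s) + q k)).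
  have Is : mu.-integrable D (EFin \o (fun s => sqmod (v k.+1 s - v k s))).
    by case: (dstep k).
  rewrite RintegralD//; [|exact: integrable_mulr|exact: bounded_integrable_cst].
  rewrite RintegralZl// Rintegral_cst//.
  rewrite -/(L2sqn (v k.+1 - v k)) (_ : M / _ = q k * M); last by rewrite mulrC /q div1r.
  rewrite /M mulrDr mulr1 lerD2r mulrC ler_pdivrMr//.
  by rewrite -expr2 ltW.
pose g s := (\sum_(k <oo) (l1 (v k.+1 s - v k s))%:E)%E.
have mg : measurable_fun D g.
  apply: (eq_measurable_fun
      (fun x => \sum_(k <oo | k \in predT) (l1 (v k.+1 x - v k x))%:E)%E) => //.
  apply: ge0_emeasurable_sum; first by move=> k x _ _; rewrite lee_fin l1_ge0.
  by move=> k _; exact/measurable_EFinP.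
have g0 s : (0 <= g s)%E by apply: nneseries_ge0 => k _ _; rewrite lee_fin l1_ge0.
have Ig : mu.-integrable D g.
  apply/integrableP; split => //; under eq_integral do rewrite gee0_abs//.
  rewrite integral_nneseries//; last 2 first.
  - by move=> k; exact/measurable_EFinP.
  - by move=> k s _; rewrite lee_fin l1_ge0.
  apply: le_lt_trans (ltry M); apply: le_trans (epsilon_trick0 xpredT M0).
  apply: lee_nneseries => [k _ _|k _]; last exact: istep.
  by apply: integral_ge0 => s _; rewrite lee_fin l1_ge0.
pose wr s := fine (limn_esup (fun k => (Re (v k s))%:E)).
pose wi s := fine (limn_esup (fun k => (Im (v k s))%:E)).
pose w s : C^o := wr s +i* wi s.
have mw : cmeas D w.
  split; apply: (measurable_comp (F := setT) measurableT _ (fine_measurable measurableT)) => //.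
  - by apply: measurable_fun_limn_esup => k; apply/measurable_EFinP; case: (dv k) => -[].
  - by apply: measurable_fun_limn_esup => k; apply/measurable_EFinP; case: (dv k) => -[].
have cvgRe s : g s \is a fin_num -> Re (v k s) @[k --> \oo] --> wr s.
  rewrite ge0_fin_numE// => gs.
  have c : cvgn (fun k => Re (v k s)).
    apply: cvg_summable_steps; apply: le_lt_trans gs.
    apply: lee_nneseries => [k _ _|k _]; first by rewrite lee_fin.
    by rewrite lee_fin; apply: le_trans (l1_Re _); rewrite Re_add; case: (v k s).
  suff -> : wr s = limn (fun k => Re (v k s)) by [].
  have /cvg_limn_einf_sup[_ h] : (Re (v k s))%:E @[k --> \oo] -->
      (limn (fun k => Re (v k s)))%:E by apply: cvg_EFin => //; apply: nearW.
  by rewrite /wr h.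
have cvgIm s : g s \is a fin_num -> Im (v k s) @[k --> \oo] --> wi s.
  rewrite ge0_fin_numE// => gs.
  have c : cvgn (fun k => Im (v k s)).
    apply: cvg_summable_steps; apply: le_lt_trans gs.
    apply: lee_nneseries => [k _ _|k _]; first by rewrite lee_fin.
    by rewrite lee_fin; apply: le_trans (l1_Im _); rewrite Im_add; case: (v k s).
  suff -> : wi s = limn (fun k => Im (v k s)) by [].
  have /cvg_limn_einf_sup[_ h] : (Im (v k s))%:E @[k --> \oo] -->
      (limn (fun k => Im (v k s)))%:E by apply: cvg_EFin => //; apply: nearW.
  by rewrite /wi h.
have fatou_bound n K (e : R) : (forall k, (K <= k)%N -> L2sqn (v k - u n) <= e) ->
    (\int[mu]_(s in D) (sqmod (w s - u n s))%:E <= e%:E)%E.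
  move=> he.
  have mvu k : measurable_fun D (fun s => (sqmod (v k s - u n s))%:E).
    apply/measurable_EFinP; apply: (measurable_sqmod (f := fun s => v k s - u n s)).
    by case: (L2domB (dv k) (du n)).
  have -> : (\int[mu]_(s in D) (sqmod (w s - u n s))%:E =
      \int[mu]_(s in D) limn_einf (fun k => (sqmod (v k s - u n s))%:E))%E.
    apply: ge0_ae_eq_integral => //.
    - apply/measurable_EFinP; apply: (measurable_sqmod (f := fun s => w s - u n s)).
      by apply: cmeasD => //; apply: cmeasN; case: (du n).
    - rewrite (_ : (fun s => _) = (fun s => - limn_esup (fun k => - (sqmod (v k s - u n s))%:E))%E).
        apply: measurableT_comp => //; apply: measurable_fun_limn_esup => k.
        exact: measurableT_comp.
      by apply/funext => s; rewrite -[LHS]oppeK -limn_esupN.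
    - by move=> s _; rewrite lee_fin sqmod_ge0.
    - move=> s _; rewrite limn_einf_lim; apply: lime_ge; first exact: is_cvg_einfs.
      apply: nearW => k; apply: le_ereal_inf_tmp => _ [j _ <-].
      by rewrite lee_fin sqmod_ge0.
    - have := integrable_ae mD Ig; apply: filterS => s hs Ds.
      have gs := hs Ds.
      have /cvg_limn_einf_sup[h _] :=
        cvg_sqmod (c := u n s) (cvgRe _ gs) (cvgIm _ gs).
      rewrite -[LHS]h; congr limn_einf; apply/funext => k.
      by case: (v k s).
  apply: le_trans (fatou _ _ _ _) _ => //.
    by move=> k s _; rewrite lee_fin sqmod_ge0.
  apply: (limn_einf_le (K := K)) => k Kk.
  have Is : mu.-integrable D (EFin \o (fun s => sqmod (v k s - u n s))).
    by case: (L2domB (dv k) (du n)).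
  by rewrite -(fineK (integrable_fin_num mD Is)) lee_fin; exact: he.
have dwu n K (e : R) : (forall k, (K <= k)%N -> L2sqn (v k - u n) <= e) ->
    L2dom (w - u n) /\ L2sqn (w - u n) <= e.
  move=> /fatou_bound h.
  have m : cmeas D (w - u n).
    by apply: cmeasD => //; apply: cmeasN; case: (du n).
  have I : mu.-integrable D (EFin \o (fun s => sqmod ((w - u n) s))).
    apply/integrableP; split; first exact/measurable_EFinP/measurable_sqmod.
    under eq_integral do rewrite gee0_abs ?lee_fin ?sqmod_ge0//.
    by apply: le_lt_trans h _; exact: ltry.
  split; first by split.
  by rewrite -lee_fin /L2sqn /Rintegral fineK//; exact: (integrable_fin_num mD I).
have close (e : R) : 0 < e -> exists N, forall n, (N <= n)%N ->
    L2dom (w - u n) /\ L2sqn (w - u n) <= e.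
  move=> /cau[N hN]; exists N => n Nn; apply: (dwu n N) => k Nk.
  by apply/ltW/hN => //; apply: leq_trans Nk _; exact: phi_ge.
have [N hN] := close 1 ltr01.
have dw : L2dom w.
  rewrite -(subrK (u N) w) -[w - _]scale1r; apply: L2dom_lin => //.
  by case: (hN N (leqnn N)).
exists w => // e e0; have [N' hN'] := close _ (divr_gt0 e0 (ltr0n _ 2)).
exists N' => n /hN'[_ h]; rewrite L2ip_self/=.
have -> : L2sqn (u n - w) = L2sqn (w - u n).
  by apply: eq_Rintegral => s _; rewrite -sqmodN /= opprB.
by apply: le_lt_trans h _; lra.
Qed.

Definition L2space : semi_hilbert (X -> C^o) :=
  SemiHilbert L2dom0 L2dom_lin L2ip_lin L2ip_conj L2ip_ge0 L2_complete.

End riesz_fischer.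

(** * Second order bounds for the exponential *)

Section complex_exponential.
Context {R : realType}.
Local Notation C := (R[i]).
Local Notation Re := complex.Re.
Local Notation Im := complex.Im.

Lemma norm_sin_le (x : R) : `|sin x| <= `|x|.
Proof.
wlog x0 : x / 0 <= x => [hw|].
  by have [/hw//|/ltW x0] := leP 0 x; rewrite -normrN -sinN -[leRHS]normrN hw// oppr_ge0.
have [c _] := @MVT_segment R sin cos 0 x x0 (fun y _ => is_derive_sin y)
  (continuous_subspaceT (@continuous_sin R)).
by rewrite sin0 !subr0 => ->; rewrite normrM ler_piMl// cos_max.
Qed.

Lemma norm_cosB1_le (x : R) : `|cos x - 1| <= `|x|.
Proof.
wlog x0 : x / 0 <= x => [hw|].
  by have [/hw//|/ltW x0] := leP 0 x; rewrite -cosN -[leRHS]normrN hw// oppr_ge0.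
have [c _] := @MVT_segment R cos (fun y => - sin y) 0 x x0 (fun y _ => is_derive_cos y)
  (continuous_subspaceT (@continuous_cos R)).
by rewrite cos0 subr0 => ->; rewrite normrM ler_piMl// normrN sin_max.
Qed.

Lemma norm_cosB1_sqr (x : R) : `|cos x - 1| <= `|x| ^+ 2.
Proof.
wlog x0 : x / 0 <= x => [hw|].
  by have [/hw//|/ltW x0] := leP 0 x; rewrite -cosN -[`|x|]normrN hw// oppr_ge0.
have [c] := @MVT_segment R cos (fun y => - sin y) 0 x x0 (fun y _ => is_derive_cos y)
  (continuous_subspaceT (@continuous_cos R)).
rewrite in_itv/= => /andP[c0 cx].
rewrite cos0 subr0 => ->; rewrite normrM normrN expr2 ler_wpM2r//.
by apply: le_trans (norm_sin_le c) _; rewrite !ger0_norm.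
Qed.

Lemma norm_sinBid_le (x : R) : `|sin x - x| <= `|x| ^+ 2.
Proof.
wlog x0 : x / 0 <= x => [hw|].
  have [/hw//|/ltW x0] := leP 0 x.
  have := hw (- x); rewrite oppr_ge0 => /(_ x0).
  have -> : sin (- x) - - x = - (sin x - x) by rewrite sinN; ring.
  by rewrite !normrN.
have := @MVT_segment R (fun y => sin y - y) (fun y => cos y - 1) 0 x x0.
case.
- apply: continuous_subspaceT => y.
  by apply: cvgB; [exact: continuous_sin|exact: cvg_id].
- move=> c; rewrite in_itv/= => /andP[c0 cx].
  rewrite sin0 !subr0 => ->; rewrite normrM expr2 ler_wpM2r//.
  by apply: le_trans (norm_cosB1_le c) _; rewrite !ger0_norm.
Qed.

Lemma norm_expRB1_le (x : R) : `|expR x - 1| <= `|x| * expR `|x|.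
Proof.
have h1 := expR_ge1Dx x; have h2 := expR_ge1Dx (- x).
have e0 := expR_gt0 x.
have E : expR (- x) * expR x = 1 by rewrite mulrC expRxMexpNx_1.
have [x0|x0] := leP 0 x.
  rewrite (ger0_norm x0) ger0_norm; last by lra.
  have := ler_wpM2r (ltW e0) h2; rewrite E; lra.
rewrite (ltr0_norm x0) ltr0_norm; last first.
  by rewrite subr_lt0 -expR0 ltr_expR.
have : 0 <= - x * (expR (- x) - 1).
  by rewrite mulr_ge0//; lra.
lra.
Qed.

Lemma norm_expR_taylor (x : R) : `|expR x - 1 - x| <= x ^+ 2 * expR `|x|.
Proof.
have h1 := expR_ge1Dx x; have h2 := norm_expRB1_le x.
have h3 := expR_ge1Dx `|x|; have e0 := expR_gt0 x.
rewrite ger0_norm; last by lra.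
have E : expR (- x) * expR x = 1 by rewrite mulrC expRxMexpNx_1.
have h4 := ler_wpM2r (ltW e0) (expR_ge1Dx (- x)); rewrite E in h4.
apply: (@le_trans _ _ (x * (expR x - 1))); first by lra.
apply: le_trans (ler_norm _) _; rewrite normrM -(real_normK (num_real x)) expr2 -mulrA.
by rewrite ler_wpM2l.
Qed.

Lemma cexpD (z w : C) : cexp (z + w) = cexp z * cexp w.
Proof.
case: z w => [a b] [c d]; rewrite /cexp/= expRD cosD sinD.
by apply/eqP; rewrite eq_complex/=; apply/andP; split; apply/eqP; ring.
Qed.

Lemma cexp_conj (z : C) : cexp z^* = (cexp z)^*.
Proof.
case: z => a b; rewrite /cexp/= cosN sinN.
by apply/eqP; rewrite eq_complex/=; apply/andP; split; apply/eqP; ring.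
Qed.

Lemma l1_cexp (z : C) : l1 (cexp z) <= 2 * expR (Re z).
Proof.
case: z => a b; rewrite /cexp l1Zr/= ger0_norm ?expR_ge0// mulrC.
rewrite ler_wpM2r ?expR_ge0//.
by apply: (@le_trans _ _ (1 + 1)); [rewrite lerD ?cos_max ?sin_max|lra].
Qed.

Lemma l1_cexp_taylor (w : C) :
  l1 (cexp w - 1 - w) <= 4 * l1 w ^+ 2 * expR (l1 w).
Proof.
case: w => x y; pose L := l1 (x +i* y); rewrite -/L.
have [Lx Ly] : `|x| <= L /\ `|y| <= L by rewrite /L /l1/= lerDl lerDr.
have L0 : 0 <= L by apply: le_trans Lx.
have Ex : expR `|x| <= expR L by rewrite ler_expR.
have E1 : 1 <= expR L by rewrite -expR0 ler_expR.
have ex : expR x <= expR L by rewrite ler_expR; apply: le_trans Lx; exact: ler_norm.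
have x2 : x ^+ 2 <= L ^+ 2 by rewrite -(real_normK (num_real x)) lerXn2r ?nnegrE.
have y2 : `|y| ^+ 2 <= L ^+ 2 by rewrite lerXn2r ?nnegrE.
have M (a b c d : R) : 0 <= a -> 0 <= b -> a <= c -> b <= d -> a * b <= c * d.
  by move=> *; exact: ler_pM.
have t1 := norm_expR_taylor x; have t2 := norm_expRB1_le x.
have -> : cexp (x +i* y) - 1 - (x +i* y) =
   ((expR x - 1 - x) + expR x * (cos y - 1)) +i*
   ((expR x - 1) * sin y + (sin y - y)).
  by rewrite /cexp; apply/eqP; rewrite eq_complex/=; apply/andP; split; apply/eqP; ring.
have c1 := le_trans (norm_cosB1_sqr y) y2.
have c2 := le_trans (norm_sinBid_le y) y2.
have c3 := le_trans (norm_sin_le y) Ly.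
rewrite /l1/=.
have b1 : `|expR x - 1 - x + expR x * (cos y - 1)| <= L ^+ 2 * expR L + expR L * L ^+ 2.
  apply: le_trans (ler_normD _ _) _; apply: lerD.
    by apply: le_trans t1 _; rewrite M ?sqr_ge0 ?expR_ge0.
  by rewrite normrM M// ger0_norm// expR_ge0.
have b2 : `|(expR x - 1) * sin y + (sin y - y)| <= L * expR L * L + L ^+ 2.
  apply: le_trans (ler_normD _ _) _; apply: lerD => //.
  rewrite normrM M//; apply: le_trans t2 _.
  by rewrite M ?expR_ge0.
have : L ^+ 2 * 1 <= L ^+ 2 * expR L by rewrite M ?sqr_ge0.
move: b1 b2; rewrite !expr2; move: (expR L) => E b1 b2 b3.
by apply: le_trans (lerD b1 b2) _; lra.
Qed.

End complex_exponential.

(** * The time integral of a product of two heat kernels *)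

Section heat_primitive.
Context {R : realType}.
Local Notation mu := (@lebesgue_measure R).

Lemma expRN_le (x : R) : 0 < x -> expR (- x) <= 120 * (x^-1) ^+ 5.
Proof.
move=> x0; have := @expR_ge1Dxn R x 4 (ltW x0).
rewrite (_ : 5`!%:R = 120)// => h.
have h' : x ^+ 5 / 120 <= expR x by lra.
rewrite expRN exprVn -[120]invrK -invfM lef_pV2 ?posrE ?expR_gt0//.
  by rewrite mulrC.
by rewrite mulr_gt0 ?invr_gt0// exprn_gt0.
Qed.

Lemma is_derive_reverse (h : R -> R) (T s a : R) : is_derive (T - s) 1 h a ->
  is_derive s 1 (fun s => h (T - s)) (- a).
Proof.
move=> ha; have h2 : is_derive s 1 (fun s : R => T - s) (-1).
  by apply: is_derive_eq; ring.
have := @is_derive1_comp R h (fun s => T - s) s _ _ ha h2.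
by rewrite mulrN1.
Qed.

(** Controls act at time s and are observed at time T, so kernels appear at
    time T - s.  A bound by K * t at the origin gives the continuity at s = T
    required by the fundamental theorem of calculus. *)
Lemma reverse_time_continuous (h : R -> R) (K T : R) : 0 < T ->
  (forall t : R, 0 < t -> derivable h t 1) -> h 0 = 0 ->
  (forall t : R, 0 < t -> t <= T -> `|h t| <= K * t) ->
  derivable_oo_LRcontinuous (fun s => h (T - s)) 0 T.
Proof.
move=> T0 dh h0 hK.
have drev s : s < T -> derivable (fun s => h (T - s)) s 1.
  move=> sT; have Ts : 0 < T - s by rewrite subr_gt0.
  by have /derivableP h1 := dh _ Ts; have [] := is_derive_reverse h1.
split.
- by move=> s; rewrite in_itv/= => /andP[_]; exact: drev.
- apply: cvg_at_right_filter.
  by apply: differentiable_continuous; apply/derivable1_diffP; exact: drev.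
- rewrite subrr h0; apply/cvgr0Pnorm_lt => e e0.
  near=> s.
  have sT : s < T by near: s; exact: nbhs_left_lt.
  have s0 : 0 <= s by near: s; exact: nbhs_left_ge.
  have sK : T - e / (`|K| + 1) < s.
    by near: s; apply: nbhs_left_gt; rewrite ltrBlDr ltrDl divr_gt0// ltr_wpDl.
  apply: (@le_lt_trans _ _ ((`|K| + 1) * (T - s))).
    apply: le_trans (hK (T - s) _ _) _; rewrite ?subr_gt0 ?gerBl//.
    rewrite ler_wpM2r ?subr_ge0 ?(ltW sT)//.
    by apply: le_trans (ler_norm K) _; rewrite lerDl.
  by rewrite mulrC -ltr_pdivlMr ?ltr_wpDl// ltrBlDr addrC -ltrBlDr.
Unshelve. all: by end_near.
Qed.

Variables (al be p1 p2 q1 q2 c1 c2 : R).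
Hypothesis al0 : 0 < al.
Hypothesis Hq1 : al * p1 - be * p2 = 4 * q1.
Hypothesis Hq2 : al * p2 + be * p1 = 4 * q2.
Hypothesis Hc1 : 4 * (al * q1 - be * q2) = c1.
Hypothesis Hc2 : 4 * (al * q2 + be * q1) = c2.

(** Real and imaginary parts of exp (- (al + i be) / (4 t)). *)
Definition gauss_re (t : R) : R := expR (- (al / 4 * t^-1)) * cos (be / 4 * t^-1).
Definition gauss_im (t : R) : R := - (expR (- (al / 4 * t^-1)) * sin (be / 4 * t^-1)).

Lemma is_derive_gauss_re (t : R) : t != 0 -> is_derive t 1 gauss_re
  ((al * gauss_re t - be * gauss_im t) / (4 * t ^+ 2)).
Proof.
move=> t0; rewrite /gauss_re /gauss_im.
have hV : is_derive t 1 (fun y : R => y^-1) (- t ^- 2 *: 1) by exact: is_deriveV.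
have hA : is_derive t 1 (fun y : R => - (al / 4 * y^-1)) (al / 4 * t ^- 2).
  by apply: is_derive_eq; rewrite /GRing.scale/=; ring.
have hB : is_derive t 1 (fun y : R => be / 4 * y^-1) (- (be / 4 * t ^- 2)).
  by apply: is_derive_eq; rewrite /GRing.scale/=; ring.
have hE : is_derive t 1 (fun y : R => expR (- (al / 4 * y^-1))) _ :=
  is_derive1_comp (is_derive_expR _) hA.
have hC : is_derive t 1 (fun y : R => cos (be / 4 * y^-1)) _ :=
  is_derive1_comp (is_derive_cos _) hB.
by apply: is_derive_eq; rewrite /GRing.scale/=; field.
Qed.

Lemma is_derive_gauss_im (t : R) : t != 0 -> is_derive t 1 gauss_im
  ((al * gauss_im t + be * gauss_re t) / (4 * t ^+ 2)).
Proof.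
move=> t0; rewrite /gauss_re /gauss_im.
have hV : is_derive t 1 (fun y : R => y^-1) (- t ^- 2 *: 1) by exact: is_deriveV.
have hA : is_derive t 1 (fun y : R => - (al / 4 * y^-1)) (al / 4 * t ^- 2).
  by apply: is_derive_eq; rewrite /GRing.scale/=; ring.
have hB : is_derive t 1 (fun y : R => be / 4 * y^-1) (- (be / 4 * t ^- 2)).
  by apply: is_derive_eq; rewrite /GRing.scale/=; ring.
have hE : is_derive t 1 (fun y : R => expR (- (al / 4 * y^-1))) _ :=
  is_derive1_comp (is_derive_expR _) hA.
have hC : is_derive t 1 (fun y : R => sin (be / 4 * y^-1)) _ :=
  is_derive1_comp (is_derive_sin _) hB.
by apply: is_derive_eq; rewrite /GRing.scale/=; field.
Qed.

(** The real part of exp (- a / (4 t)) (p + q / t), with a = al + i be.  Written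
    with the factor t^-1 outside, it takes its limit value 0 at t = 0, where
    division by zero yields 0.  Under the hypotheses a p = 4 q and 4 a q = c it is
    a primitive of gauss_dens, the real part of c exp (- a / (4 t)) / (16 t^3);
    the imaginary parts are obtained by multiplying p, q and c by - i. *)
Definition gauss_prim (t : R) : R :=
  (gauss_re t * (p1 * t + q1) - gauss_im t * (p2 * t + q2)) * t^-1.

Definition gauss_dens (t : R) : R :=
  (gauss_re t * c1 - gauss_im t * c2) * (16^-1 * t^-1 ^+ 3).

Lemma is_derive_gauss_prim (t : R) : t != 0 ->
  is_derive t 1 gauss_prim (gauss_dens t).
Proof.
move=> t0; rewrite /gauss_prim /gauss_dens.
have hV : is_derive t 1 (fun y : R => y^-1) (- t ^- 2 *: 1) by exact: is_deriveV.
have h1 := is_derive_gauss_re t0.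
have h2 := is_derive_gauss_im t0.
apply: is_derive_eq; rewrite /GRing.scale/= -Hc1 -Hc2.
have -> : q1 = (al * p1 - be * p2) / 4 by rewrite Hq1; field.
have -> : q2 = (al * p2 + be * p1) / 4 by rewrite Hq2; field.
by move: (gauss_re t) (gauss_im t) => E F; field.
Qed.

Lemma derivable_gauss_dens (t : R) : 0 < t -> derivable gauss_dens t 1.
Proof.
move=> t0; have t1 : t != 0 by rewrite gt_eqF.
have hV : is_derive t 1 (fun y : R => y^-1) (- t ^- 2 *: 1) by exact: is_deriveV.
have h1 := is_derive_gauss_re t1.
have h2 := is_derive_gauss_im t1.
by rewrite /gauss_dens; apply: ex_derive.
Qed.

(** Since x^5 / 5! <= exp x, the exponential beats the powers of 1 / t. *)
Definition gauss_const (t : R) : R := 120 * (4 / al) ^+ 5 * t ^+ 5.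

Lemma gauss_re_le (t : R) : 0 < t -> `|gauss_re t| <= gauss_const t.
Proof.
move=> t0; rewrite normrM ger0_norm ?expR_ge0//.
apply: (@le_trans _ _ (expR (- (al / 4 * t^-1)))).
  by rewrite ler_piMr ?expR_ge0 ?cos_max.
apply: le_trans (expRN_le _) _; first by rewrite !mulr_gt0 ?invr_gt0.
rewrite le_eqVlt /gauss_const; apply/orP; left; apply/eqP.
by field; rewrite !gt_eqF.
Qed.

Lemma gauss_im_le (t : R) : 0 < t -> `|gauss_im t| <= gauss_const t.
Proof.
move=> t0; rewrite normrN normrM ger0_norm ?expR_ge0//.
apply: (@le_trans _ _ (expR (- (al / 4 * t^-1)))).
  by rewrite ler_piMr ?expR_ge0 ?sin_max.
apply: le_trans (expRN_le _) _; first by rewrite !mulr_gt0 ?invr_gt0.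
rewrite le_eqVlt /gauss_const; apply/orP; left; apply/eqP.
by field; rewrite !gt_eqF.
Qed.

Lemma gauss_const_ge0 (t : R) : 0 < t -> 0 <= gauss_const t.
Proof. by move=> t0; apply: le_trans (gauss_re_le t0). Qed.

Lemma gauss_comb_le (t a b B : R) : 0 < t -> `|a| + `|b| <= B ->
  `|gauss_re t * a - gauss_im t * b| <= gauss_const t * B.
Proof.
move=> t0 abB; apply: (@le_trans _ _ (gauss_const t * (`|a| + `|b|))); last first.
  by rewrite ler_wpM2l// gauss_const_ge0.
apply: le_trans (ler_normB _ _) _; rewrite mulrDr (normrM _ a) (normrM _ b).
by apply: lerD; apply: ler_wpM2r => //; [exact: gauss_re_le|exact: gauss_im_le].
Qed.

Lemma gauss_prim_le (T : R) : exists K, forall t : R, 0 < t -> t <= T ->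
  `|gauss_prim t| <= K * t.
Proof.
pose B := (`|p1| + `|p2|) * T + `|q1| + `|q2|.
exists (120 * (4 / al) ^+ 5 * T ^+ 3 * B) => t t0 tT.
have T0 := lt_le_trans t0 tT.
rewrite /gauss_prim normrM [`|t^-1|]gtr0_norm ?invr_gt0//.
rewrite ler_pdivrMr//.
have hB : `|p1 * t + q1| + `|p2 * t + q2| <= B.
  have h1 := ler_normD (p1 * t) q1; have h2 := ler_normD (p2 * t) q2.
  rewrite !normrM (gtr0_norm t0) in h1 h2.
  have := ler_wpM2l (addr_ge0 (normr_ge0 p1) (normr_ge0 p2)) tT.
  by rewrite /B; lra.
apply: le_trans (gauss_comb_le t0 hB) _.
have B0 : 0 <= B by apply: le_trans hB; rewrite addr_ge0.
have k0 : 0 <= 120 * (4 / al) ^+ 5 by rewrite mulr_ge0// exprn_ge0// divr_ge0// ltW.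
rewrite /gauss_const; move: (120 * _) k0 => k k0.
rewrite (_ : k * t ^+ 5 * B = (k * B * t ^+ 2) * t ^+ 3); last by ring.
rewrite [leRHS](_ : _ = (k * B * t ^+ 2) * T ^+ 3); last by ring.
apply: ler_wpM2l; first by rewrite (mulr_ge0 (mulr_ge0 k0 B0))// sqr_ge0.
by apply: lerXn2r => //; rewrite nnegrE ltW.
Qed.

Lemma gauss_dens_le (T : R) : exists K, forall t : R, 0 < t -> t <= T ->
  `|gauss_dens t| <= K * t.
Proof.
pose B := `|c1| + `|c2|.
exists (120 * (4 / al) ^+ 5 * B * T) => t t0 tT.
have T0 := lt_le_trans t0 tT.
have B0 : 0 <= B by rewrite addr_ge0.
rewrite /gauss_dens normrM [X in _ * X]ger0_norm; last first.
  by rewrite mulr_ge0// exprn_ge0// invr_ge0 ltW.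
apply: (@le_trans _ _ (gauss_const t * B * t^-1 ^+ 3)).
  apply: ler_pM => //; first by rewrite mulr_ge0// exprn_ge0// invr_ge0 ltW.
    exact: gauss_comb_le.
  rewrite ler_piMl//; first by rewrite exprn_ge0// invr_ge0 ltW.
  by rewrite invf_le1// ler1n.
have k0 : 0 <= 120 * (4 / al) ^+ 5 by rewrite mulr_ge0// exprn_ge0// divr_ge0// ltW.
rewrite /gauss_const; move: (120 * _) k0 => k k0.
rewrite (_ : k * t ^+ 5 * B * t^-1 ^+ 3 = k * B * t * t); last first.
  by field; rewrite gt_eqF.
rewrite [leRHS](_ : _ = k * B * t * T); last by ring.
apply: ler_wpM2l => //; exact: mulr_ge0 (mulr_ge0 k0 B0) (ltW t0).
Qed.

Lemma gauss_integral (T : R) : 0 < T ->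
  [/\ lebesgue_measure.-integrable `]0, T[ (EFin \o (fun s : R => gauss_dens (T - s))) &
      \int[lebesgue_measure]_(s in `]0, T[) gauss_dens (T - s) = gauss_prim T].
Proof.
move=> T0; have [K hK] := gauss_prim_le T; have [K' hK'] := gauss_dens_le T.
have d0 : gauss_dens 0 = 0 by rewrite /gauss_dens invr0 expr0n/= !mulr0.
have p0 : gauss_prim 0 = 0 by rewrite /gauss_prim invr0 mulr0.
have dP t : 0 < t -> derivable gauss_prim t 1.
  by move=> t0; have [] := is_derive_gauss_prim (lt0r_neq0 t0).
have cP := reverse_time_continuous T0 dP p0 hK.
have cD := reverse_time_continuous T0 derivable_gauss_dens d0 hK'.
have wD := derivable_oo_LRcontinuous_within cD.
have wP : derivable_oo_LRcontinuous (fun s => - gauss_prim (T - s)) 0 T.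
  case: cP => h1 h2 h3; split.
  - by move=> s /h1; exact: derivableN.
  - exact: cvgN.
  - exact: cvgN.
have der : {in `]0, T[, derive1 (fun s => - gauss_prim (T - s)) =1 (fun s => gauss_dens (T - s))}.
  move=> s; rewrite in_itv/= => /andP[s0 sT].
  have Ts : 0 < T - s by rewrite subr_gt0.
  have h1 := is_derive_reverse (is_derive_gauss_prim (lt0r_neq0 Ts)).
  have h2 : is_derive s 1 (fun s => - gauss_prim (T - s)) (gauss_dens (T - s)).
    by apply: is_derive_eq; exact: opprK.
  by rewrite derive1E derive_val.
have If : lebesgue_measure.-integrable `[0, T] (EFin \o (fun s : R => gauss_dens (T - s))).
  by apply: continuous_compact_integrable => //; exact: segment_compact.
have If' : lebesgue_measure.-integrable `]0, T[ (EFin \o (fun s : R => gauss_dens (T - s))).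
  by apply: integrableS If => //; exact: subset_itv_oo_cc.
split => //.
have := continuous_FTC2 T0 wD wP der.
rewrite subrr subr0 p0 oppr0 sub0e -EFinN opprK => E.
rewrite Rintegral_itv_bndo_bndc// Rintegral_itv_obnd_cbnd.
  by rewrite /Rintegral E.
by apply: integrableS If => //; exact: subset_itv_oc_cc.
Qed.

End heat_primitive.

(** * Estimates for the heat kernel, uniform in time *)

Section heat_kernel_estimates.
Context {R : realType}.
Local Notation C := (R[i]).
Local Notation Re := complex.Re.
Local Notation Im := complex.Im.

Lemma invC_real (x : R) : (x%:C)^-1 = (x^-1)%:C.
Proof. by rewrite fmorphV. Qed.

Lemma Re_realM (x : R) (z : C) : Re (x%:C * z) = x * Re z.
Proof. by case: z => a b /=; rewrite mul0r subr0. Qed.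

Lemma Im_realM (x : R) (z : C) : Im (x%:C * z) = x * Im z.
Proof. by case: z => a b /=; rewrite mul0r addr0. Qed.

Lemma cexp_gauss (w : C) (t : R) :
  cexp (- (w / (4 * t)%:C)) = gauss_re (Re w) (Im w) t +i* gauss_im (Re w) (Im w) t.
Proof.
rewrite invC_real mulrC /cexp /gauss_re /gauss_im.
have -> : Re (- ((4 * t)^-1%:C * w)) = - (Re w / 4 * t^-1).
  by case: w => a b /=; rewrite mul0r subr0 invfM; ring.
have -> : Im (- ((4 * t)^-1%:C * w)) = - (Im w / 4 * t^-1).
  by case: w => a b /=; rewrite mul0r addr0 invfM; ring.
rewrite cosN sinN.
by apply/eqP; rewrite eq_complex/=; apply/andP; split; apply/eqP; ring.
Qed.

Definition heat_factor (t : R) : R := (4 * Num.sqrt pi * t `^ (3 / 2))^-1.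

Lemma dxKE (z : C) t :
  dxK z t = - (z * (heat_factor t)%:C) * cexp (- (z ^+ 2 / (4 * t)%:C)).
Proof. by rewrite /heat_factor -invC_real. Qed.

Lemma heat_factor_ge0 t : 0 <= heat_factor t.
Proof. by rewrite invr_ge0 !mulr_ge0// ?sqrtr_ge0 ?powR_ge0. Qed.

Lemma powR32_sqr (t : R) : 0 < t -> (t `^ (3 / 2)) ^+ 2 = t ^+ 3.
Proof.
move=> t0; rewrite -powR_mulrn ?powR_ge0// -powRrM.
rewrite (_ : 3 / 2 * 2%:R = 3%:R); last by field.
by rewrite powR_mulrn// ltW.
Qed.

Lemma heat_factor_sqr t : 0 < t -> heat_factor t ^+ 2 = (16 * pi * t ^+ 3)^-1.
Proof.
move=> t0; rewrite /heat_factor exprVn !exprMn powR32_sqr// sqr_sqrtr ?pi_ge0//.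
by congr (_ * _ * _)^-1; ring.
Qed.

Lemma heat_factor_le t : 0 < t -> heat_factor t <= 1 + t^-1 ^+ 2.
Proof.
move=> t0; rewrite -(@ler_pXn2r _ 2%N)// ?nnegrE ?heat_factor_ge0 ?addr_ge0 ?sqr_ge0//.
rewrite heat_factor_sqr//.
have x0 : 0 < t^-1 by rewrite invr_gt0.
have -> : (16 * pi * t ^+ 3)^-1 = (16 * pi)^-1 * t^-1 ^+ 3 :> R.
  by rewrite invfM exprVn.
have p1 : (16 * pi)^-1 <= 1 :> R.
  by rewrite invf_le1; have := pi_ge2 R; lra.
apply: (@le_trans _ _ (1 * t^-1 ^+ 3)).
  by rewrite ler_wpM2r// exprn_ge0// ltW.
move: (t^-1) x0 => x x0; rewrite mul1r.
have := sqr_ge0 (x * (x - 1)); have := sqr_ge0 x; nra.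
Qed.

(** A common bound for all the powers of 1 / t occurring in dxK, in its derivative
    and in its Taylor remainder. *)
Definition decay_weight (t : R) : R :=
  (1 + t^-1 ^+ 2) * (1 + t^-1 + t^-1 ^+ 2).

Definition decay_const (d T : R) : R :=
  120 * (4 / d) ^+ 5 * (T ^+ 5 + T ^+ 4 + 2 * T ^+ 3 + T ^+ 2 + T).

Lemma decay_const_ge0 d T : 0 < d -> 0 < T -> 0 <= decay_const d T.
Proof.
move=> d0 T0; rewrite /decay_const mulr_ge0//.
  by rewrite mulr_ge0// exprn_ge0// divr_ge0// ltW.
by rewrite !addr_ge0// ?mulr_ge0// ?exprn_ge0// ltW.
Qed.

(** The exponential absorbs five powers of N / t: these pay for decay_weight, for
    N ^+ 3, and for the factor N^-1 ^+ 2 that makes the bound summable over the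
    translates. *)
Lemma decay_le (d N t T : R) : 0 < d -> 0 < N -> 0 < t -> t <= T ->
  expR (- (d * N / 4 * t^-1)) * decay_weight t * N ^+ 3
    <= decay_const d T * N^-1 ^+ 2.
Proof.
move=> d0 N0 t0 tT; have T0 := lt_le_trans t0 tT.
have x0 : 0 < d * N / 4 * t^-1 by rewrite !mulr_gt0 ?invr_gt0.
have w0 : 0 <= decay_weight t.
  by rewrite mulr_ge0// !addr_ge0// ?sqr_ge0// invr_ge0 ltW.
apply: (@le_trans _ _ (120 * ((d * N / 4 * t^-1)^-1) ^+ 5 * decay_weight t * N ^+ 3)).
  rewrite ler_wpM2r ?exprn_ge0 ?(ltW N0)// ler_wpM2r//.
  exact: expRN_le.
have -> : 120 * ((d * N / 4 * t^-1)^-1) ^+ 5 * decay_weight t * N ^+ 3 =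
    120 * (4 / d) ^+ 5 * (t ^+ 5 + t ^+ 4 + 2 * t ^+ 3 + t ^+ 2 + t) * N^-1 ^+ 2.
  by rewrite /decay_weight; field; rewrite !gt_eqF.
rewrite ler_wpM2r ?sqr_ge0// ler_wpM2l//.
  by rewrite mulr_ge0// exprn_ge0// divr_ge0// ltW.
have X n : t ^+ n <= T ^+ n by rewrite lerXn2r// nnegrE ltW.
by rewrite !lerD// ler_wpM2l.
Qed.

(** Here N stands for the size of one translate z of the argument: in the regions
    of interest Re (z ^+ 2) grows at least, and z at most, linearly with N. *)
Section one_term.
Variables (d M N T : R) (z : C) (t : R).
Hypotheses (d0 : 0 < d) (M0 : 0 <= M) (N1 : 1 <= N) (t0 : 0 < t) (tT : t <= T).
Hypotheses (hz2 : d * N <= Re (z ^+ 2)) (hz : l1 z <= M * N).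

Let N0 : 0 < N. Proof. exact: lt_le_trans N1. Qed.

Let x0 : 0 < t^-1. Proof. by rewrite invr_gt0. Qed.

Lemma l1_cexp_cone :
  l1 (cexp (- (z ^+ 2 / (4 * t)%:C))) <= 2 * expR (- (d * N / 4 * t^-1)).
Proof.
apply: le_trans (l1_cexp _) _; rewrite ler_wpM2l// ler_expR.
rewrite invC_real mulrC.
have -> : Re (- ((4 * t)^-1%:C * z ^+ 2)) = - (Re (z ^+ 2) / 4 * t^-1).
  by case: (z ^+ 2) => a b /=; rewrite mul0r subr0 invfM; ring.
by rewrite lerN2 ler_wpM2r ?(ltW x0)// ler_wpM2r.
Qed.

Let l1_heat_factor : l1 (heat_factor t)%:C <= 1 + t^-1 ^+ 2.
Proof. by rewrite l1_real ger0_norm ?heat_factor_ge0// heat_factor_le. Qed.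

Let N_sqr : N <= N ^+ 2.
Proof. by rewrite expr2 ler_peMl// ltW. Qed.

Let N_cube : N ^+ 2 <= N ^+ 3.
Proof. by rewrite [leRHS]exprS; apply: ler_peMl => //; rewrite exprn_ge0// ltW. Qed.

Lemma dxK_bound : l1 (dxK z t) <= 2 * M * decay_const d T * N^-1 ^+ 2.
Proof.
have := decay_le d0 N0 t0 tT; set E := expR _ => hdec.
have E0 : 0 <= E by exact: expR_ge0.
apply: (@le_trans _ _ (M * N * (1 + t^-1 ^+ 2) * (2 * E))).
  rewrite dxKE; apply: l1M_le; last exact: l1_cexp_cone.
  by rewrite l1N; exact: l1M_le.
apply: (@le_trans _ _ (2 * M * (E * decay_weight t * N ^+ 3))); last first.
  by rewrite -[leRHS]mulrA ler_wpM2l// mulr_ge0.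
rewrite [leLHS](_ : _ = 2 * M * (E * (1 + t^-1 ^+ 2) * N)); last by ring.
apply: ler_wpM2l; first by rewrite mulr_ge0.
rewrite -[leLHS]mulrA -[leRHS]mulrA; apply: ler_wpM2l => //.
rewrite /decay_weight -[leRHS]mulrA; apply: ler_wpM2l.
  by rewrite addr_ge0 ?sqr_ge0.
rewrite -[leLHS]mul1r ler_pM ?(ltW N0)//; last exact: le_trans N_sqr N_cube.
by rewrite -addrA lerDl addr_ge0 ?sqr_ge0// ltW.
Qed.

Definition ddxK (z : C) (t : R) : C :=
  - ((1 - 2 * ((4 * t)^-1)%:C * z ^+ 2) * (heat_factor t)%:C) *
    cexp (- (z ^+ 2 / (4 * t)%:C)).

Lemma ddxK_bound :
  l1 (ddxK z t) <= 2 * (1 + M ^+ 2) * decay_const d T * N^-1 ^+ 2.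
Proof.
have := decay_le d0 N0 t0 tT; set E := expR _ => hdec.
have E0 : 0 <= E by exact: expR_ge0.
have P : l1 (1 - 2 * ((4 * t)^-1)%:C * z ^+ 2) <= (1 + M ^+ 2) * N ^+ 2 * (1 + t^-1).
  apply: le_trans (l1B _ _) _.
  have -> : l1 (1 : C) = 1 by rewrite /l1/= normr1 normr0 addr0.
  have -> : 2 * ((4 * t)^-1)%:C = (2^-1 * t^-1)%:C :> C.
    by rewrite -[2 in LHS](rmorph_nat (real_complex R)) -rmorphM/=; congr (_%:C); field; rewrite gt_eqF.
  rewrite l1Zr ger0_norm; last by rewrite mulr_ge0// ltW.
  have := l1X_le 2 hz; rewrite exprMn; move: (l1 _) => L hL.
  have N2 : 1 <= N ^+ 2 by exact: le_trans N_sqr.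
  have M2 := sqr_ge0 M; move: (N ^+ 2) (M ^+ 2) (t^-1) hL N2 M2 x0 => n m x hL N2 M2 x1.
  have h1 := ler_wpM2l (ltW x1) hL.
  have h2 : 0 <= x * n by rewrite mulr_ge0 ?(ltW x1)//; lra.
  have h3 : 0 <= x * (m * n) by rewrite mulr_ge0 ?(ltW x1)// mulr_ge0//; lra.
  have h4 : 0 <= m * n by rewrite mulr_ge0//; lra.
  lra.
apply: (@le_trans _ _ ((1 + M ^+ 2) * N ^+ 2 * (1 + t^-1) * (1 + t^-1 ^+ 2) * (2 * E))).
  apply: l1M_le; last exact: l1_cexp_cone.
  by rewrite l1N; exact: l1M_le.
have m0 : 0 <= 1 + M ^+ 2 by rewrite addr_ge0// sqr_ge0.
apply: (@le_trans _ _ (2 * (1 + M ^+ 2) * (E * decay_weight t * N ^+ 3))); last first.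
  by rewrite -[leRHS]mulrA ler_wpM2l// mulr_ge0.
rewrite [leLHS](_ : _ = 2 * (1 + M ^+ 2) * (E * (1 + t^-1 ^+ 2) * ((1 + t^-1) * N ^+ 2))); last by ring.
apply: ler_wpM2l; first by rewrite mulr_ge0.
rewrite -[leLHS]mulrA -[leRHS]mulrA; apply: ler_wpM2l => //.
rewrite /decay_weight -[leRHS]mulrA; apply: ler_wpM2l.
  by rewrite addr_ge0 ?sqr_ge0.
rewrite ler_pM// ?addr_ge0 ?sqr_ge0// ?(ltW x0)//.
by rewrite lerDl sqr_ge0.
Qed.

Let taylor_identity (y h tau k a b : C) :
  - ((y + h) * k) * (a * b) - - (y * k) * a
    - h * (- ((1 - 2 * tau * y ^+ 2) * k) * a) =
  - k * a * ((y + h) * (b - 1 - - (tau * (2 * y * h + h ^+ 2)))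
             - tau * (3 * y * h ^+ 2 + h ^+ 3)).
Proof. by ring. Qed.

Definition taylor_const := 2 * ((M + 1) * (2 * M + 1) ^+ 2 + (3 * M + 1)).

(** With w = - (2 z h + h^2) / (4 t), the remainder equals, up to the factor of
    dxK, (z + h) (e^w - 1 - w) - (3 z h^2 + h^3) / (4 t).  The smallness of h
    makes |w| at most half of the exponent of the Gaussian factor, so e^|w| costs
    half of the decay rate d. *)
Lemma dxK_taylor (h : C) : l1 h <= 1 -> (2 * M + 1) * l1 h <= d / 2 ->
  l1 (dxK (z + h) t - dxK z t - h * ddxK z t) <=
  taylor_const * decay_const (d / 2) T * l1 h ^+ 2 * N^-1 ^+ 2.
Proof.
move=> h1 hd.
have d20 : 0 < d / 2 by rewrite divr_gt0.
have := decay_le d20 N0 t0 tT; set E2 := expR _ => hdec.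
have E20 : 0 <= E2 by exact: expR_ge0.
pose tau : C := ((4 * t)^-1)%:C.
pose w : C := - (tau * (2 * z * h + h ^+ 2)).
pose Ez := cexp (- (z ^+ 2 / (4 * t)%:C)).
have Ezh : cexp (- ((z + h) ^+ 2 / (4 * t)%:C)) = Ez * cexp w.
  by rewrite /Ez -cexpD invC_real -/tau /w; congr cexp; ring.
have -> : dxK (z + h) t - dxK z t - h * ddxK z t =
   - (heat_factor t)%:C * Ez *
   ((z + h) * (cexp w - 1 - w) - tau * (3 * z * h ^+ 2 + h ^+ 3)).
  by rewrite /ddxK !dxKE Ezh -/Ez -/tau taylor_identity.
have ltau : l1 tau = 4^-1 * t^-1.
  by rewrite l1_real invfM ger0_norm// mulr_ge0// ltW.
have H0 := l1_ge0 h.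
move: h1 hd H0; set H := l1 h => h1 hd H0.
have zhN : l1 (z + h) <= (M + 1) * N.
  by apply: le_trans (l1D _ _) _; rewrite mulrDl mul1r lerD// (le_trans h1).
have lnat n (y : C) : l1 (n%:R * y) = n%:R * l1 y.
  by rewrite -(rmorph_nat (real_complex R)) l1Zr ger0_norm.
have wN : l1 w <= (2 * M + 1) * N * H * (4^-1 * t^-1).
  rewrite l1N mulrC; apply: l1M_le; last by rewrite ltau.
  apply: le_trans (l1D _ _) _.
  have hh := l1X_le 2 (lexx H); have zh := l1M_le hz (lexx H).
  rewrite -mulrA lnat.
  have : H ^+ 2 <= N * H by rewrite expr2 ler_wpM2r// (le_trans h1).
  move: hh zh; rewrite -!/H; lra.
have wE : expR (l1 w) <= expR (d / 2 * N / 4 * t^-1).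
  rewrite ler_expR; apply: le_trans wN _.
  rewrite [leLHS](_ : _ = (2 * M + 1) * H * (N * (4^-1 * t^-1))); last by ring.
  rewrite [leRHS](_ : _ = d / 2 * (N * (4^-1 * t^-1))); last by ring.
  by rewrite ler_wpM2r// !mulr_ge0// ltW.
have w2 : l1 w ^+ 2 <= ((2 * M + 1) * N * H * (4^-1 * t^-1)) ^+ 2.
  have w0 := l1_ge0 w.
  by rewrite lerXn2r// nnegrE ?(le_trans w0 wN).
pose E := expR (- (d * N / 4 * t^-1)).
have E0 : 0 <= E by exact: expR_ge0.
have EE : E * expR (d / 2 * N / 4 * t^-1) = E2.
  by rewrite /E -expRD; congr expR; field; rewrite gt_eqF.
have EE2 : E <= E2.
  rewrite -EE ler_peMr// -expR0 ler_expR !mulr_ge0// ?ltW//.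
have N00 : 0 <= N by exact: ltW.
have M10 : 0 <= M + 1 by rewrite addr_ge0.
have M20 : 0 <= 2 * M + 1 by rewrite addr_ge0// mulr_ge0.
have N03 : 0 <= N ^+ 3 by rewrite exprn_ge0// ltW.
have x1 : 0 <= t^-1 by exact: ltW.
pose x := t^-1; rewrite -/x in x1.
have B1 : l1 ((z + h) * (cexp w - 1 - w)) <=
   (M + 1) * (2 * M + 1) ^+ 2 * N ^+ 3 * H ^+ 2 * x ^+ 2 * expR (d / 2 * N / 4 * x).
  apply: (@le_trans _ _ ((M + 1) * N * (4 * ((2 * M + 1) * N * H * (4^-1 * x)) ^+ 2 *
      expR (d / 2 * N / 4 * x)))).
    apply: l1M_le => //; apply: le_trans (l1_cexp_taylor _) _.
    apply: ler_pM; [by rewrite mulr_ge0 ?sqr_ge0|exact: expR_ge0| |exact: wE].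
    by rewrite ler_wpM2l.
  rewrite [leLHS](_ : _ = 4^-1 * ((M + 1) * (2 * M + 1) ^+ 2 * N ^+ 3 * H ^+ 2 *
     x ^+ 2 * expR (d / 2 * N / 4 * x))); last by field.
  apply: ler_piMl; last by lra.
  by rewrite !mulr_ge0 ?expR_ge0 ?sqr_ge0.
have B2 : l1 (tau * (3 * z * h ^+ 2 + h ^+ 3)) <= (3 * M + 1) * N ^+ 3 * H ^+ 2 * x.
  apply: (@le_trans _ _ (4^-1 * x * ((3 * M + 1) * N * H ^+ 2))).
    apply: l1M_le; first by rewrite ltau.
    apply: le_trans (l1D _ _) _.
    have hh := l1X_le 3 (lexx H); have zh := l1M_le hz (l1X_le 2 (lexx H)).
    rewrite -mulrA lnat.
    have : H ^+ 3 <= N * H ^+ 2.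
      by rewrite exprS ler_wpM2r ?sqr_ge0// (le_trans h1).
    move: hh zh; rewrite -!/H; lra.
  rewrite [leLHS](_ : _ = ((3 * M + 1) * H ^+ 2 * x) * (4^-1 * N)); last by ring.
  rewrite [leRHS](_ : _ = ((3 * M + 1) * H ^+ 2 * x) * N ^+ 3); last by ring.
  apply: ler_wpM2l; first by rewrite !mulr_ge0 ?addr_ge0 ?mulr_ge0 ?sqr_ge0.
  apply: le_trans N_cube; apply: le_trans N_sqr.
  by apply: ler_piMl; [exact: ltW|lra].
pose U := (M + 1) * (2 * M + 1) ^+ 2 * N ^+ 3 * H ^+ 2 * x ^+ 2.
pose V := (3 * M + 1) * N ^+ 3 * H ^+ 2 * x.
have U0 : 0 <= U by rewrite !mulr_ge0 ?sqr_ge0.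
have V0 : 0 <= V by rewrite !mulr_ge0 ?addr_ge0 ?mulr_ge0 ?sqr_ge0.
apply: (@le_trans _ _ ((1 + x ^+ 2) * (2 * E) * (U * expR (d / 2 * N / 4 * x) + V))).
  apply: l1M_le.
    by apply: l1M_le; [rewrite l1N|exact: l1_cexp_cone].
  by apply: le_trans (l1B _ _) _; exact: lerD.
apply: (@le_trans _ _ ((1 + x ^+ 2) * 2 * (E2 * (U + V)))).
  rewrite -mulrA -[leRHS]mulrA; apply: ler_wpM2l; first by rewrite addr_ge0 ?sqr_ge0.
  rewrite -[leLHS]mulrA; apply: ler_wpM2l => //.
  by rewrite mulrDr mulrCA EE [leRHS]mulrDr mulrC lerD2l ler_wpM2r.
apply: (@le_trans _ _ (taylor_const * H ^+ 2 * (E2 * decay_weight t * N ^+ 3))); last first.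
  rewrite [leRHS](_ : _ = taylor_const * H ^+ 2 *
    (decay_const (d / 2) T * N^-1 ^+ 2)); last by ring.
  apply: ler_wpM2l => //; rewrite mulr_ge0 ?sqr_ge0// /taylor_const mulr_ge0//.
  by rewrite !addr_ge0// !mulr_ge0 ?sqr_ge0.
rewrite /decay_weight -/x /taylor_const /U /V.
set a := (M + 1) * _; set b := 3 * M + 1.
have a0 : 0 <= a by rewrite mulr_ge0 ?sqr_ge0.
have b0 : 0 <= b by rewrite addr_ge0 ?mulr_ge0.
rewrite [leLHS](_ : _ = (2 * H ^+ 2 * E2 * N ^+ 3 * (1 + x ^+ 2)) * (a * x ^+ 2 + b * x)); last by ring.
rewrite [leRHS](_ : _ = (2 * H ^+ 2 * E2 * N ^+ 3 * (1 + x ^+ 2)) *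
  ((a + b) * (1 + x + x ^+ 2))); last by ring.
apply: ler_wpM2l; first by rewrite !mulr_ge0 ?addr_ge0 ?sqr_ge0.
have x2 := sqr_ge0 x; move: (x ^+ 2) x2 => y y0.
have h2 := mulr_ge0 a0 x1; have h3 := mulr_ge0 b0 y0.
lra.
Qed.

End one_term.
End heat_kernel_estimates.

(** * K0 as a Gram integral *)

Section heat_kernel_integral.
Context {R : realType}.
Local Notation C := (R[i]).
Local Notation Re := complex.Re.
Local Notation Im := complex.Im.
Local Notation RT := (measurableTypeR R).
Local Notation mu := (@lebesgue_measure R).

Lemma mu_itv_fin (T : R) : (mu `]0%R, T[ < +oo)%E.
Proof.
by rewrite lebesgue_measure_itv/=; case: ifPn => _; rewrite ?ltry// -EFinB ltry.
Qed.

Lemma measurable_reverse (f : R -> R) (T : R) :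
  (forall t : R, 0 < t -> derivable f t 1) ->
  measurable_fun `]0, T[ (fun s => f (T - s)).
Proof.
move=> df; apply: open_continuous_measurable_fun; first exact: interval_open.
move=> s; rewrite inE/= in_itv/= => /andP[_ sT].
apply: differentiable_continuous; apply/derivable1_diffP.
have Ts : 0 < T - s by rewrite subr_gt0.
have /derivableP h := df _ Ts.
by have [] := is_derive_reverse h.
Qed.

Lemma cmeas_cexp_reverse (w : C) (T : R) :
  cmeas (X := RT) `]0, T[ (fun s => cexp (- (w / (4 * (T - s))%:C))).
Proof.
have mr : measurable_fun `]0, T[ (fun s => gauss_re (Re w) (Im w) (T - s)).
  apply: measurable_reverse => t t0.
  by have [] := is_derive_gauss_re (Re w) (Im w) (lt0r_neq0 t0).
have mi : measurable_fun `]0, T[ (fun s => gauss_im (Re w) (Im w) (T - s)).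
  apply: measurable_reverse => t t0.
  by have [] := is_derive_gauss_im (Re w) (Im w) (lt0r_neq0 t0).
rewrite (_ : (fun s => _) = (fun s => gauss_re (Re w) (Im w) (T - s) +i*
    gauss_im (Re w) (Im w) (T - s))); last by apply/funext => s; rewrite cexp_gauss.
by split.
Qed.

Lemma measurable_heat_factor (T : R) :
  measurable_fun `]0, T[ (fun s => heat_factor (T - s)).
Proof.
rewrite (_ : (fun s => _) =
    (fun s : R => (4 * Num.sqrt pi)^-1 * (T - s) `^ (- (3 / 2)))); last first.
  by apply/funext => s; rewrite /heat_factor invfM powRN.
apply: measurable_funM => //.
apply: (@measurableT_comp _ _ _ _ _ _ (@powR R ^~ (- (3 / 2)))).
  exact: measurable_powR.
by apply: measurable_funB => //.
Qed.

Lemma cmeas_real_R (D : set R) (f : R -> R) : measurable_fun D f ->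
  cmeas (X := RT) D (fun t => (f t)%:C).
Proof. by move=> mf; split; [exact: mf|exact: measurable_cst]. Qed.

Lemma cmeas_heat_factor (T : R) :
  cmeas (X := RT) `]0, T[ (fun s => (heat_factor (T - s))%:C).
Proof.
apply: (@cmeas_real_R _ (fun s => heat_factor (T - s))).
exact: measurable_heat_factor.
Qed.

Lemma cmeas_dxK (z : C) (T : R) :
  cmeas (X := RT) `]0, T[ (fun s => dxK z (T - s)).
Proof.
rewrite (_ : (fun s => _) = (fun s => (- z * (heat_factor (T - s))%:C) *
    cexp (- (z ^+ 2 / (4 * (T - s))%:C)))); last first.
  by apply/funext => s; rewrite dxKE [in RHS]mulNr.
apply: cmeasM; last exact: cmeas_cexp_reverse.
apply: cmeasM; first exact: cmeas_cst.
exact: cmeas_heat_factor.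
Qed.

Lemma cmeas_ddxK (z : C) (T : R) :
  cmeas (X := RT) `]0, T[ (fun s => ddxK z (T - s)).
Proof.
apply: cmeasM; last exact: cmeas_cexp_reverse.
apply: cmeasN; apply: cmeasM; last exact: cmeas_heat_factor.
apply: cmeasD; first exact: cmeas_cst.
apply: cmeasN; apply: cmeasM; last exact: cmeas_cst.
apply: cmeasM; first exact: cmeas_cst.
apply: (@cmeas_real_R _ (fun s => (4 * (T - s))^-1)); apply: (@measurable_reverse (fun t => (4 * t)^-1)) => t t0.
have h : is_derive t 1 (fun t : R => 4 * t) 4.
  by apply: is_derive_eq; rewrite /GRing.scale/=; ring.
have h4 : 4 * t != 0 by rewrite mulf_neq0// gt_eqF.
by have [] := is_deriveV h4 h.
Qed.

Lemma gauss_primE (al be T : R) (p q : C) : 0 < T ->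
  gauss_prim al be (Re p) (Im p) (Re q) (Im q) T +i*
  gauss_prim al be (Im p) (- Re p) (Im q) (- Re q) T =
  (p * T%:C + q) * (gauss_re al be T +i* gauss_im al be T) * (T^-1)%:C.
Proof.
move=> T0; rewrite /gauss_prim.
case: p q => [p1 p2] [q1 q2]; move: (gauss_re _ _ _) (gauss_im _ _ _) => E F.
by apply/eqP; rewrite eq_complex/=; apply/andP; split; apply/eqP; ring.
Qed.

Lemma dxK_conj (w : C) (t : R) : (dxK w t)^* = dxK w^* t.
Proof.
have conj_real (x : R) : (x%:C)^* = x%:C :> C.
  by apply/eqP; rewrite eq_complex/= oppr0 !eqxx.
have cM (x y : C) : (x * y)^* = x^* * y^* by exact: rmorphM.
have cN (x : C) : (- x)^* = - x^* by exact: rmorphN.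
rewrite !dxKE cM cN cM conj_real -cexp_conj; congr (_ * cexp _).
by rewrite cN invC_real cM conj_real expr2 cM.
Qed.

(** Taking c = z w^* / pi and a = z^2 + w^*^2, the product of the two kernels is
    c exp (- a / (4 t)) / (16 t^3), whose primitive at T is K0 for p = c / a^2 and
    q = c / (4 a). *)
Lemma dxK_integral (z w : C) (T : R) : 0 < T ->
  0 < Re (z ^+ 2 + w^* ^+ 2) ->
  cint (X := RT) mu `]0, T[ (fun s => dxK z (T - s) * (dxK w (T - s))^*) =
  K0 T z w.
Proof.
move=> T0 a0; pose a := z ^+ 2 + w^* ^+ 2.
pose c : C := z * w^* / (pi : R)%:C.
pose p : C := c / a ^+ 2; pose q : C := c / (4 * a).
rewrite -/a in a0.
have an0 : a != 0 by apply: contraTN a0 => /eqP ->; rewrite ltxx.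
have ap : a * p = 4 * q by rewrite /p /q; field.
have aq : 4 * (a * q) = c by rewrite /q; field.
have Re4 (y : C) : Re (4 * y) = 4 * Re y.
  by rewrite -[4](rmorph_nat (real_complex R)) Re_realM.
have Im4 (y : C) : Im (4 * y) = 4 * Im y.
  by rewrite -[4](rmorph_nat (real_complex R)) Im_realM.
have H1 : Re a * Re p - Im a * Im p = 4 * Re q by rewrite -Re_mul ap Re4.
have H2 : Re a * Im p + Im a * Re p = 4 * Im q by rewrite -Im_mul ap Im4.
have H3 : 4 * (Re a * Re q - Im a * Im q) = Re c by rewrite -Re_mul -Re4 aq.
have H4 : 4 * (Re a * Im q + Im a * Re q) = Im c by rewrite -Im_mul -Im4 aq.
have [i1 e1] := gauss_integral a0 H1 H2 H3 H4 T0.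
have [||||i2 e2] := @gauss_integral R (Re a) (Im a) (Im p) (- Re p) (Im q) (- Re q)
  (Im c) (- Re c) a0 _ _ _ _ T T0.
- by move: H2; lra.
- by move: H1; lra.
- by move: H4; lra.
- by move: H3; lra.
have pw (t : R) : 0 < t -> dxK z t * (dxK w t)^* =
    gauss_dens (Re a) (Im a) (Re c) (Im c) t +i*
    gauss_dens (Re a) (Im a) (Im c) (- Re c) t.
  move=> t0; rewrite dxK_conj !dxKE.
  pose k := (heat_factor t)%:C : C.
  have kk : k ^+ 2 = (16 * t ^+ 3)^-1%:C / (pi : R)%:C.
    rewrite /k -rmorphXn/= heat_factor_sqr// invC_real -rmorphM/=; congr (_%:C).
    by rewrite -invfM; congr (_^-1); ring.
  transitivity (c * (16 * t ^+ 3)^-1%:C * cexp (- (a / (4 * t)%:C))).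
    have -> : cexp (- (a / (4 * t)%:C)) =
      cexp (- (z ^+ 2 / (4 * t)%:C)) * cexp (- (w^* ^+ 2 / (4 * t)%:C)).
      by rewrite -cexpD; congr cexp; rewrite /a; ring.
    rewrite -/k; move: (cexp _) (cexp _) => F E.
    rewrite (_ : - (z * k) * E * (- (w^* * k) * F) = z * w^* * k ^+ 2 * (E * F)); last by ring.
    by rewrite kk /c; ring.
  rewrite cexp_gauss /gauss_dens exprVn -invfM.
  move: (gauss_re _ _ _) (gauss_im _ _ _) (_^-1) => E F x; case: (c) => c1 c2.
  by apply/eqP; rewrite eq_complex/=; apply/andP; split; apply/eqP; ring.
transitivity (\int[mu]_(s in `]0, T[) gauss_dens (Re a) (Im a) (Re c) (Im c) (T - s) +i*
    \int[mu]_(s in `]0, T[) gauss_dens (Re a) (Im a) (Im c) (- Re c) (T - s)).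
  rewrite /cint; congr Complex; apply: eq_Rintegral => s;
    by rewrite inE/= in_itv/= => /andP[_ sT]; rewrite pw// subr_gt0.
rewrite e1 e2 gauss_primE// -cexp_gauss.
rewrite /K0 -/a -/c /p /q.
rewrite rmorphM rmorph_nat /= -invC_real.
have Tn0 : T%:C != 0 :> C by rewrite fmorph_eq0 gt_eqF.
by move: (cexp _) => E; field; rewrite an0 Tn0.
Qed.

End heat_kernel_integral.

(** * The periodised heat kernel and Kl *)

Section theta.
Context {R : realType}.
Local Notation C := (R[i]).
Local Notation Re := complex.Re.
Local Notation Im := complex.Im.
Local Notation RT := (measurableTypeR R).
Local Notation mu := (@lebesgue_measure R).

(** The size of the translate of an argument by 2 n. *)
Definition weight (n : int) : R := 1 + `|n%:~R|.

Lemma weight_ge1 n : 1 <= weight n.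
Proof. by rewrite lerDl. Qed.

Lemma weight_gt0 n : 0 < weight n.
Proof. exact: lt_le_trans (weight_ge1 n). Qed.

Lemma nneseries_telescope (b a : nat -> R) : (forall k, 0 <= a k) ->
  (forall k, 0 <= b k) -> (forall k, a k <= b k - b k.+1) ->
  (\sum_(k <oo) (a k)%:E <= (b 0%N)%:E)%E.
Proof.
move=> a0 b0 ab; apply: lime_le; first by apply: is_cvg_nneseries => *; rewrite lee_fin.
apply: nearW => n; rewrite sumEFin lee_fin.
apply: (@le_trans _ _ (\sum_(0 <= k < n) (b k - b k.+1))).
  by apply: ler_sum => k _; exact: ab.
have -> : \sum_(0 <= k < n) (b k - b k.+1) = b 0%N - b n.
  elim: n => [|n ih]; first by rewrite big_geq ?subrr.
  by rewrite big_nat_recr//= ih; ring.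
by rewrite lerBlDr lerDl.
Qed.

(** Comparison with a telescoping series. *)
Lemma rsummable_weight (c : R) : 0 <= c ->
  rsummable (fun n : int => c * (weight n)^-1 ^+ 2).
Proof.
move=> c0; apply: (rsumZ c _).1; rewrite /rsummable.
have w0 n : 0 <= (weight n)^-1 ^+ 2 by rewrite sqr_ge0.
under eq_esum do rewrite ger0_norm//.
rewrite esum_int//.
have wP k : (weight (Posz k))^-1 ^+ 2 + (weight (Negz k))^-1 ^+ 2 <=
    4 / k.+1%:R - 4 / k.+2%:R.
  rewrite /weight.
  have -> : `|(Posz k)%:~R| = k%:R :> R by rewrite -pmulrn normr_nat.
  have -> : `|(Negz k)%:~R| = k%:R + 1 :> R by rewrite NegzE mulrNz normrN -pmulrn normr_nat -natr1.
  rewrite -(natr1 k.+1) -(natr1 k); have k0 : 0 <= k%:R :> R by [].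
  move: (k%:R) k0 => x x0.
  have x1 : 0 < 1 + x by lra.
  have x2 : 0 < 1 + (x + 1) by lra.
  have -> : 4 / (x + 1) - 4 / (x + 1 + 1) = 4 * ((1 + x)^-1 * (1 + (x + 1))^-1) :> R.
    by field; apply/andP; split; rewrite gt_eqF//; lra.
  have h : (1 + (x + 1))^-1 <= (1 + x)^-1 by rewrite lef_pV2 ?posrE//; lra.
  have h2 : (1 + x)^-1 <= 2 * (1 + (x + 1))^-1.
    by rewrite -[X in _ <= X * _]invrK -invfM lef_pV2 ?posrE ?mulr_gt0//; lra.
  have i0 : 0 < (1 + x)^-1 by rewrite invr_gt0.
  have i1 : 0 < (1 + (x + 1))^-1 by rewrite invr_gt0.
  move: (_^-1) (_^-1) h h2 i0 i1 => u v *; nra.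
apply: le_lt_trans (ltry (4 / 1%:R)).
under eq_eseriesr do rewrite -EFinD.
apply: (nneseries_telescope (b := fun k => 4 / k.+1%:R)) => // k.
by rewrite addr_ge0.
Qed.

Lemma intC_real (n : int) : n%:~R = (n%:~R)%:C :> C.
Proof. by rewrite rmorph_int. Qed.

Lemma Re_shift (z : C) (n : int) : Re (z + 2 * n%:~R) = Re z + 2 * n%:~R.
Proof.
rewrite intC_real -[2](rmorph_nat (real_complex R)) -rmorphM/=.
by case: z.
Qed.

Lemma Im_shift (z : C) (n : int) : Im (z + 2 * n%:~R) = Im z.
Proof.
rewrite intC_real -[2](rmorph_nat (real_complex R)) -rmorphM/=.
by case: z => a b /=; rewrite addr0.
Qed.

Lemma Re_sqr (z : C) : Re (z ^+ 2) = Re z ^+ 2 - Im z ^+ 2.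
Proof. by case: z => a b; rewrite expr2/= -!expr2. Qed.

Definition in_cone (z : C) (d M : R) := [/\ 0 < d, 0 <= M &
  forall n : int, d * weight n <= Re ((z + 2 * n%:~R) ^+ 2) /\
                  l1 (z + 2 * n%:~R) <= M * weight n].

(** In Qinf the distance from Re z to the integers exceeds |Im z|, by some
    eta > 0.  So each translate X + i y satisfies |X| >= |y| + eta, and
    X^2 - y^2 = (|X| - |y|) (|X| + |y|) >= eta |X|. *)
Lemma Qinf_cone (z : C) : Qinf z -> exists d M, in_cone z d M.
Proof.
move=> [k [/=]].
have -> : Re (z - k%:~R) = Re z - k%:~R by rewrite intC_real; case: z.
have -> : Im (z - k%:~R) = Im z by rewrite intC_real; case: z => a b /=; rewrite subr0.
set x := Re z; set y := `|Im z|; set r := x - k%:~R => yr yr1.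
have y0 : 0 <= y by exact: normr_ge0.
pose eta := Num.min (r - y) (1 - r - y).
have eta0 : 0 < eta by rewrite lt_min; apply/andP; split; lra.
have eta1 : eta <= r - y by rewrite ge_min lexx.
have eta2 : eta <= 1 - r - y by rewrite ge_min lexx orbT.
pose S := 1 + (1 + `|x|) / eta.
have S0 : 0 < S by rewrite addr_gt0// divr_gt0// ltr_wpDr.
exists (eta / S), (l1 z + 2); split; [by rewrite divr_gt0|by rewrite addr_ge0 ?l1_ge0|].
move=> n; split; last first.
  apply: le_trans (l1D _ _) _; rewrite [leRHS]mulrDl; apply: lerD.
    by rewrite ler_peMr ?l1_ge0 ?weight_ge1.
  rewrite intC_real -[2](rmorph_nat (real_complex R)) -rmorphM l1_real normrM.
  by rewrite normr_nat ler_wpM2l// /weight lerDr.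
rewrite Re_sqr Re_shift Im_shift -/x -(real_normK (num_real (Im z))) -/y.
set X := x + 2 * n%:~R.
(* X is at distance at least y + eta from the integers, and so from 0 *)
have Xy : y + eta <= `|X|.
  have XE : X = r + (k + 2 * n)%:~R by rewrite /X /r rmorphD rmorphM/=; ring.
  have [j0|j0] := leP 0 (k + 2 * n).
    have : 0 <= (k + 2 * n)%:~R :> R by rewrite ler0z.
    by rewrite XE; move: (_%:~R) => j j1; apply: le_trans (ler_norm _); lra.
  have : (k + 2 * n)%:~R <= -1 :> R by rewrite -[-1]/((-1)%:~R) ler_int -ltzD1.
  rewrite XE; move: (_%:~R) => j j1; rewrite -normrN; apply: le_trans (ler_norm _); lra.
have XN : weight n <= `|X| * S.
  have h1 : 2 * `|n%:~R| <= `|X| + `|x| :> R.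
    have -> : 2 * `|n%:~R| = `|X - x| :> R.
      by rewrite /X addrC addKr normrM normr_nat.
    exact: ler_normB.
  have h2 : 1 + `|x| <= `|X| * ((1 + `|x|) / eta).
    by rewrite mulrC mulrAC ler_pdivlMr// ler_wpM2l ?addr_ge0//; lra.
  by rewrite /S mulrDr mulr1 /weight; have := normr_ge0 (n%:~R : R); lra.
rewrite -(real_normK (num_real X)).
have -> : `|X| ^+ 2 - y ^+ 2 = (`|X| - y) * (`|X| + y) by ring.
apply: (@le_trans _ _ (eta * `|X|)).
  by rewrite -mulrA ler_wpM2l ?(ltW eta0)// mulrC ler_pdivrMr.
by apply: ler_pM; rewrite ?(ltW eta0)//; lra.
Qed.

Lemma Qinf_add1 (z : C) : Qinf z -> Qinf (z + 1).
Proof.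
by move=> [k hk]; exists (k + 1); rewrite rmorphD/= opprD addrACA subrr addr0.
Qed.

Lemma Qinf_sub1 (z : C) : Qinf z -> Qinf (z - 1).
Proof.
move=> [k hk]; exists (k - 1); rewrite rmorphB/=.
by rewrite (_ : z - 1 - _ = z - k%:~R)//; ring.
Qed.

Lemma dxtheta_shift (z : C) t : dxtheta (z + 1) t = dxtheta (z - 1) t.
Proof.
rewrite /dxtheta (csum_reindex (fun n : int => dxK (z - 1 + 2 * n%:~R) t)
  (e := fun n : int => n + 1)).
  by congr csum; apply/funext => n /=; congr dxK; rewrite rmorphD/=; ring.
by exists (fun n => n - 1) => n; rewrite ?addrK ?subrK.
Qed.

Section on_Qinf.
Variables (T : R) (T0 : 0 < T).

Lemma dxK_dominated (z : C) : Qinf z -> exists2 c : int -> R, rsummable c &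
  forall n (t : R), 0 < t -> t <= T -> l1 (dxK (z + 2 * n%:~R) t) <= c n.
Proof.
move=> /Qinf_cone[d [M [d0 M0 hc]]].
exists (fun n => 2 * M * decay_const d T * (weight n)^-1 ^+ 2).
  apply: rsummable_weight; apply: mulr_ge0; first exact: mulr_ge0.
  exact: decay_const_ge0.
move=> n t t0 tT; have [h1 h2] := hc n.
exact: (dxK_bound d0 M0 (weight_ge1 n) t0 tT h1 h2).
Qed.

Lemma in_time (s : R) : `]0, T[%classic s -> 0 < T - s /\ T - s <= T.
Proof. by rewrite /= in_itv/= => /andP[s0 sT]; rewrite subr_gt0 gerBl ltW. Qed.

Lemma dxtheta_bounded (z : C) : Qinf z -> exists B : R,
  forall s, `]0, T[%classic s -> l1 (dxtheta z (T - s)) <= B.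
Proof.
move=> /dxK_dominated[c sc hc]; exists (2 * rsum c) => s /in_time[t0 tT].
by apply: l1_csum => // n; exact: hc.
Qed.

Lemma cmeas_dxtheta (z : C) : Qinf z ->
  cmeas (X := RT) `]0, T[ (fun s => dxtheta z (T - s)).
Proof.
move=> /dxK_dominated[c sc hc].
apply: (csum_cmeas (X := RT) (f := fun n s => dxK (z + 2 * n%:~R) (T - s)) (c := c)) => //.
  by move=> n s /in_time[t0 tT]; exact: hc.
by move=> n; exact: cmeas_dxK.
Qed.

Lemma Re_sqr_gt0 (z : C) (n : int) : Qinf z -> 0 < Re ((z + 2 * n%:~R) ^+ 2).
Proof.
move=> /Qinf_cone[d [M [d0 _ h]]]; apply: lt_le_trans (h n).1.
by rewrite mulr_gt0// weight_gt0.
Qed.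

(** The double sum over the translates and the time integral are exchanged one
    index at a time, each term being bounded uniformly in time. *)
Lemma Kl_integral (z w : C) : Qinf z -> Qinf w ->
  Kl T z w = cint (X := RT) mu `]0, T[
    (fun s => dxtheta z (T - s) * (dxtheta w (T - s))^*).
Proof.
move=> hz hw.
have [c sc cP] := dxK_dominated hz; have [c' sc' cP'] := dxK_dominated hw.
have mD : measurable (`]0, T[%classic : set RT) by exact: measurable_itv.
have c0 n : 0 <= c n by apply: le_trans (cP n T T0 (lexx T)); exact: l1_ge0.
have c0' n : 0 <= c' n by apply: le_trans (cP' n T T0 (lexx T)); exact: l1_ge0.
pose a n s := dxK (z + 2 * n%:~R) (T - s).
pose b m s := (dxK (w + 2 * m%:~R) (T - s))^*.
have la n s : `]0, T[%classic s -> l1 (a n s) <= c n.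
  by move=> /in_time[t0 tT]; exact: cP.
have lb m s : `]0, T[%classic s -> l1 (b m s) <= c' m.
  by move=> /in_time[t0 tT]; rewrite l1_conj; exact: cP'.
have ma n : cmeas (X := RT) `]0, T[ (a n) by exact: cmeas_dxK.
have mb m : cmeas (X := RT) `]0, T[ (b m) by apply: cmeas_conj; exact: cmeas_dxK.
have E m n : K0 T (z + 2 * n%:~R) (w + 2 * m%:~R) =
    cint (X := RT) mu `]0, T[ (fun s => b m s * a n s).
  rewrite -dxK_integral//; last first.
    have -> : (w + 2 * m%:~R)^* ^+ 2 = ((w + 2 * m%:~R) ^+ 2)^* :> C.
      by rewrite rmorphXn.
    rewrite Re_add addr_gt0 ?Re_sqr_gt0//.
    by have := Re_sqr_gt0 m hw; case: ((w + _) ^+ 2).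
  by congr cint; apply/funext => s; rewrite mulrC.
have sK : csummable (fun mn : int * int => K0 T (z + 2 * mn.2%:~R) (w + 2 * mn.1%:~R)).
  apply: (csummable_le (c := fun mn => (2 * fine (mu `]0%R, T[)) * c' mn.1 * c mn.2)).
    move=> [m n] /=; rewrite E.
    apply: le_trans (l1_cintegral_bounded (c := c' m * c n) mD (mu_itv_fin T) _ _) _.
    - exact: cmeasM.
    - by move=> s Ds; apply: l1M_le; [exact: lb|exact: la].
    - by rewrite le_eqVlt; apply/orP; left; apply/eqP; ring.
  apply: (rsummable_pair (f := fun m => 2 * fine (mu `]0%R, T[) * c' m)) => //.
  by have [] := rsumZ (2 * fine (mu `]0%R, T[)) sc'.
rewrite /Kl (csum_pair sK)/=.
have sa s : `]0, T[%classic s -> csummable (a ^~ s).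
  by move=> Ds; apply: (csummable_le (c := c)) => // n; exact: la.
have mA := cmeas_dxtheta hz.
have lA s : `]0, T[%classic s -> l1 (dxtheta z (T - s)) <= 2 * rsum c.
  by move=> Ds; apply: l1_csum => // n; exact: la.
transitivity (csum (fun m : int => cint (X := RT) mu `]0, T[
    (fun s => b m s * dxtheta z (T - s)))).
  congr csum; apply/funext => m.
  transitivity (csum (fun n : int => cint (X := RT) mu `]0, T[ (fun s => b m s * a n s))).
    by congr csum; apply/funext => n.
  rewrite -(csum_cintegral mD (mu_itv_fin T) (c := fun n => c' m * c n)).
  - apply: eq_cintegral => s; rewrite inE => Ds; rewrite csumZ//; exact: sa.
  - by move=> n s Ds; apply: l1M_le; [exact: lb|exact: la].
  - by have [] := rsumZ (c' m) sc.
  - by move=> n; exact: cmeasM.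
rewrite -(csum_cintegral mD (mu_itv_fin T) (c := fun m => 2 * rsum c * c' m)).
- apply: eq_cintegral => s; rewrite inE => Ds.
  under eq_fun do rewrite mulrC.
  rewrite csumZ; last by apply: (csummable_le (c := c')) => // m; exact: lb.
  congr (_ * _); rewrite csum_conj//.
  apply: (csummable_le (c := c')) => // m.
  by rewrite -l1_conj; exact: lb.
- by move=> m s Ds; rewrite mulrC; apply: l1M_le; [exact: lA|exact: lb].
- by have [] := rsumZ (2 * rsum c) sc'.
- by move=> m; exact: cmeasM.
Qed.

End on_Qinf.
End theta.

(** * Complex differentiability *)

Section analyticity.
Context {R : realType}.
Local Notation C := (R[i]).
Local Notation Re := complex.Re.
Local Notation Im := complex.Im.
Local Notation RT := (measurableTypeR R).
Local Notation mu := (@lebesgue_measure R).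

Lemma normC_le_l1 (z : C) : `|z| <= (l1 z)%:C.
Proof.
rewrite normc_def lecR -(ger0_norm (l1_ge0 z)) -sqrtr_sqr ler_sqrt ?sqr_ge0//.
exact: sqmod_l1.
Qed.

Lemma l1_le_normC (z : C) (e : R) : `|z| < e%:C -> l1 z < 2 * e.
Proof.
rewrite normc_def ltcR => h.
have e0 : 0 < e by apply: le_lt_trans h; exact: sqrtr_ge0.
have h2 : sqmod z < e ^+ 2.
  by rewrite -(sqr_sqrtr (sqmod_ge0 z)) ltrXn2r ?nnegrE ?sqrtr_ge0// ltW.
rewrite -(@ltr_pXn2r _ 2%N)// ?nnegrE ?l1_ge0//; last by rewrite mulr_ge0// ltW.
by apply: le_lt_trans (l1_sqmod z) _; rewrite exprMn; have := sqr_ge0 e; nra.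
Qed.

Lemma analytic_taylor (A : set C) (F : C -> C) :
  (forall z : C, A z -> exists (D : C) (K r : R), [/\ 0 < r, 0 <= K & forall h : C,
     l1 h < r -> A (z + h) /\ l1 (F (z + h) - F z - h * D) <= K * l1 h ^+ 2]) ->
  analytic (fun z : A => F (set_val z)).
Proof.
move=> hF z Az.
have valE w : A w -> 'valL_0 (fun z : A => F (set_val z)) w = F w.
  move=> Aw; pose x : A := SigSub (mem_set Aw).
  have xw : set_val x = w by rewrite set_valE.
  move: x xw => x <-.
  exact: (congr1 (@^~ x) (valLK 0 (fun z : A => F (set_val z)))).
have [D [K [r [r0 K0 hr]]]] := hF z Az.
move: ('valL_0 _) valE => g valE.
apply/cvg_ex; exists D; apply/cvgrPdist_lt => e.
rewrite ltcE/= => /andP[/eqP eim e0].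
have -> : e = (Re e)%:C by case: (e) eim => a b /= ->.
pose del := Num.min r (Re e / (2 * (K + 1))).
have del0 : 0 < del by rewrite lt_min r0 divr_gt0// mulr_gt0// ltr_wpDl.
have d0 : 0 < (del / 2)%:C :> C by rewrite ltcR divr_gt0.
apply/nbhs_ballP; exists (del / 2)%:C => //= h.
rewrite /ball/= sub0r normrN => /l1_le_normC; rewrite mulrC divfK// => hdel hn0.
have hr' : l1 h < r by apply: lt_le_trans hdel _; rewrite ge_min lexx.
have [Azh hT] := hr h hr'.
have -> : h *: (1 : C^o) + z = z + h by rewrite addrC [h *: _]mulr1.
rewrite !valE// -[h^-1 *: _]/(h^-1 * (F (z + h) - F z)).
have -> : D - h^-1 *: (F (z + h) - F z) = - (h^-1 * (F (z + h) - F z - h * D)).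
  rewrite mulrBr mulrA mulVf// mul1r opprB; congr (_ - _).
rewrite normrN normrM normfV.
have hpos : 0 < `|h| by rewrite normr_gt0.
rewrite mulrC ltr_pdivrMr//.
apply: le_lt_trans (normC_le_l1 _) _.
have hdel2 : l1 h < Re e / (2 * (K + 1)).
  by apply: lt_le_trans hdel _; rewrite ge_min lexx orbT.
move: hpos; rewrite normc_def -rmorphM/= ltcR ltcR -/(sqmod h) => hpos.
apply: le_lt_trans hT _.
have l2 : l1 h <= 2 * Num.sqrt (sqmod h).
  rewrite -(@ler_pXn2r _ 2%N)// ?nnegrE ?l1_ge0 ?mulr_ge0 ?sqrtr_ge0//.
  rewrite exprMn sqr_sqrtr ?sqmod_ge0//.
  by apply: le_trans (l1_sqmod h) _; have := sqmod_ge0 h; lra.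
move: (Num.sqrt _) hpos l2 => nu nu0 l2.
have K1 : 0 < K + 1 by rewrite ltr_wpDl.
apply: (@le_lt_trans _ _ (K * (Re e / (2 * (K + 1)) * (2 * nu)))).
  rewrite expr2; apply: ler_wpM2l => //; apply: ler_pM; rewrite ?l1_ge0//.
  exact: ltW.
rewrite (_ : K * (Re e / (2 * (K + 1)) * (2 * nu)) = (Re e * nu) * (K / (K + 1))); last first.
  by field; rewrite gt_eqF.
rewrite gtr_pMr ?mulr_gt0// ltr_pdivrMr//; lra.
Qed.

Lemma ddxK_dominated (T : R) (z : C) : 0 < T -> Qinf z ->
  exists2 c : int -> R, rsummable c &
  forall n (t : R), 0 < t -> t <= T -> l1 (ddxK (z + 2 * n%:~R) t) <= c n.
Proof.
move=> T0 /Qinf_cone[d [M [d0 M0 hc]]].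
exists (fun n => 2 * (1 + M ^+ 2) * decay_const d T * (weight n)^-1 ^+ 2).
  apply: rsummable_weight; apply: mulr_ge0; last exact: decay_const_ge0.
  by rewrite mulr_ge0// addr_ge0// sqr_ge0.
move=> n t t0 tT; have [h1 h2] := hc n.
exact: (ddxK_bound d0 (weight_ge1 n) t0 tT h1 h2).
Qed.

Lemma dxtheta_taylor (T : R) (z : C) : 0 < T -> Qinf z ->
  exists (g : R -> C) (B K r : R), [/\ cmeas (X := RT) `]0, T[ g,
    forall s, `]0, T[%classic s -> l1 (g s) <= B, 0 < r, 0 <= K &
    forall h : C, l1 h < r -> Qinf (z + h) -> forall s, `]0, T[%classic s ->
      l1 (dxtheta (z + h) (T - s) - dxtheta z (T - s) - h * g s) <= K * l1 h ^+ 2].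
Proof.
move=> T0 hz.
have [c' sc' hc'] := ddxK_dominated T0 hz.
have [c sc hc] := dxK_dominated T0 hz.
have [d [M [d0 M0 hcone]]] := Qinf_cone hz.
pose K0 := taylor_const M * decay_const (d / 2) T.
have K00 : 0 <= K0.
  apply: mulr_ge0; last by apply: decay_const_ge0 => //; rewrite divr_gt0.
  by rewrite mulr_ge0// !addr_ge0// !mulr_ge0 ?sqr_ge0// ?addr_ge0// mulr_ge0.
pose W : R := rsum (fun n : int => 1 * (weight n)^-1 ^+ 2).
have W0 : 0 <= W by apply: rsum_ge0 => n; rewrite mul1r sqr_ge0.
exists (fun s => csum (fun n : int => ddxK (z + 2 * n%:~R) (T - s))).
exists (2 * rsum c'), (2 * K0 * W), (Num.min 1 (d / 2 / (2 * M + 1))).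
have M1 : 0 < 2 * M + 1 by rewrite ltr_wpDl// mulr_ge0.
split.
- apply: (csum_cmeas (X := RT) (f := fun n s => ddxK (z + 2 * n%:~R) (T - s)) (c := c')) => //.
    by move=> n s /in_time[t0 tT]; exact: hc'.
  by move=> n; exact: cmeas_ddxK.
- by move=> s /in_time[t0 tT]; apply: l1_csum => // n; exact: hc'.
- by rewrite lt_min ltr01/= !divr_gt0.
- by apply: mulr_ge0 => //; exact: mulr_ge0.
move=> h; rewrite lt_min => /andP[h1 hd] hzh s /in_time[t0 tT].
have hd' : (2 * M + 1) * l1 h <= d / 2.
  by rewrite mulrC -ler_pdivlMr// ltW.
have [c2 sc2 hc2] := dxK_dominated T0 hzh.
have s1 : csummable (fun n : int => dxK (z + h + 2 * n%:~R) (T - s)).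
  by apply: (csummable_le (c := c2)) => // n; exact: hc2.
have s2 : csummable (fun n : int => dxK (z + 2 * n%:~R) (T - s)).
  by apply: (csummable_le (c := c)) => // n; exact: hc.
have s3 : csummable (fun n : int => ddxK (z + 2 * n%:~R) (T - s)).
  by apply: (csummable_le (c := c')) => // n; exact: hc'.
rewrite /dxtheta -csumB// -csumZ// -csumB//; last 2 first.
- by apply: csummableD => //; exact: csummableN.
- exact: csummableZ.
have [sw ew] := rsumZ (K0 * l1 h ^+ 2) (rsummable_weight ler01).
rewrite [leRHS](_ : _ = 2 * (K0 * l1 h ^+ 2 * W)); last by ring.
rewrite /W -ew; apply: l1_csum => // n.
have [e1 e2] := hcone n.
rewrite (_ : z + h + 2 * n%:~R = z + 2 * n%:~R + h); last by ring.
have := dxK_taylor d0 M0 (weight_ge1 n) t0 tT e1 e2 (ltW h1) hd'.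
by rewrite mul1r -/K0.
Qed.

Lemma Q_open (z : C) : Q z -> exists2 r : R, 0 < r & forall h, l1 h < r -> Q (z + h).
Proof.
move=> [h1 h2]; exists (Num.min ((Re z - `|Im z|) / 2) ((1 - Re z - `|Im z|) / 2)).
  by rewrite lt_min; apply/andP; split; lra.
move=> h; rewrite lt_min => /andP[r1 r2].
have a := l1_Re h; have b := l1_Im h.
have c : `|Im z + Im h| <= `|Im z| + `|Im h| by exact: ler_normD.
have e1 := ler_norm (Re h); have := ler_norm (- Re h); rewrite normrN => e2.
by split; rewrite /= Re_add Im_add; rewrite /l1 in r1 r2 a b; lra.
Qed.

End analyticity.

(** * Reachable states *)

Section reachable.
Context {R : realType}.
Local Notation C := (R[i]).
Local Notation Re := complex.Re.
Local Notation Im := complex.Im.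
Local Notation RT := (measurableTypeR R).
Local Notation mu := (@lebesgue_measure R).
Variables (T : R) (T0 : 0 < T).
Local Notation D := (`]0%R, T[%classic : set RT).

Let mD : measurable D. Proof. exact: measurable_itv. Qed.
Let Dfin : (mu D < +oo)%E. Proof. exact: mu_itv_fin. Qed.

Lemma L2C_L2dom (u : R -> C) : L2C T u <-> L2dom (X := RT) mu D u.
Proof. by split => [[m1 m2 i]|[[m1 m2] i]]; split. Qed.

Definition pairing (g u : R -> C) : C := cint (X := RT) mu D (fun s => g s * u s).

(** Bounded measurable functions can be integrated against every control. *)
Definition test_fun (g : R -> C) :=
  cmeas (X := RT) D g /\ exists B : R, forall s, D s -> l1 (g s) <= B.

Lemma pairing_integrable g u : test_fun g -> L2C T u ->
  cintegrable (X := RT) mu D (fun s => g s * u s).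
Proof. by move=> [mg [B hB]] /L2C_L2dom du; exact: (L2_mul_bounded mD Dfin du mg hB). Qed.

Lemma test_fun_dxtheta (z : C) : Qinf z -> test_fun (fun s => dxtheta z (T - s)).
Proof.
by move=> hz; split; [exact: cmeas_dxtheta|exact: dxtheta_bounded].
Qed.

Lemma test_funD g h : test_fun g -> test_fun h -> test_fun (fun s => g s + h s).
Proof.
move=> [mg [B hB]] [mh [B' hB']]; split; first exact: cmeasD.
by exists (B + B') => s Ds; apply: le_trans (l1D _ _) (lerD (hB s Ds) (hB' s Ds)).
Qed.

Lemma test_funZ c g : test_fun g -> test_fun (fun s => c * g s).
Proof.
move=> [mg [B hB]]; split; first by apply: cmeasM => //; exact: cmeas_cst.
by exists (l1 c * B) => s Ds; apply: l1M_le => //; exact: hB.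
Qed.

Lemma test_fun_L2C g : test_fun g -> L2C T g.
Proof. by move=> [mg [B hB]]; apply/L2C_L2dom; exact: (L2_bounded mD Dfin mg hB). Qed.

Lemma L2C_lin (a : C) (u v : R -> C) : L2C T u -> L2C T v ->
  L2C T (fun s => a * u s + v s).
Proof. by move=> /L2C_L2dom du /L2C_L2dom dv; apply/L2C_L2dom; exact: L2dom_lin. Qed.

Lemma L2C_0 : L2C T (fun=> 0).
Proof. by apply/L2C_L2dom; exact: L2dom0. Qed.

Lemma pairing_lin g (a : C) u v : test_fun g -> L2C T u -> L2C T v ->
  pairing g (fun s => a * u s + v s) = a * pairing g u + pairing g v.
Proof.
move=> tg du dv; have i1 := pairing_integrable tg du; have i2 := pairing_integrable tg dv.
rewrite /pairing -cintegralZ// -cintegralD//; last exact: cintegrableZ.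
by congr cint; apply/funext => s; ring.
Qed.

Lemma pairing_lin_l (a : C) g h u : test_fun g -> test_fun h -> L2C T u ->
  pairing (fun s => a * g s + h s) u = a * pairing g u + pairing h u.
Proof.
move=> tg th du; have i1 := pairing_integrable tg du; have i2 := pairing_integrable th du.
rewrite /pairing -cintegralZ// -cintegralD//; last exact: cintegrableZ.
by congr cint; apply/funext => s; ring.
Qed.

Lemma pairingZ_l (a : C) g u : test_fun g -> L2C T u ->
  pairing (fun s => a * g s) u = a * pairing g u.
Proof.
move=> tg du; rewrite /pairing -cintegralZ//; last exact: pairing_integrable.
by congr cint; apply/funext => s; rewrite mulrA.
Qed.

Lemma L2C_scale (a : C) u : L2C T u -> L2C T (fun s => a * u s).
Proof.
move=> du; rewrite (_ : (fun s => _) = (fun s => a * u s + 0)).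
  exact: L2C_lin du L2C_0.
by apply/funext => s; rewrite addr0.
Qed.

Lemma pairingZ_r g (a : C) u : test_fun g -> L2C T u ->
  pairing g (fun s => a * u s) = a * pairing g u.
Proof.
move=> tg du; rewrite -pairingZ_l// /pairing.
by congr cint; apply/funext => s; rewrite mulrCA mulrA.
Qed.

Lemma pairing0 g : pairing g (fun=> 0) = 0.
Proof.
have -> : pairing g (fun=> 0) = cint (X := RT) mu D (fun=> 0 * 0).
  by congr cint; apply/funext => s; rewrite !mulr0.
rewrite cintegralZ ?mul0r//; apply: (bounded_cintegrable mD Dfin (c := 0)).
  exact: cmeas_cst.
by move=> t _; rewrite /l1/= normr0 addr0.
Qed.

Lemma heat_solutionE ul ur z : heat_solution ul ur z T =
  - 2 * pairing (fun s => dxtheta z (T - s)) ul +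
  2 * pairing (fun s => dxtheta (z - 1) (T - s)) ur.
Proof. by []. Qed.

Lemma set_val_Qinf (z : @Qinf R) : Qinf (set_val z).
Proof. exact: set_valP. Qed.

Lemma final_state_lin (a : C) ul ur vl vr :
  L2C T ul -> L2C T ur -> L2C T vl -> L2C T vr ->
  final_state T (fun s => a * ul s + vl s) (fun s => a * ur s + vr s) =
  (fun z => a * final_state T ul ur z + final_state T vl vr z).
Proof.
move=> *; apply/funext => z; rewrite /final_state !heat_solutionE.
have hz := set_val_Qinf z.
have t1 := test_fun_dxtheta hz; have t2 := test_fun_dxtheta (Qinf_sub1 hz).
by rewrite !pairing_lin//; ring.
Qed.

(** Both symmetric classes of controls at once: the right control is - sg times
    the left one, with sg = 1 for reach_plus and sg = -1 for reach_minus. *)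
Definition reach_sign (sg : C) : set (Qinf -> C) :=
  [set f | exists2 u, L2C T u & f = final_state T u (fun s => - sg * u s)].

Lemma reach_plusE : reach_plus T = reach_sign 1.
Proof.
apply/seteqP; split => f.
  move=> [ul [ur [dl dr -> ->]]]; exists ul => //; congr final_state.
  by apply/funext => s /=; rewrite mulN1r.
move=> [u du ->]; exists u, (- u); split => //.
  have := L2C_scale (-1) du.
  by rewrite (_ : (fun s => _) = - u)//; apply/funext => s; rewrite mulN1r.
by congr final_state; apply/funext => s /=; rewrite mulN1r.
Qed.

Lemma reach_minusE : reach_minus T = reach_sign (-1).
Proof.
apply/seteqP; split => f.
  move=> [ul [ur [dl dr -> ->]]]; exists ul => //; congr final_state.
  by apply/funext => s /=; rewrite opprK mul1r.
move=> [u du ->]; exists u, u; split => //.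
by congr final_state; apply/funext => s /=; rewrite opprK mul1r.
Qed.

(** By 2-periodicity dxtheta (z - 1) is dxtheta (z + 1), so up to the factor - 2
    the state at z pairs the left control with this function. *)
Definition sign_feature (sg z : C) : R -> C :=
  fun s => sg * dxtheta (z + 1) (T - s) + dxtheta z (T - s).

Lemma test_sign_feature sg z : Qinf z -> test_fun (sign_feature sg z).
Proof.
move=> hz; apply: test_funD; last exact: test_fun_dxtheta.
by apply: test_funZ; apply/test_fun_dxtheta/Qinf_add1.
Qed.

Lemma final_state_sign (sg : C) u (z : Qinf) : L2C T u ->
  final_state T u (fun s => - sg * u s) z = - 2 * pairing (sign_feature sg (set_val z)) u.
Proof.
move=> du; rewrite /final_state heat_solutionE.
have hz := set_val_Qinf z; have h1 := Qinf_add1 hz.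
rewrite /sign_feature pairing_lin_l//; [|exact: test_fun_dxtheta..].
rewrite pairingZ_r//; last exact/test_fun_dxtheta/Qinf_sub1.
have -> : (fun s => dxtheta (set_val z - 1) (T - s)) =
    (fun s => dxtheta (set_val z + 1) (T - s)).
  by apply/funext => s; rewrite dxtheta_shift.
move: (pairing _ _) (pairing _ _) => a b; ring.
Qed.

(** Translating by 1 exchanges the two terms of sign_feature.  Thus the states in
    reach_plus have period 1, while those in reach_minus change sign; this
    separates the two spaces. *)
Lemma sign_feature_shift (sg z : C) : sg * sg = 1 ->
  sign_feature sg (z + 1) = fun s => sg * sign_feature sg z s.
Proof.
move=> sg2; apply/funext => s; rewrite /sign_feature dxtheta_shift addrK.
by rewrite mulrDr mulrA sg2 mul1r addrC.
Qed.

Lemma reach_sign_shift (sg : C) f (z z1 : Qinf) : sg * sg = 1 ->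
  set_val z1 = set_val z + 1 -> reach_sign sg f -> f z1 = sg * f z.
Proof.
move=> sg2 zz1 [u du ->]; rewrite !final_state_sign// zz1 sign_feature_shift//.
have hz := set_val_Qinf z.
rewrite pairingZ_l//; last exact: test_sign_feature.
by rewrite mulrCA.
Qed.

Lemma reach_sign0 (sg : C) : reach_sign sg 0.
Proof.
exists (fun=> 0); first exact: L2C_0.
apply/funext => z; rewrite final_state_sign//; last exact: L2C_0.
by rewrite pairing0 mulr0.
Qed.

Lemma reach_plus_minus0 : reach_plus T `&` reach_minus T = [set 0].
Proof.
rewrite reach_plusE reach_minusE; apply/seteqP; split => f; last first.
  by move=> ->; split; exact: reach_sign0.
move=> [fp fm]; apply/funext => z.
have h1 := Qinf_add1 (set_val_Qinf z).
pose z1 : Qinf := SigSub (mem_set h1).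
have e1 : set_val z1 = set_val z + 1 by rewrite set_valE.
have := reach_sign_shift (mulr1 1) e1 fp.
rewrite (reach_sign_shift _ e1 fm); last by rewrite mulrNN mulr1.
rewrite mulN1r mul1r => /eqP; rewrite eq_sym -subr_eq0 opprK -mulr2n.
by rewrite mulrn_eq0/= => /eqP.
Qed.

Lemma reach_decomposition :
  reach T = [set f + g | f in reach_plus T & g in reach_minus T].
Proof.
rewrite reach_plusE reach_minusE; apply/seteqP; split => f.
  move=> [ul [ur [dl dr ->]]].
  pose a s := 2^-1 * (-1 * ur s + ul s); pose b s := 2^-1 * (1 * ur s + ul s).
  have da : L2C T a.
    exact: L2C_scale (L2C_lin (-1) dr dl).
  have db : L2C T b.
    exact: L2C_scale (L2C_lin 1 dr dl).
  have da' : L2C T (fun s => -1 * a s).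
    exact: L2C_scale da.
  have db' : L2C T (fun s => - -1 * b s).
    exact: L2C_scale db.
  exists (final_state T a (fun s => -1 * a s)); first by exists a.
  exists (final_state T b (fun s => - -1 * b s)); first by exists b.
  have := final_state_lin 1 da da' db db'.
  have -> : (fun s => 1 * a s + b s) = ul.
    by apply/funext => s; rewrite /a /b; field.
  have -> : (fun s => 1 * (-1 * a s) + - -1 * b s) = ur.
    by apply/funext => s; rewrite /a /b; field.
  by move=> ->; apply/funext => z; rewrite mul1r.
move=> [_ [u du ->] [_ [v dv ->] <-]].
have du' : L2C T (fun s => -1 * u s).
  exact: L2C_scale du.
have dv' : L2C T (fun s => - -1 * v s).
  exact: L2C_scale dv.
exists (fun s => 1 * u s + v s), (fun s => 1 * (-1 * u s) + - -1 * v s); split.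
- exact: L2C_lin.
- exact: L2C_lin.
- by rewrite final_state_lin//; apply/funext => z; rewrite mul1r.
Qed.

Definition Ksign (sg z w : C) : C :=
  Kl T z w + Kl T (z + 1) (w + 1) + sg * Kl T (z + 1) w + sg * Kl T z (w + 1).

Lemma Ksign_gram (sg z w : C) : sg * sg = 1 -> sg^* = sg -> Qinf z -> Qinf w ->
  Ksign sg z w = cint (X := RT) mu D
    (fun s => (sign_feature sg w s)^* * sign_feature sg z s).
Proof.
move=> sg2 sgc hz hw.
have [hz1 hw1] := (Qinf_add1 hz, Qinf_add1 hw).
have i v v' : Qinf v -> Qinf v' -> cintegrable (X := RT) mu D
    (fun s => dxtheta v (T - s) * (dxtheta v' (T - s))^*).
  move=> hv hv'; apply: pairing_integrable; first exact: test_fun_dxtheta.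
  have [m [B hB]] := test_fun_dxtheta hv'.
  apply: test_fun_L2C; split; first exact: cmeas_conj.
  by exists B => s Ds; rewrite l1_conj; exact: hB.
have iZ v v' : Qinf v -> Qinf v' -> cintegrable (X := RT) mu D
    (fun s => sg * (dxtheta v (T - s) * (dxtheta v' (T - s))^*)).
  by move=> hv hv'; apply: cintegrableZ => //; exact: i.
rewrite /Ksign (Kl_integral T0 hz hw) (Kl_integral T0 hz1 hw1).
rewrite (Kl_integral T0 hz1 hw) (Kl_integral T0 hz hw1).
rewrite -(cintegralZ mD sg (i _ _ hz1 hw)) -(cintegralZ mD sg (i _ _ hz hw1)).
have [h1 h2] := (i _ _ hz hw, i _ _ hz1 hw1).
have [h3 h4] := (iZ _ _ hz1 hw, iZ _ _ hz hw1).
have h12 := cintegrableD mD h1 h2; have h123 := cintegrableD mD h12 h3.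
rewrite -(cintegralD mD h1 h2) -(cintegralD mD h12 h3) -(cintegralD mD h123 h4).
congr cint; apply/funext => s; rewrite /sign_feature.
have -> (a b : C) : (sg * a + b)^* = sg * a^* + b^* :> C.
  by rewrite rmorphD rmorphM/= [X in X * _]sgc.
move: (dxtheta _ _) (dxtheta _ _) (_^*) (_^*) => a b c e.
rewrite -[a * c]mul1r -sg2; ring.
Qed.

(** The conjugate turns the pairing into an inner product. *)
Definition sign_conj_feature (sg : C) (z : @Q R) : R -> C^o :=
  fun s => (sign_feature sg (set_val z) s)^*.

Lemma Q_Qinf (z : @Q R) : Qinf (set_val z).
Proof. by apply: Q_sub_Qinf; exact: set_valP. Qed.

Lemma sign_conj_feature_dom sg z : L2dom (X := RT) mu D (sign_conj_feature sg z).
Proof.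
have [m [B hB]] := test_sign_feature sg (Q_Qinf z).
apply: (L2_bounded mD Dfin (c := B)); first exact: cmeas_conj.
by move=> s Ds; rewrite l1_conj; exact: hB.
Qed.

Definition sign_space sg : hilbert_fun (@Q R) :=
  feature_space (H := L2space mD Dfin) (sign_conj_feature_dom sg).

(** The states are - 2 times the pairings, so that the control - u / 2 produces
    the function paired with u: the factor changes the norm, not the space. *)
Lemma sign_spaceP sg : sg * sg = 1 -> sg^* = sg ->
  analytic_rkhs (on_Q (Ksign sg)) (sign_space sg) /\
  hcarrier (sign_space sg) = restrictQ @` reach_sign sg.
Proof.
move=> sg2 sgc.
have fmE u : feature_map (L2space mD Dfin) (sign_conj_feature sg) u =
    fun z => pairing (sign_feature sg (set_val z)) u.
  apply/funext => z; rewrite /feature_map/= /L2ip /pairing; congr cint.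
  by apply/funext => s; rewrite conjCK mulrC.
have restE u (z : Q) : L2C T u ->
    restrictQ (final_state T u (fun s => - sg * u s)) z =
    - 2 * pairing (sign_feature sg (set_val z)) u.
  by move=> du; rewrite /restrictQ/= final_state_sign// !set_valE.
split; last first.
  apply/seteqP; split => f.
    move=> [u /L2C_L2dom du <-].
    exists (final_state T (fun s => - 2^-1 * u s) (fun s => - sg * (- 2^-1 * u s))).
      by exists (fun s => - 2^-1 * u s) => //; exact: L2C_scale.
    apply/funext => z; rewrite restE; last exact: L2C_scale.
    by rewrite pairingZ_r ?fmE//; [field|exact/test_sign_feature/Q_Qinf].
  move=> [_ [u du ->] <-]; exists (fun s => - 2 * u s : C^o).
    by apply/L2C_L2dom; exact: L2C_scale.
  by apply/funext => z; rewrite fmE restE// pairingZ_r//; exact/test_sign_feature/Q_Qinf.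
split; last first.
  have := feature_space_kernel (H := L2space mD Dfin) (sign_conj_feature_dom sg).
  congr reproducing_kernel; apply/funext => z; apply/funext => w.
  rewrite /on_Q Ksign_gram//; [|exact: Q_Qinf..].
  rewrite /= /L2ip; congr cint; apply/funext => s.
  by rewrite conjCK.
move=> _ [u du <-]; rewrite fmE.
apply: (analytic_taylor (F := fun z => pairing (sign_feature sg z) u)) => z Qz.
have hz := Q_sub_Qinf Qz.
have [r r0 hQ] := Q_open Qz.
have [g1 [B1 [K1 [r1 [m1 b1 r10 K10 t1]]]]] := dxtheta_taylor T0 hz.
have [g2 [B2 [K2 [r2 [m2 b2 r20 K20 t2]]]]] := dxtheta_taylor T0 (Qinf_add1 hz).
have d1 : test_fun g1 by split => //; exists B1.
have d2 : test_fun g2 by split => //; exists B2.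
pose g s := sg * g2 s + g1 s.
have dg : test_fun g by apply: test_funD => //; exact: test_funZ.
have du' : L2C T u by exact/L2C_L2dom.
have Iu : cintegrable (X := RT) mu D u.
  have t : test_fun (fun=> 1).
    by split; [exact: cmeas_cst|exists 1 => s _; rewrite /l1/= normr1 normr0 addr0].
  have := pairing_integrable t du'; congr cintegrable.
  by apply/funext => s; rewrite mul1r.
have Iu1 := cintegrable_l1 mD Iu.
have I0 : 0 <= \int[mu]_(s in D) l1 (u s) by apply: Rintegral_ge0 => s _; exact: l1_ge0.
pose K := l1 sg * K2 + K1.
have K0 : 0 <= K by rewrite addr_ge0// mulr_ge0// l1_ge0.
exists (pairing g u), (2 * (K * \int[mu]_(s in D) l1 (u s))), (Num.min r (Num.min r1 r2)).
split; [by rewrite !lt_min r0 r10|by rewrite !mulr_ge0|].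
move=> h; rewrite !lt_min => /and3P[hr hr1 hr2]; split; first exact: hQ.
have hzh := Q_sub_Qinf (hQ h hr).
have E : pairing (sign_feature sg (z + h)) u - pairing (sign_feature sg z) u - h * pairing g u =
   cint (X := RT) mu D (fun s => (sign_feature sg (z + h) s - sign_feature sg z s - h * g s) * u s).
  have i1 := pairing_integrable (test_sign_feature sg hzh) du'.
  have i2 := pairing_integrable (test_sign_feature sg hz) du'.
  have i3 := pairing_integrable dg du'.
  rewrite /pairing -cintegralZ// -!cintegralB//; last 2 first.
  - by apply: cintegrableD => //; exact: cintegrableN.
  - exact: cintegrableZ.
  by congr cint; apply/funext => s; ring.
rewrite E.
have mall : cmeas (X := RT) D (fun s => (sign_feature sg (z + h) s - sign_feature sg z s - h * g s) * u s).
  apply: cmeasM; last by case: du.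
  apply: cmeasD; [apply: cmeasD|apply: cmeasN; apply: cmeasM].
  - by case: (test_sign_feature sg hzh).
  - by apply: cmeasN; case: (test_sign_feature sg hz).
  - exact: cmeas_cst.
  - by case: dg.
have IK : mu.-integrable D (EFin \o (fun s => (K * l1 h ^+ 2) * l1 (u s))).
  exact: integrable_mulr.
apply: le_trans (l1_cintegral mD mall IK _) _.
  move=> s Ds; apply: l1M_le => //.
  have -> : sign_feature sg (z + h) s - sign_feature sg z s - h * g s =
    sg * (dxtheta (z + 1 + h) (T - s) - dxtheta (z + 1) (T - s) - h * g2 s) +
    (dxtheta (z + h) (T - s) - dxtheta z (T - s) - h * g1 s).
    by rewrite /sign_feature /g (addrAC z h 1); ring.
  apply: le_trans (l1D _ _) _; rewrite [leRHS]mulrDl; apply: lerD.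
    rewrite -mulrA; apply: l1M_le => //; apply: t2 => //.
    by rewrite addrAC; exact: Qinf_add1.
  exact: t1.
rewrite RintegralZl//; rewrite le_eqVlt; apply/orP; left; apply/eqP; ring.
Qed.

End reachable.

Lemma KplusE (R : realType) (T : R) : Kplus T = Ksign T 1.
Proof. by apply/funext => z; apply/funext => w; rewrite /Kplus /Ksign !mul1r. Qed.

Lemma KminusE (R : realType) (T : R) : Kminus T = Ksign T (-1).
Proof. by apply/funext => z; apply/funext => w; rewrite /Kminus /Ksign !mulN1r. Qed.

Theorem theorem4 (R : realType) (T : R) (T_gt0 : 0 < T) :
  [/\ @reach R T = [set f + g | f in reach_plus T & g in reach_minus T],
      @reach_plus R T `&` reach_minus T = [set 0],
      exists Hp, analytic_rkhs (@on_Q R (Kplus T)) Hp,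
      exists Hm, analytic_rkhs (@on_Q R (Kminus T)) Hm
    & forall Hp Hm : hilbert_fun (@Q R),
        analytic_rkhs (on_Q (Kplus T)) Hp ->
        analytic_rkhs (on_Q (Kminus T)) Hm ->
        restrictQ @` reach T = [set f + g | f in hcarrier Hp & g in hcarrier Hm] /\
        exists H : hilbert_fun (@Q R),
          [/\ hcarrier H = restrictQ @` reach T,
              forall f, hcarrier H f -> is_min (decomposition_norms Hp Hm f)
                                      (hnorm H f ^+ 2)
            & reproducing_kernel H
                (on_Q (fun z w => 2 * Kl T z w + 2 * Kl T (z + 1) (w + 1)))]].
Proof.
have [Ap Cp] : analytic_rkhs (on_Q (Kplus T)) (sign_space T_gt0 1) /\
    hcarrier (sign_space T_gt0 1) = restrictQ @` reach_plus T.
  rewrite KplusE reach_plusE; apply: sign_spaceP; first exact: mulr1.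
  exact: rmorph1.
have [Am Cm] : analytic_rkhs (on_Q (Kminus T)) (sign_space T_gt0 (-1)) /\
    hcarrier (sign_space T_gt0 (-1)) = restrictQ @` reach_minus T.
  rewrite KminusE reach_minusE; apply: sign_spaceP; first by rewrite mulrNN mulr1.
  exact: rmorphN1.
split.
- exact: reach_decomposition.
- exact: reach_plus_minus0.
- by eexists; exact: Ap.
- by eexists; exact: Am.
move=> Hp Hm [_ rp] [_ rm].
have cp : hcarrier Hp = restrictQ @` reach_plus T.
  by rewrite -Cp; apply: reproducing_kernel_carrier rp _; exact: Ap.2.
have cm : hcarrier Hm = restrictQ @` reach_minus T.
  by rewrite -Cm; apply: reproducing_kernel_carrier rm _; exact: Am.2.
have E : restrictQ @` reach T = [set f + g | f in hcarrier Hp & g in hcarrier Hm].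
  rewrite cp cm reach_decomposition//; apply/seteqP; split => F.
    move=> [_ [f hf [g hg <-]] <-].
    by exists (restrictQ f); [exists f|exists (restrictQ g); [exists g|]].
  move=> [_ [f hf <-] [_ [g hg <-] <-]].
  by exists (f + g) => //; exists f => //; exists g.
split => //.
have [H [cH nH kH]] := reproducing_kernel_sum rp rm.
exists H; split => //; first by rewrite cH E.
move: kH; congr reproducing_kernel; apply/funext => z; apply/funext => w.
by rewrite /on_Q /Kplus /Kminus; ring.
Qed.
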